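(* Fix $a\in\mathbb{C}$ nonzero, and let $\varepsilon=\pm1$. The function $$\mathfrak{u}(t):=\frac14\mathrm{i}\varepsilon t\,\Psi\cdot\left(\Psi^*+t\frac{\mathrm{d}\Psi^*}{\mathrm{d}t}\right),\quad t\in\mathbb{R},\quad \Psi=\Psi(0,t^2;\mathbf{G}(a,a)),$$ satisfies the Painlev\'e-III (D$_7$) equation in the form $$\frac{\mathrm{d}^2\mathfrak{u}}{\mathrm{d}t^2}=\frac{1}{\mathfrak{u}}\left(\frac{\mathrm{d}\mathfrak{u}}{\mathrm{d}t}\right)^2-\frac1t\frac{\mathrm{d}\mathfrak{u}}{\mathrm{d}t}+\frac{-8\varepsilon\mathfrak{u}^2+2\mathscr{A}\mathscr{B}}{t}+\frac{\mathscr{B}^2}{\mathfrak{u}}$$ with parameters $\mathscr{A}=\frac12\mathrm{i}$ and $\mathscr{B}=4\varepsilon$.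
   Context: Notation: $*$ is complex conjugation; $\sigma_3=\mathrm{diag}(1,-1)$; $\mathrm{e}^{f\sigma_3}=\mathrm{diag}(\mathrm{e}^{f},\mathrm{e}^{-f})$. For $(a,b)\in\mathbb{C}^2\setminus\{(0,0)\}$ let $$\mathbf{G}(a,b)=\frac{1}{\sqrt{|a|^2+|b|^2}}\begin{bmatrix}a & b^*\\ -b & a^*\end{bmatrix}.$$ For $(X,T)\in\mathbb{R}^2$ and $\mathbf{G}=\mathbf{G}(a,b)$, $\mathbf{P}(\Lambda;X,T,\mathbf{G})$ denotes the unique (it is known to exist and to depend real-analytically on $(X,T)$) $2\times 2$ matrix function of $\Lambda$ such that: (i) it is analytic for $|\Lambda|\neq 1$ and takes continuous boundary values on the unit circle from the interior and from the exterior; (ii) writing $\mathbf{P}_+$ (resp. $\mathbf{P}_-$) for the boundary value on $|\Lambda|=1$ from the exterior (resp. interior), $$\mathbf{P}_+=\mathbf{P}_-\,\mathrm{e}^{-\mathrm{i}(\Lambda X+\Lambda^2T+2\Lambda^{-1})\sigma_3}\,\mathbf{G}\,\mathrm{e}^{\mathrm{i}(\Lambda X+\Lambda^2T+2\Lambda^{-1})\sigma_3},\quad |\Lambda|=1;$$ (iii) $\mathbf{P}\to\mathbb{I}$ as $\Lambda\to\infty$. Then $\Psi(X,T;\mathbf{G}):=2\mathrm{i}\lim_{\Lambda\to\infty}\Lambda P_{12}(\Lambda;X,T,\mathbf{G})$. *)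

(* Defs.v *)
From Stdlib Require Import Reals.
From Coquelicot Require Import Coquelicot.

Local Open Scope C_scope.

Definition M2 : Type := @matrix C 2 2.

(** Indices start at 0, so that P_12 is [entry P 0 1]. *)
Definition entry (M : M2) (i j : nat) : C := coeff_mat (RtoC 0) M i j.

Definition mul2 (M N : M2) : M2 := @Mmult C_Ring 2 2 2 M N.

Definition Cexp (z : C) : C :=
  RtoC (exp (Re z)) * (cos (Im z), sin (Im z)).

(** exp (f sigma_3), with sigma_3 = diag(1,-1) *)
Definition exp_sigma3 (f : C) : M2 :=
  [[ Cexp f, RtoC 0 ], [ RtoC 0, Cexp (- f) ]].

Definition Gmat (a b : C) : M2 :=
  let k := RtoC (/ sqrt (Cmod a ^ 2 + Cmod b ^ 2))%R in
  [[ k * a, k * Cconj b ], [ k * - b, k * Cconj a ]].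

Definition phase (X T : R) (L : C) : C :=
  L * RtoC X + L ^ 2 * RtoC T + 2 * / L.

Definition jump (G : M2) (X T : R) (L : C) : M2 :=
  mul2 (mul2 (exp_sigma3 (- Ci * phase X T L)) G)
       (exp_sigma3 (Ci * phase X T L)).

Definition analytic_at (f : C -> C) (z0 : C) : Prop :=
  exists (r : posreal) (c : nat -> C), forall z : C, (Cmod (z - z0) < r)%R ->
    @is_pseries C_AbsRing C_NormedModule c (z - z0) (f z).

(** The filter of neighbourhoods of the point at infinity of the complex plane. *)
Definition C_infty (S : C -> Prop) : Prop :=
  exists M : R, forall z : C, (M < Cmod z)%R -> S z.

(** [Q] is the boundary value at [zeta] of [P] restricted to the region [D]. *)
Definition boundary_value (D : C -> Prop) (P : C -> M2) (zeta : C) (Q : M2)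
  : Prop :=
  forall i j : nat, (i < 2)%nat -> (j < 2)%nat ->
    filterlim (fun L : C => entry (P L) i j) (within D (locally zeta))
      (locally (entry Q i j)).

Definition continuous_on_circle (Q : C -> M2) : Prop :=
  forall i j : nat, (i < 2)%nat -> (j < 2)%nat ->
  forall zeta : C, Cmod zeta = 1%R ->
    filterlim (fun z : C => entry (Q z) i j)
      (within (fun z : C => Cmod z = 1%R) (locally zeta))
      (locally (entry (Q zeta) i j)).

(** The values of [P] on the unit circle itself are irrelevant. *)
Definition solves_RHP (G : M2) (X T : R) (P : C -> M2) : Prop :=
  (forall i j : nat, (i < 2)%nat -> (j < 2)%nat ->
   forall L : C, Cmod L <> 1%R -> analytic_at (fun z => entry (P z) i j) L)
  /\
  (exists Pplus Pminus : C -> M2,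
     continuous_on_circle Pplus /\ continuous_on_circle Pminus /\
     forall L : C, Cmod L = 1%R ->
       boundary_value (fun z : C => (1 < Cmod z)%R) P L (Pplus L) /\
       boundary_value (fun z : C => (Cmod z < 1)%R) P L (Pminus L) /\
       Pplus L = mul2 (Pminus L) (jump G X T L))
  /\
  (forall i j : nat, (i < 2)%nat -> (j < 2)%nat ->
     filterlim (fun L : C => entry (P L) i j) C_infty
       (locally (if Nat.eqb i j then RtoC 1 else RtoC 0))).

(** Real-analyticity in (X,T) of the matrix function [P X T] of [L] with
    [Cmod L <> 1], as a function-valued map: near every (X0,T0) it is the sum of
    a power series in (X - X0, T - T0) whose coefficients are functions of [L]
    and whose convergence is uniform in [L].  The Cauchy-type bound makes the
    double series absolutely convergent, so that it may be summed iteratively. *)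
Definition real_analytic_dependence (P : R -> R -> C -> M2) : Prop :=
  forall i j : nat, (i < 2)%nat -> (j < 2)%nat ->
  forall X0 T0 : R,
  exists (r : posreal) (M : R) (c : nat -> nat -> C -> C),
  forall L : C, Cmod L <> 1%R ->
    (forall m n : nat, (Cmod (c m n L) * r ^ (m + n) <= M)%R) /\
    (forall X T : R, (Rabs (X - X0) < r)%R -> (Rabs (T - T0) < r)%R ->
     exists s : nat -> C,
       (forall m : nat,
          @is_series C_AbsRing C_NormedModule
            (fun n : nat => c m n L * RtoC ((T - T0) ^ n)) (s m)) /\
       @is_series C_AbsRing C_NormedModule
         (fun m : nat => s m * RtoC ((X - X0) ^ m)) (entry (P X T L) i j)).

(** 2 i lim_{L -> oo} L P_12(L) *)
Definition Psi_of (P : C -> M2) : C :=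
  2 * Ci * @iota C_R_CompleteNormedModule (fun l : C =>
    filterlim (fun L : C => L * entry (P L) 0 1) C_infty (locally l)).

(** Differentiability and derivative of a complex-valued function of a real
    variable; [Cderiv f t] is meaningful when [Cdifferentiable f t] holds. *)
Definition Cdifferentiable (f : R -> C) (t : R) : Prop :=
  @ex_derive R_AbsRing C_R_NormedModule f t.

Definition Cderiv (f : R -> C) (t : R) : C :=
  (Derive (fun s : R => Re (f s)) t, Derive (fun s : R => Im (f s)) t).

Definition u_of (eps : R) (psi : R -> C) (t : R) : C :=
  RtoC (/ 4)%R * Ci * RtoC eps * RtoC t * psi t *
  (Cconj (psi t) + RtoC t * Cderiv (fun s : R => Cconj (psi s)) t).

Definition PIII_D7_eq (eps : R) (A B : C) (u : R -> C) (t : R) : Prop :=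
  Cderiv (Cderiv u) t =
    / u t * Cderiv u t ^ 2 - / RtoC t * Cderiv u t
    + (- 8 * RtoC eps * u t ^ 2 + 2 * A * B) / RtoC t
    + B ^ 2 / u t.

(* Main.v *)
(** Write [P e^{-i theta sigma_3}], at [X = 0], as a function with the constant
    jump matrix [G].  The exterior product of two rows with this jump has no jump,
    so its mean values over circles outside and inside the unit circle agree.  The
    first row [(p, q)] of [P] yields new rows by changing [T], by rotating the
    variable, by Schwarz reflection, and, as [b = a], by [z -> -z].  Let
    [p(0)] be the value at the origin and [beta] the coefficient of [1/z] in [q] at
    infinity, so that [Psi = 2 i beta].  Evaluating the mean values for pairs of
    such rows, and dividing by the increment of [T] or of the angle, gives
    [|p(0)|^2 = 1/2], [p(0)_T = 2 i |beta|^2 p(0)] and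
    [beta + 2 T beta_T = - 4 i p(0)^2].  With [T = t^2] and [x = p(0)] this reads
    [(t Psi)' = 8 x^2], [x' = i t |Psi|^2 x], hence
    [u = 2 i eps t Psi (x^* )^2], [u' = 4 i eps - 2 i t |Psi|^2 u], and the
    Painleve equation follows by differentiating once more.  Changes
    of [T] and rotations preserve the unit circle, which is why continuity of [P]
    up to the circle suffices for the exterior products. *)

Require Import Defs.
From Stdlib Require Import Reals Lra Lia ClassicalEpsilon FunctionalExtensionality.
From Coquelicot Require Import Coquelicot.

Local Open Scope C_scope.

(** The usual derivation differentiates [P e^{-i theta sigma_3}] in [T] and in [z] and identifies
    the logarithmic derivatives by Liouville's theorem. Here [P] is only continuous up to the unit
    circle, so its derivatives have no boundary values to start from. Hence finite increments: for
    each increment [h] the exterior product of two rows gives an exact equality of mean values, and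
    [h] tends to 0 only afterwards, on circles of radius 2 and 1/2, where everything is holomorphic.
    The jump disappears because [det G = 2 g conj g = 1]. The pairs of rows are chosen to tame the
    essential singularities of [e^{i theta}], [theta = T z^2 + 2/z]. For two values of [T] the term
    [2/z] cancels and the inner mean is the value at 0. For reflection combined with [z -> -z], only
    [4/z] survives outside and only [2 T z^2] inside, so both means are explicit; together with
    reflection alone this forces [q(0) = - p(0)]. The equation for [beta] comes from two relations,
    for an increment of [T] and for one of the angle; both contain the unknown integral of
    [z^3 p q], which is eliminated. *)

Lemma Cmod_minus_sym (x y : C) : Cmod (x - y) = Cmod (y - x).
Proof. replace (x - y) with (- (y - x)) by ring. apply Cmod_opp. Qed.

Lemma Cmod_triangle_minus (x y : C) : (Cmod x <= Cmod (x - y) + Cmod y)%R.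
Proof. replace x with ((x - y) + y) at 1 by ring. apply Cmod_triangle. Qed.

Lemma Im_le_Cmod (z : C) : (Rabs (Im z) <= Cmod z)%R.
Proof. eapply Rle_trans; [ apply Rmax_r | apply (Rmax_Cmod z) ]. Qed.

Lemma Cmod_le_re_im (z : C) : (Cmod z <= Rabs (Re z) + Rabs (Im z))%R.
Proof.
  replace z with (RtoC (Re z) + Ci * RtoC (Im z)) at 1
    by (destruct z as [x y]; apply injective_projections; simpl; ring).
  eapply Rle_trans; [ apply Cmod_triangle | ].
  rewrite Cmod_mult, Cmod_Ci, !Cmod_R. lra.
Qed.

(** * Strict complex differentiability and continuity *)

(** Strict complex differentiability: on an open set it amounts to holomorphy,
    it contains the continuity of the derivative, and it is read off at the
    centre of a power series. *)
Definition sderiv (f : C -> C) (z0 l : C) : Prop :=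
  forall eps : R, (0 < eps)%R -> exists d : R, (0 < d)%R /\
    forall z w : C, (Cmod (z - z0) < d)%R -> (Cmod (w - z0) < d)%R ->
      (Cmod (f z - f w - l * (z - w)) <= eps * Cmod (z - w))%R.

Definition hol (f : C -> C) (z0 : C) : Prop := exists l, sderiv f z0 l.

Definition ccont (f : C -> C) (z0 : C) : Prop :=
  forall eps : R, (0 < eps)%R -> exists d : R, (0 < d)%R /\
    forall z : C, (Cmod (z - z0) < d)%R -> (Cmod (f z - f z0) < eps)%R.

Lemma sderiv_lip f z0 l : sderiv f z0 l -> exists d : R, (0 < d)%R /\
  forall z w, (Cmod (z - z0) < d)%R -> (Cmod (w - z0) < d)%R ->
  (Cmod (f z - f w) <= (Cmod l + 1) * Cmod (z - w))%R.
Proof.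
  intros H. destruct (H 1%R Rlt_0_1) as [d [Hd Hf]]. exists d; split; [ easy | ].
  intros z w Hz Hw. specialize (Hf z w Hz Hw).
  pose proof (Cmod_triangle_minus (f z - f w) (l * (z - w))) as Ht.
  rewrite Cmod_mult in Ht. lra.
Qed.

Lemma hol_ccont f z0 : hol f z0 -> ccont f z0.
Proof.
  intros [l H] eps He. destruct (sderiv_lip _ _ _ H) as [d [Hd Hf]].
  pose proof (Cmod_ge_0 l) as Hl.
  exists (Rmin d (eps / (Cmod l + 1)))%R. split.
  { apply Rmin_pos; [ easy | apply Rdiv_lt_0_compat; lra ]. }
  intros z Hz.
  assert (H1 : (Cmod (z - z0) < d)%R) by (eapply Rlt_le_trans; [ apply Hz | apply Rmin_l ]).
  assert (H2 : (Cmod (z - z0) < eps / (Cmod l + 1))%R)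
    by (eapply Rlt_le_trans; [ apply Hz | apply Rmin_r ]).
  assert (H0 : (Cmod (z0 - z0) < d)%R).
  { replace (z0 - z0) with (RtoC 0) by ring. now rewrite Cmod_0. }
  eapply Rle_lt_trans; [ apply (Hf z z0 H1 H0) | ].
  apply Rlt_div_r in H2; lra.
Qed.

Lemma hol_ext_loc f g z0 (d : R) : (0 < d)%R ->
  (forall z, (Cmod (z - z0) < d)%R -> f z = g z) -> hol f z0 -> hol g z0.
Proof.
  intros Hd E [l H]. exists l. intros eps He. destruct (H eps He) as [d' [Hd' Hf]].
  exists (Rmin d d'). split; [ now apply Rmin_pos | ].
  intros z w Hz Hw.
  rewrite <- !E by (eapply Rlt_le_trans; [ eassumption | apply Rmin_l ]).
  apply Hf; (eapply Rlt_le_trans; [ eassumption | apply Rmin_r ]).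
Qed.

Lemma hol_ext f g z0 : (forall z, f z = g z) -> hol f z0 -> hol g z0.
Proof. intros E. apply (hol_ext_loc f g z0 1%R Rlt_0_1). intros; apply E. Qed.

Lemma hol_const (c : C) z0 : hol (fun _ => c) z0.
Proof.
  exists (RtoC 0). intros eps He. exists 1%R. split; [ lra | ]. intros z w _ _.
  replace (c - c - 0 * (z - w)) with (RtoC 0) by ring. rewrite Cmod_0.
  apply Rmult_le_pos; [ lra | apply Cmod_ge_0 ].
Qed.

Lemma ccont_const (c z0 : C) : ccont (fun _ => c) z0.
Proof. apply hol_ccont, hol_const. Qed.

(** Relative continuity, applied with the closed exterior and the closed interior of the unit circle
    at points of the circle, because the boundary values of [P] are one-sided. *)
Definition ccont_in (D : C -> Prop) (f : C -> C) (z0 : C) : Prop :=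
  forall eps : R, (0 < eps)%R -> exists d : R, (0 < d)%R /\
    forall z : C, D z -> (Cmod (z - z0) < d)%R -> (Cmod (f z - f z0) < eps)%R.

Lemma ccont_in_ccont (D : C -> Prop) (f : C -> C) (z0 : C) : ccont f z0 -> ccont_in D f z0.
Proof. intros H eps He. destruct (H eps He) as [d [P B]]. exists d. split; auto. Qed.

Lemma ccont_in_ext (D : C -> Prop) (f g : C -> C) (z0 : C) :
  (forall z, f z = g z) -> ccont_in D f z0 -> ccont_in D g z0.
Proof.
  intros E H eps He. destruct (H eps He) as [d [P B]]. exists d. split; [ easy | ].
  intros z Dz Hz. rewrite <- !E. now apply B.
Qed.

Lemma ccont_in_plus (D : C -> Prop) (f g : C -> C) (z0 : C) :
  ccont_in D f z0 -> ccont_in D g z0 -> ccont_in D (fun z => f z + g z) z0.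
Proof.
  intros HF HG eps He.
  destruct (HF (eps / 2)%R) as [d1 [P1 B1]]; [ lra | ].
  destruct (HG (eps / 2)%R) as [d2 [P2 B2]]; [ lra | ].
  exists (Rmin d1 d2). split; [ now apply Rmin_pos | ]. intros z Dz Hz.
  specialize (B1 z Dz (Rlt_le_trans _ _ _ Hz (Rmin_l _ _))).
  specialize (B2 z Dz (Rlt_le_trans _ _ _ Hz (Rmin_r _ _))).
  replace (f z + g z - (f z0 + g z0)) with ((f z - f z0) + (g z - g z0)) by ring.
  eapply Rle_lt_trans; [ apply Cmod_triangle | lra ].
Qed.

Lemma ccont_in_mult (D : C -> Prop) (f g : C -> C) (z0 : C) :
  ccont_in D f z0 -> ccont_in D g z0 -> ccont_in D (fun z => f z * g z) z0.
Proof.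
  intros HF HG eps He. pose proof (Cmod_ge_0 (f z0)) as PF. pose proof (Cmod_ge_0 (g z0)) as PG.
  destruct (HF (Rmin 1 (eps / (2 * (Cmod (g z0) + 1))))%R) as [d1 [P1 B1]];
    [ apply Rmin_pos; [ lra | apply Rdiv_lt_0_compat; lra ] | ].
  destruct (HG (eps / (2 * (Cmod (f z0) + 1)))%R) as [d2 [P2 B2]];
    [ apply Rdiv_lt_0_compat; lra | ].
  exists (Rmin d1 d2). split; [ now apply Rmin_pos | ]. intros z Dz Hz.
  specialize (B1 z Dz (Rlt_le_trans _ _ _ Hz (Rmin_l _ _))).
  specialize (B2 z Dz (Rlt_le_trans _ _ _ Hz (Rmin_r _ _))).
  assert (B3 := Rlt_le_trans _ _ _ B1 (Rmin_l _ _)).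
  assert (B4 := Rlt_le_trans _ _ _ B1 (Rmin_r _ _)).
  apply Rlt_div_r in B4; [ | lra ]. apply Rlt_div_r in B2; [ | lra ].
  pose proof (Cmod_triangle_minus (f z) (f z0)) as T.
  replace (f z * g z - f z0 * g z0) with (f z * (g z - g z0) + (f z - f z0) * g z0) by ring.
  eapply Rle_lt_trans; [ apply Cmod_triangle | ]. rewrite !Cmod_mult.
  pose proof (Cmod_ge_0 (f z - f z0)). pose proof (Cmod_ge_0 (g z - g z0)).
  assert (Cmod (f z) * Cmod (g z - g z0) <= (Cmod (f z0) + 1) * Cmod (g z - g z0))%R
    by (apply Rmult_le_compat_r; lra).
  nra.
Qed.

Lemma ccont_in_opp (D : C -> Prop) (f : C -> C) (z0 : C) :
  ccont_in D f z0 -> ccont_in D (fun z => - f z) z0.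
Proof.
  intros H. apply (ccont_in_ext _ (fun z => - (1) * f z)); [ intros; ring | ].
  apply ccont_in_mult; [ apply ccont_in_ccont, ccont_const | easy ].
Qed.

Lemma ccont_in_True (f : C -> C) (z0 : C) : ccont_in (fun _ => True) f z0 -> ccont f z0.
Proof. intros H eps He. destruct (H eps He) as [d [P B]]. exists d. split; auto. Qed.

Lemma ccont_mult (F G : C -> C) (z0 : C) : ccont F z0 -> ccont G z0 -> ccont (fun z => F z * G z) z0.
Proof. intros HF HG. now apply ccont_in_True, ccont_in_mult; apply ccont_in_ccont. Qed.

Lemma ccont_minus (F G : C -> C) (z0 : C) : ccont F z0 -> ccont G z0 -> ccont (fun z => F z - G z) z0.
Proof.
  intros HF HG. apply ccont_in_True, ccont_in_plus; [ | apply ccont_in_opp ]; now apply ccont_in_ccont.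
Qed.

Lemma hol_id z0 : hol (fun z => z) z0.
Proof.
  exists (RtoC 1). intros eps He. exists 1%R. split; [ lra | ]. intros z w _ _.
  replace (z - w - 1 * (z - w)) with (RtoC 0) by ring. rewrite Cmod_0.
  apply Rmult_le_pos; [ lra | apply Cmod_ge_0 ].
Qed.

Lemma hol_plus f g z0 : hol f z0 -> hol g z0 -> hol (fun z => f z + g z) z0.
Proof.
  intros [l H] [m K]. exists (l + m). intros eps He.
  destruct (H (eps / 2)%R) as [d [Hd Hf]]; [ lra | ].
  destruct (K (eps / 2)%R) as [d' [Hd' Hg]]; [ lra | ].
  exists (Rmin d d'). split; [ now apply Rmin_pos | ]. intros z w Hz Hw.
  assert (Bf := Hf z w (Rlt_le_trans _ _ _ Hz (Rmin_l _ _)) (Rlt_le_trans _ _ _ Hw (Rmin_l _ _))).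
  assert (Bg := Hg z w (Rlt_le_trans _ _ _ Hz (Rmin_r _ _)) (Rlt_le_trans _ _ _ Hw (Rmin_r _ _))).
  replace (f z + g z - (f w + g w) - (l + m) * (z - w))
    with ((f z - f w - l * (z - w)) + (g z - g w - m * (z - w))) by ring.
  eapply Rle_trans; [ apply Cmod_triangle | lra ].
Qed.

Lemma hol_mult f g z0 : hol f z0 -> hol g z0 -> hol (fun z => f z * g z) z0.
Proof.
  intros Hf Hg. assert (Cf := hol_ccont _ _ Hf). assert (Cg := hol_ccont _ _ Hg).
  destruct Hf as [l H], Hg as [m K]. exists (l * g z0 + f z0 * m). intros eps He.
  pose proof (Cmod_ge_0 l) as Pl. pose proof (Cmod_ge_0 m) as Pm.
  pose proof (Cmod_ge_0 (f z0)) as Pf. pose proof (Cmod_ge_0 (g z0)) as Pg.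
  destruct (H (eps / (4 * (Cmod (g z0) + 1)))%R) as [d1 [Hd1 H1]];
    [ apply Rdiv_lt_0_compat; lra | ].
  destruct (K (eps / (4 * (Cmod (f z0) + 1)))%R) as [d2 [Hd2 H2]];
    [ apply Rdiv_lt_0_compat; lra | ].
  destruct (Cf (Rmin 1 (eps / (4 * (Cmod m + 1))))%R) as [d3 [Hd3 H3]];
    [ apply Rmin_pos; [ lra | apply Rdiv_lt_0_compat; lra ] | ].
  destruct (Cg (Rmin 1 (eps / (4 * (Cmod l + 1))))%R) as [d4 [Hd4 H4]];
    [ apply Rmin_pos; [ lra | apply Rdiv_lt_0_compat; lra ] | ].
  exists (Rmin (Rmin d1 d2) (Rmin d3 d4)). split; [ repeat apply Rmin_pos; easy | ].
  assert (M : forall x, (x < Rmin (Rmin d1 d2) (Rmin d3 d4) -> x < d1 /\ x < d2 /\ x < d3 /\ x < d4)%R).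
  { intros x Hx. pose proof (Rmin_l (Rmin d1 d2) (Rmin d3 d4)).
    pose proof (Rmin_r (Rmin d1 d2) (Rmin d3 d4)).
    pose proof (Rmin_l d1 d2). pose proof (Rmin_r d1 d2).
    pose proof (Rmin_l d3 d4). pose proof (Rmin_r d3 d4). lra. }
  intros z w Hz Hw. apply M in Hz. apply M in Hw.
  specialize (H1 z w (proj1 Hz) (proj1 Hw)).
  specialize (H2 z w (proj1 (proj2 Hz)) (proj1 (proj2 Hw))).
  assert (F := H3 w (proj1 (proj2 (proj2 Hw)))). assert (G := H4 z (proj2 (proj2 (proj2 Hz)))).
  assert (F1 := Rlt_le_trans _ _ _ F (Rmin_l _ _)). assert (F2 := Rlt_le_trans _ _ _ F (Rmin_r _ _)).
  assert (G1 := Rlt_le_trans _ _ _ G (Rmin_l _ _)). assert (G2 := Rlt_le_trans _ _ _ G (Rmin_r _ _)).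
  pose proof (Cmod_triangle_minus (f w) (f z0)) as Tf.
  pose proof (Cmod_triangle_minus (g z) (g z0)) as Tg.
  (* Four terms, each at most [eps / 4] times [|z - w|]: two remainders of strict differentiability,
     and two products of a derivative with a small oscillation. *)
  replace (f z * g z - f w * g w - (l * g z0 + f z0 * m) * (z - w))
    with (((f z - f w - l * (z - w)) * g z + l * (z - w) * (g z - g z0))
          + ((g z - g w - m * (z - w)) * f w + (f w - f z0) * m * (z - w))) by ring.
  set (D := Cmod (z - w)) in *. pose proof (Cmod_ge_0 (z - w)) as PD. fold D in PD.
  assert (Q : forall e c x : R, (0 <= c -> x <= c + 1 -> e / (4 * (c + 1)) * x * D <= e / 4 * D \/ e < 0)%R).
  { intros e c x Hc Hx. destruct (Rlt_le_dec e 0) as [|He']; [ now right | left ].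
    apply Rmult_le_compat_r; [ easy | ].
    replace (e / 4)%R with (e / (4 * (c + 1)) * (c + 1))%R by (field; lra).
    apply Rmult_le_compat_l; [ | easy ]. apply Rdiv_le_0_compat; lra. }
  assert (A1 : (Cmod ((f z - f w - l * (z - w)) * g z) <= eps / 4 * D)%R).
  { rewrite Cmod_mult. eapply Rle_trans.
    { apply Rmult_le_compat_r; [ apply Cmod_ge_0 | apply H1 ]. }
    destruct (Q eps (Cmod (g z0)) (Cmod (g z))); try lra. }
  assert (A2 : (Cmod (l * (z - w) * (g z - g z0)) <= eps / 4 * D)%R).
  { rewrite !Cmod_mult. fold D.
    assert (Cmod l * Cmod (g z - g z0) <= Cmod l * (eps / (4 * (Cmod l + 1))))%R
      by (apply Rmult_le_compat_l; lra).
    destruct (Q eps (Cmod l) (Cmod l)); try lra. nra. }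
  assert (A3 : (Cmod ((g z - g w - m * (z - w)) * f w) <= eps / 4 * D)%R).
  { rewrite Cmod_mult. eapply Rle_trans.
    { apply Rmult_le_compat_r; [ apply Cmod_ge_0 | apply H2 ]. }
    destruct (Q eps (Cmod (f z0)) (Cmod (f w))); try lra. }
  assert (A4 : (Cmod ((f w - f z0) * m * (z - w)) <= eps / 4 * D)%R).
  { rewrite !Cmod_mult. fold D.
    assert (Cmod m * Cmod (f w - f z0) <= Cmod m * (eps / (4 * (Cmod m + 1))))%R
      by (apply Rmult_le_compat_l; lra).
    destruct (Q eps (Cmod m) (Cmod m)); try lra. nra. }
  eapply Rle_trans; [ apply Cmod_triangle | ].
  eapply Rle_trans; [ apply Rplus_le_compat; apply Cmod_triangle | lra ].
Qed.

Lemma hol_opp f z0 : hol f z0 -> hol (fun z => - f z) z0.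
Proof.
  intros H. apply (hol_ext (fun z => (- (1)) * f z)); [ intros; ring | ].
  apply hol_mult; [ apply hol_const | easy ].
Qed.

Lemma hol_minus f g z0 : hol f z0 -> hol g z0 -> hol (fun z => f z - g z) z0.
Proof. intros H K. apply hol_plus; [ easy | now apply hol_opp ]. Qed.

Lemma hol_pow f n z0 : hol f z0 -> hol (fun z => f z ^ n) z0.
Proof.
  intros H. induction n as [|n IH].
  - exact (hol_const (RtoC 1) z0).
  - apply (hol_ext (fun z => f z * f z ^ n)); [ intros; simpl; ring | ].
    now apply hol_mult.
Qed.

Lemma hol_comp f g z0 : hol g z0 -> hol f (g z0) -> hol (fun z => f (g z)) z0.
Proof.
  intros [m K] [l H]. exists (l * m). intros eps He.
  pose proof (Cmod_ge_0 l) as Pl. pose proof (Cmod_ge_0 m) as Pm.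
  destruct (sderiv_lip _ _ _ K) as [d1 [Hd1 H1]].
  destruct (H (eps / (2 * (Cmod m + 1)))%R) as [d2 [Hd2 H2]];
    [ apply Rdiv_lt_0_compat; lra | ].
  destruct (hol_ccont g z0 (ex_intro _ m K) d2 Hd2) as [d3 [Hd3 H3]].
  destruct (K (eps / (2 * (Cmod l + 1)))%R) as [d4 [Hd4 H4]];
    [ apply Rdiv_lt_0_compat; lra | ].
  exists (Rmin d1 (Rmin d3 d4)). split; [ repeat apply Rmin_pos; easy | ].
  assert (M : forall x, (x < Rmin d1 (Rmin d3 d4) -> x < d1 /\ x < d3 /\ x < d4)%R).
  { intros x Hx. pose proof (Rmin_l d1 (Rmin d3 d4)).
    pose proof (Rmin_r d1 (Rmin d3 d4)).
    pose proof (Rmin_l d3 d4). pose proof (Rmin_r d3 d4). lra. }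
  intros z w Hz Hw. apply M in Hz. apply M in Hw.
  specialize (H1 z w (proj1 Hz) (proj1 Hw)).
  specialize (H2 (g z) (g w) (H3 _ (proj1 (proj2 Hz))) (H3 _ (proj1 (proj2 Hw)))).
  specialize (H4 z w (proj2 (proj2 Hz)) (proj2 (proj2 Hw))).
  replace (f (g z) - f (g w) - l * m * (z - w))
    with ((f (g z) - f (g w) - l * (g z - g w)) + l * (g z - g w - m * (z - w))) by ring.
  set (D := Cmod (z - w)) in *. pose proof (Cmod_ge_0 (z - w)) as PD. fold D in PD.
  eapply Rle_trans; [ apply Cmod_triangle | ]. rewrite Cmod_mult.
  assert (A1 : (eps / (2 * (Cmod m + 1)) * Cmod (g z - g w) <= eps / 2 * D)%R).
  { replace (eps / 2 * D)%R with (eps / (2 * (Cmod m + 1)) * ((Cmod m + 1) * D))%R by (field; lra).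
    apply Rmult_le_compat_l; [ apply Rdiv_le_0_compat; lra | easy ]. }
  assert (A2 : (Cmod l * Cmod (g z - g w - m * (z - w)) <= eps / 2 * D)%R).
  { replace (eps / 2 * D)%R with ((Cmod l + 1) * (eps / (2 * (Cmod l + 1)) * D))%R by (field; lra).
    apply Rmult_le_compat; try apply Cmod_ge_0; try lra; easy. }
  lra.
Qed.

Lemma hol_bar f z0 : hol f (Cconj z0) -> hol (fun z => Cconj (f (Cconj z))) z0.
Proof.
  intros [l H]. exists (Cconj l). intros eps He. destruct (H eps He) as [d [Hd Hf]].
  exists d. split; [ easy | ]. intros z w Hz Hw.
  rewrite <- (Cmod_conj (z - z0)), Cminus_conj in Hz.
  rewrite <- (Cmod_conj (w - z0)), Cminus_conj in Hw.
  specialize (Hf _ _ Hz Hw).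
  rewrite <- (Cmod_conj (z - w)), Cminus_conj.
  rewrite <- Cmod_conj in Hf.
  rewrite !Cminus_conj, Cmult_conj, Cminus_conj, !Cconj_conj in Hf. exact Hf.
Qed.

Lemma hol_inv (z0 : C) : z0 <> 0 -> hol (fun z => / z) z0.
Proof.
  intros Hz0. assert (P0 := proj1 (Cmod_gt_0 z0) Hz0). set (a := Cmod z0) in *.
  exists (- / (z0 * z0)). intros eps He.
  (* [1/z - 1/w + (z-w)/z0^2 = (z-w)(zw - z0^2)/(z w z0^2)], with [|z|, |w| >= a/2]
     and [|zw - z0^2| <= 3 a d]. *)
  set (d := Rmin (a / 2) (eps * a ^ 3 / 12)).
  assert (Hd1 := Rmin_l (a / 2) (eps * a ^ 3 / 12)). assert (Hd2 := Rmin_r (a / 2) (eps * a ^ 3 / 12)).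
  fold d in Hd1, Hd2.
  assert (Pd : (0 < d)%R).
  { apply Rmin_pos; [ lra | ]. apply Rdiv_lt_0_compat; [ | lra ].
    apply Rmult_lt_0_compat; [ lra | now apply pow_lt ]. }
  exists d. split; [ easy | ]. intros z w Hz Hw.
  assert (Bz : (a / 2 <= Cmod z)%R).
  { pose proof (Cmod_triangle_minus z0 z) as T. rewrite Cmod_minus_sym in T. fold a in T. lra. }
  assert (Bw : (a / 2 <= Cmod w)%R).
  { pose proof (Cmod_triangle_minus z0 w) as T. rewrite Cmod_minus_sym in T. fold a in T. lra. }
  assert (Bw' : (Cmod w <= 2 * a)%R).
  { pose proof (Cmod_triangle_minus w z0) as T. fold a in T. lra. }
  assert (Nz : z <> 0) by (intros E; rewrite E, Cmod_0 in Bz; lra).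
  assert (Nw : w <> 0) by (intros E; rewrite E, Cmod_0 in Bw; lra).
  replace (/ z - / w - - / (z0 * z0) * (z - w))
    with ((z - w) * ((z - z0) * w + z0 * (w - z0)) / (z * w * (z0 * z0)))
    by (field; auto).
  rewrite Cmod_div by (repeat apply Cmult_neq_0; auto).
  rewrite !Cmod_mult. fold a.
  assert (PD := Cmod_ge_0 (z - w)). set (D := Cmod (z - w)) in *.
  assert (N : (Cmod ((z - z0) * w + z0 * (w - z0)) <= 3 * a * d)%R).
  { eapply Rle_trans; [ apply Cmod_triangle | ]. rewrite !Cmod_mult. fold a.
    assert (Cmod (z - z0) * Cmod w <= d * (2 * a))%R
      by (apply Rmult_le_compat; try apply Cmod_ge_0; lra).
    assert (a * Cmod (w - z0) <= a * d)%R by (apply Rmult_le_compat_l; lra). lra. }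
  assert (M : (a ^ 4 / 4 <= Cmod z * Cmod w * (a * a))%R).
  { replace (a ^ 4 / 4)%R with (a / 2 * (a / 2) * (a * a))%R by field.
    apply Rmult_le_compat_r; [ nra | ]. apply Rmult_le_compat; lra. }
  assert (0 < a ^ 4 / 4)%R by (apply Rdiv_lt_0_compat; [ now apply pow_lt | lra ]).
  apply Rle_div_l; [ lra | ].
  replace (eps * D * (Cmod z * Cmod w * (a * a)))%R
    with (D * (eps * (Cmod z * Cmod w * (a * a))))%R by ring.
  apply Rmult_le_compat_l; [ easy | ].
  eapply Rle_trans; [ apply N | ].
  apply Rle_trans with (eps * (a ^ 4 / 4))%R; [ | apply Rmult_le_compat_l; lra ].
  replace (eps * (a ^ 4 / 4))%R with (3 * a * (eps * a ^ 3 / 12))%R by field.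
  apply Rmult_le_compat_l; lra.
Qed.

Lemma hol_inv_comp (f : C -> C) (z0 : C) : f z0 <> 0 -> hol f z0 -> hol (fun z => / f z) z0.
Proof. intros N H. apply (hol_comp (fun z => / z)); [ easy | now apply hol_inv ]. Qed.

(** * The complex exponential *)

Lemma Cexp_0 : Cexp 0 = 1.
Proof.
  unfold Cexp; simpl. rewrite exp_0, cos_0, sin_0.
  apply injective_projections; simpl; ring.
Qed.

Lemma Cexp_plus (z w : C) : Cexp (z + w) = Cexp z * Cexp w.
Proof.
  destruct z as [x y], w as [u v]; unfold Cexp; simpl.
  rewrite exp_plus, cos_plus, sin_plus. apply injective_projections; simpl; ring.
Qed.

Lemma Cexp_opp_r (z : C) : Cexp z * Cexp (- z) = 1.
Proof. rewrite <- Cexp_plus. replace (z + - z) with (RtoC 0) by ring. apply Cexp_0. Qed.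

Lemma Cexp_conj (z : C) : Cconj (Cexp z) = Cexp (Cconj z).
Proof.
  destruct z as [x y]; unfold Cexp, Cconj; simpl. rewrite cos_neg, sin_neg.
  apply injective_projections; simpl; ring.
Qed.

Lemma exp_taylor1 (x : R) : (Rabs x <= 1 -> Rabs (exp x - 1 - x) <= 2 * x ^ 2)%R.
Proof.
  intros H. apply Rabs_le_between in H.
  assert (L := exp_ineq1_le x). assert (L' := exp_ineq1_le (- x)).
  assert (E : (exp x * exp (- x) = 1)%R) by (rewrite <- exp_plus, Rplus_opp_r; apply exp_0).
  assert (P := exp_pos x). assert (P' := exp_pos (- x)).
  rewrite Rabs_pos_eq by lra.
  (* [exp x (1 - x) <= 1] for [x <= 1/2]; otherwise [exp x <= 3]. *)
  destruct (Rle_dec x (1 / 2)).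
  - assert (exp x * (1 - x) <= 1)%R by nra. nra.
  - assert (exp x <= 3)%R.
    { apply Rle_trans with (exp 1); [ | apply exp_le_3 ].
      destruct (Rle_lt_or_eq_dec x 1) as [Hl | ->]; [ lra | left; now apply exp_increasing | lra ]. }
    assert (exp (x / 2) * (1 - x / 2) <= 1)%R.
    { assert (E2 : (exp (x/2) * exp (- (x/2)) = 1)%R) by (rewrite <- exp_plus, Rplus_opp_r; apply exp_0).
      assert (L2 := exp_ineq1_le (- (x/2))). assert (P2 := exp_pos (x/2)). nra. }
    assert (exp x = exp (x / 2) * exp (x / 2))%R by (rewrite <- exp_plus; f_equal; lra).
    assert (P2 := exp_pos (x/2)).
    nra.
Qed.

Lemma cos_taylor1 (y : R) : (Rabs (cos y - 1) <= y ^ 2)%R.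
Proof.
  replace y with (2 * (y / 2))%R at 1 by field. rewrite cos_2a_sin.
  assert (H : (Rabs (sin (y / 2)) <= Rabs (y / 2))%R).
  { destruct (Rle_dec 0 (y / 2)).
    - rewrite (Rabs_pos_eq (y / 2)) by lra.
      destruct (Req_dec (y / 2) 0) as [-> | ]; [ rewrite sin_0, Rabs_R0; lra | ].
      apply Rabs_le. split.
      + assert (sin (- (y/2)) <= y / 2)%R; [ | rewrite sin_neg in *; lra ].
        destruct (Rle_dec (y / 2) PI).
        * rewrite sin_neg. assert (0 <= sin (y / 2))%R by (apply sin_ge_0; lra). lra.
        * assert (HS := SIN_bound (- (y/2))). assert (PI2 := PI2_1). lra.
      + left; apply sin_lt_x; lra.
    - rewrite (Rabs_left (y / 2)) by lra. rewrite <- Rabs_Ropp, <- sin_neg.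
      set (x := (- (y / 2))%R). assert (0 < x)%R by (unfold x; lra).
      apply Rabs_le. split.
      + destruct (Rle_dec x PI).
        * assert (0 <= sin x)%R by (apply sin_ge_0; lra). lra.
        * assert (HS := SIN_bound x). assert (PI2 := PI2_1). lra.
      + left; now apply sin_lt_x. }
  replace (1 - 2 * sin (y / 2) * sin (y / 2) - 1)%R with (- (2 * (sin (y / 2)) ^ 2))%R by ring.
  rewrite Rabs_Ropp, Rabs_pos_eq by nra.
  rewrite <- (pow2_abs (sin _)). 
  assert (Rabs (sin (y / 2)) ^ 2 <= Rabs (y / 2) ^ 2)%R
    by (apply pow_incr; split; [ apply Rabs_pos | easy ]).
  rewrite (pow2_abs (y / 2)) in *. nra.
Qed.

Lemma sin_taylor1 (y : R) : (Rabs (sin y - y) <= y ^ 2)%R.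
Proof.
  destruct (Req_dec y 0) as [-> | Hy]; [ rewrite sin_0, Rminus_0_r, Rabs_R0; nra | ].
  destruct (MVT_gen (fun t => sin t - t)%R 0 y (fun t => cos t - 1)%R) as [c [Hc E]].
  - intros t _. auto_derive; [ easy | ring ].
  - intros t _. apply continuity_pt_minus; [ apply continuity_sin | apply derivable_continuous, derivable_id ].
  - rewrite sin_0 in E.
    destruct (MVT_gen cos 0 c (fun t => - sin t)%R) as [d [Hd E']].
    + intros t _. auto_derive; [ easy | ring ].
    + intros t _. apply continuity_cos.
    + rewrite cos_0 in E'. replace (sin y - y)%R with (sin y - y - (0 - 0))%R by ring.
      rewrite E, E', !Rabs_mult, !Rminus_0_r.
      assert (Rabs (- sin d) <= 1)%R.
      { rewrite Rabs_Ropp. apply Rabs_le, SIN_bound. }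
      assert (Rabs c <= Rabs y)%R.
      { unfold Rmin, Rmax in Hc. destruct (Rle_dec 0 y).
        - rewrite !Rabs_pos_eq; lra.
        - rewrite !Rabs_left1; lra. }
      rewrite <- pow2_abs. pose proof (Rabs_pos c). pose proof (Rabs_pos (- sin d)). pose proof (Rabs_pos y). 
      assert (Rabs (- sin d) * Rabs c <= 1 * Rabs y)%R by (apply Rmult_le_compat; lra).
      nra.
Qed.

(** Only the quadratic order matters, so crude real bounds are combined; 12 rounds up the resulting
    [5 x^2 + 11 y^2]. The bound serves the derivative of [Cexp] at 0 and the uniform limit of
    [(e^eta - 1) / h] on a circle. *)
Lemma Cexp_taylor1 (z : C) : (Cmod z <= 1 -> Cmod (Cexp z - 1 - z) <= 12 * Cmod z ^ 2)%R.
Proof.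
  intros H. destruct z as [x y].
  pose proof (re_le_Cmod (x, y)) as Hx. pose proof (Im_le_Cmod (x, y)) as Hy. simpl in Hx, Hy.
  pose proof (Cmod2_alt (x, y)) as E; simpl Re in E; simpl Im in E.
  eapply Rle_trans; [ apply Cmod_le_re_im | ]. rewrite E.
  unfold Cexp; simpl Re; simpl Im.
  assert (Ex := exp_taylor1 x). assert (Cy := cos_taylor1 y). assert (Sy := sin_taylor1 y).
  assert (Ex' : (Rabs (exp x - 1 - x) <= 2 * x ^ 2)%R) by (apply Ex; lra).
  assert (P := exp_pos x).
  assert (X : (Rabs x <= 1)%R) by lra. apply Rabs_le_between in X.
  assert (Y : (Rabs y <= 1)%R) by lra. apply Rabs_le_between in Y.
  apply Rabs_le_between in Ex'. apply Rabs_le_between in Cy. apply Rabs_le_between in Sy.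
  assert (X2 : (x ^ 2 <= 1)%R) by nra.
  assert (U : (exp x <= 4)%R) by lra.
  assert (A : (Rabs (exp x * cos y - 0 * sin y + - (1) + - x) <= 2 * x ^ 2 + 4 * y ^ 2)%R).
  { replace (exp x * cos y - 0 * sin y + - (1) + - x)%R
      with ((exp x - 1 - x) + exp x * (cos y - 1))%R by ring.
    eapply Rle_trans; [ apply Rabs_triang | ]. rewrite Rabs_mult, (Rabs_pos_eq (exp x)) by lra.
    apply Rplus_le_compat; [ now apply Rabs_le | ].
    apply Rmult_le_compat; try lra; [ apply Rabs_pos | now apply Rabs_le ]. }
  assert (B : (Rabs (exp x * sin y + 0 * cos y + - 0 + - y) <= 4 * y ^ 2 + (3 * Rabs x) * Rabs y)%R).
  { replace (exp x * sin y + 0 * cos y + - 0 + - y)%R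
      with (exp x * (sin y - y) + (exp x - 1) * y)%R by ring.
    eapply Rle_trans; [ apply Rabs_triang | ]. rewrite !Rabs_mult, (Rabs_pos_eq (exp x)) by lra.
    apply Rplus_le_compat.
    - apply Rmult_le_compat; try lra; [ apply Rabs_pos | now apply Rabs_le ].
    - apply Rmult_le_compat_r; [ apply Rabs_pos | ].
      assert (x ^ 2 <= Rabs x)%R.
      { rewrite <- pow2_abs. assert (0 <= Rabs x <= 1)%R; [ | nra ].
        split; [ apply Rabs_pos | apply Rabs_le; lra ]. }
      destruct (Rabs_le_between x (Rabs x)) as [H1 _]. specialize (H1 (Rle_refl _)).
      apply Rabs_le. lra. }
  assert (Rabs x * Rabs y <= x ^ 2 + y ^ 2)%R.
  { rewrite <- (pow2_abs x), <- (pow2_abs y). nra. }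
  pose proof (pow2_ge_0 x). pose proof (pow2_ge_0 y). lra.
Qed.

Lemma hol_Cexp z0 : hol Cexp z0.
Proof.
  assert (H0 : sderiv Cexp 0 1).
  (* With [d <= 1/4] the increment [z - w] stays in the unit disc required by [Cexp_taylor1]. The
     two error terms are at most [24 |z - w|^2 + 4 d |z - w|], and [|z - w| <= 2 d] bounds this by
     [52 d |z - w|]. *)
  { intros eps He. set (d := Rmin (1 / 4) (eps / 200)).
    assert (D1 := Rmin_l (1 / 4) (eps / 200)). assert (D2 := Rmin_r (1 / 4) (eps / 200)). fold d in D1, D2.
    assert (Pd : (0 < d)%R) by (apply Rmin_pos; lra).
    exists d. split; [ easy | ]. intros z w Hz Hw.
    replace (z - 0) with z in Hz by ring. replace (w - 0) with w in Hw by ring.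
    assert (Dzw : (Cmod (z - w) <= Cmod z + Cmod w)%R).
    { eapply Rle_trans; [ apply Cmod_triangle | ]. rewrite Cmod_opp. lra. }
    assert (T := Cexp_taylor1 (z - w)). assert (Tw := Cexp_taylor1 w).
    assert (T' := T ltac:(lra)). assert (Tw' := Tw ltac:(lra)).
    replace (Cexp z) with (Cexp (z - w) * Cexp w)
      by (rewrite <- Cexp_plus; f_equal; ring).
    replace (Cexp (z - w) * Cexp w - Cexp w - 1 * (z - w))
      with ((Cexp (z - w) - 1 - (z - w)) * Cexp w + (z - w) * (Cexp w - 1)) by ring.
    eapply Rle_trans; [ apply Cmod_triangle | ]. rewrite !Cmod_mult.
    assert (B1 : (Cmod (Cexp w - 1) <= 4 * d)%R).
    { pose proof (Cmod_triangle_minus (Cexp w - 1) w).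
      pose proof (Cmod_ge_0 w). nra. }
    assert (B2 : (Cmod (Cexp w) <= 2)%R).
    { pose proof (Cmod_triangle_minus (Cexp w) 1) as TT. rewrite Cmod_1 in TT. lra. }
    pose proof (Cmod_ge_0 (z - w)) as PD. set (D := Cmod (z - w)) in *.
    pose proof (Cmod_ge_0 (Cexp (z - w) - 1 - (z - w))).
    pose proof (Cmod_ge_0 (Cexp w)). pose proof (Cmod_ge_0 (Cexp w - 1)).
    assert (Cmod (Cexp (z - w) - 1 - (z - w)) * Cmod (Cexp w) <= (12 * D ^ 2) * 2)%R
      by (apply Rmult_le_compat; lra).
    assert (D * Cmod (Cexp w - 1) <= D * (4 * d))%R by (apply Rmult_le_compat_l; lra).
    nra. }
  apply (hol_ext (fun z => Cexp z0 * Cexp (z - z0))).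
  { intros z. rewrite <- Cexp_plus. f_equal. ring. }
  apply hol_mult; [ apply hol_const | ].
  apply (hol_comp Cexp); [ apply hol_minus; [ apply hol_id | apply hol_const ] | ].
  replace (z0 - z0) with (RtoC 0) by ring. now exists 1.
Qed.

Lemma hol_Cexp_comp f z0 : hol f z0 -> hol (fun z => Cexp (f z)) z0.
Proof. intros H. apply (hol_comp Cexp); [ easy | apply hol_Cexp ]. Qed.

(** * Sums of power series are strictly differentiable *)

Lemma Cpow_diff_le (d : R) (x y : C) (n : nat) :
  (Cmod x <= d)%R -> (Cmod y <= d)%R ->
  (Cmod (x ^ S n - y ^ S n) <= INR (S n) * d ^ n * Cmod (x - y))%R.
Proof.
  intros Hx Hy. pose proof (Cmod_ge_0 x). pose proof (Cmod_ge_0 y).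
  pose proof (Cmod_ge_0 (x - y)) as PD.
  induction n as [|n IH].
  - simpl. rewrite !Cmult_1_r. lra.
  - replace (x ^ S (S n) - y ^ S (S n)) with (x * (x ^ S n - y ^ S n) + (x - y) * y ^ S n)
      by (simpl; ring).
    eapply Rle_trans; [ apply Cmod_triangle | ]. rewrite !Cmod_mult, Cmod_pow.
    assert (Cmod y ^ S n <= d ^ S n)%R by (apply pow_incr; lra).
    assert (0 <= d ^ n)%R by (apply pow_le; lra).
    assert (Cmod x * Cmod (x ^ S n - y ^ S n) <= d * (INR (S n) * d ^ n * Cmod (x - y)))%R
      by (apply Rmult_le_compat; try lra; apply Cmod_ge_0).
    rewrite (S_INR (S n)).
    replace ((INR (S n) + 1) * d ^ S n * Cmod (x - y))%R
      with (d * (INR (S n) * d ^ n * Cmod (x - y)) + Cmod (x - y) * d ^ S n)%R by (simpl; ring).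
    apply Rplus_le_compat; [ easy | ]. now apply Rmult_le_compat_l.
Qed.

Lemma INR_le_pow2 (n : nat) : (INR n <= 2 ^ n)%R.
Proof. induction n; [ simpl; lra | ]. rewrite S_INR. simpl. assert (1 <= 2 ^ n)%R by (apply pow_R1_Rle; lra). lra. Qed.

Lemma is_series_Cterm_bounded (c : nat -> C) (l : C) :
  @is_series C_AbsRing C_NormedModule c l -> exists M : R, (0 < M)%R /\ forall n, (Cmod (c n) <= M)%R.
Proof.
  intros H.
  destruct (filterlim_bounded (K := C_AbsRing) (V := C_NormedModule) (sum_n c)) as [M HM]; [ now exists l | ].
  assert (P : (0 <= M)%R) by (eapply Rle_trans; [ apply (@norm_ge_0 C_AbsRing C_NormedModule (sum_n c 0%nat)) | apply HM ]).
  exists (2 * M + 1)%R. split; [ lra | ]. intros [|n].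
  - specialize (HM 0%nat). rewrite sum_O in HM. change (Cmod (c 0%nat) <= M)%R in HM. lra.
  - assert (H1 := HM n). assert (H2 := HM (S n)). rewrite sum_Sn in H2.
    change (Cmod (sum_n c n) <= M)%R in H1. change (Cmod (sum_n c n + c (S n)) <= M)%R in H2.
    replace (c (S n)) with ((sum_n c n + c (S n)) - sum_n c n) by ring.
    eapply Rle_trans; [ apply Cmod_triangle | ]. rewrite Cmod_opp. lra.
Qed.

Lemma is_series_Cmod_le (c : nat -> C) (l : C) (B : R) :
  @is_series C_AbsRing C_NormedModule c l ->
  (forall n, Cmod (sum_n c n) <= B)%R -> (Cmod l <= B)%R.
Proof.
  intros H HB. change (@norm C_AbsRing C_NormedModule l <= B)%R.
  assert (L : filterlim (fun n => @norm C_AbsRing C_NormedModule (sum_n c n)) eventually (locally (@norm C_AbsRing C_NormedModule l))).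
  { eapply filterlim_comp; [ apply H | apply filterlim_norm ]. }
  apply (filterlim_le (F := eventually) (fun n => @norm C_AbsRing C_NormedModule (sum_n c n)) (fun _ => B) (@norm C_AbsRing C_NormedModule l) B).
  - apply filter_forall. intros n. apply HB.
  - exact L.
  - apply filterlim_const.
Qed.

Lemma pow_n_Cpow (x : C) (n : nat) : @pow_n C_Ring x n = x ^ n.
Proof. induction n; simpl; [ reflexivity | now rewrite IHn ]. Qed.

(** Convergence at distance [rho = r / 2] bounds the terms there, so [|c n| <= M rho^(-n)]. In
    [f z - f w - c 1 (z - w)] the terms 0 and 1 cancel; from [n = 2] on each contains the factor
    [d |z - w|], and with [d <= rho / 4] and [INR n <= 2^n] the rest is a geometric series of ratio
    1/2. *)
Lemma analytic_at_hol (f : C -> C) (z0 : C) : analytic_at f z0 -> hol f z0.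
Proof.
  intros [r [c Hc]]. assert (Pr := cond_pos r). set (rho := (r / 2)%R).
  assert (Prho : (0 < rho)%R) by (unfold rho; lra).
  assert (HS : forall z, (Cmod (z - z0) < r)%R ->
    @is_series C_AbsRing C_NormedModule (fun n => (z - z0) ^ n * c n) (f z)).
  { intros z Hz. eapply is_series_ext; [ | apply (Hc z Hz) ].
    intros n. simpl. now rewrite pow_n_Cpow. }
  assert (Hb : exists M : R, (0 < M)%R /\ forall n, (Cmod (c n) <= M * (/ rho) ^ n)%R).
  { destruct (is_series_Cterm_bounded _ _ (HS (z0 + RtoC rho) ltac:(replace (z0 + RtoC rho - z0) with (RtoC rho) by ring; rewrite Cmod_R, Rabs_pos_eq; unfold rho in *; lra))) as [M [PM HM]].
    exists M. split; [ easy | ]. intros n. specialize (HM n).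
    rewrite Cmod_mult, Cmod_pow in HM.
    replace (z0 + RtoC rho - z0) with (RtoC rho) in HM by ring.
    rewrite Cmod_R, Rabs_pos_eq in HM by lra.
    apply Rmult_le_reg_l with (rho ^ n)%R; [ now apply pow_lt | ].
    rewrite pow_inv. assert (rho ^ n <> 0)%R by (apply pow_nonzero; lra).
    replace (rho ^ n * (M * / rho ^ n))%R with M by (field; easy). easy. }
  destruct Hb as [M [PM HM]].
  exists (c 1%nat). intros eps He.
  set (d := Rmin (rho / 4) (eps * rho ^ 2 / (16 * M))).
  assert (D1 : (d <= rho / 4)%R) by apply Rmin_l.
  assert (D2 : (d <= eps * rho ^ 2 / (16 * M))%R) by apply Rmin_r.
  assert (P2 : (0 < rho ^ 2)%R) by now apply pow_lt.
  assert (Pd : (0 < d)%R).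
  { apply Rmin_pos; [ lra | ]. apply Rdiv_lt_0_compat; [ now apply Rmult_lt_0_compat | lra ]. }
  exists d. split; [ easy | ]. intros z w Hz Hw.
  assert (Hz' := HS z ltac:(unfold rho in *; lra)). assert (Hw' := HS w ltac:(unfold rho in *; lra)).
  assert (PD := Cmod_ge_0 (z - w)). set (D := Cmod (z - w)) in *.
  (* The factor [1 - (1/2)^n] is a partial sum of the geometric majorant, so the induction closes
     exactly. In 16, one factor 4 is [2^2] from [INR n <= 2^n] at [n = 2] and the other shifts
     [(1/2)^n] to start at [n = 2]. *)
  assert (B : forall n : nat, (Cmod (sum_n (fun n => (z - z0) ^ n * c n - (w - z0) ^ n * c n)%C n
              - (if Nat.eqb n 0 then RtoC 0 else c 1%nat * (z - w)))
             <= (16 * M / rho ^ 2) * d * D * (1 - (/ 2) ^ n))%R).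
  { induction n as [|[|n] IH].
    - rewrite sum_O. simpl. replace (1 * c 0%nat - 1 * c 0%nat - 0) with (RtoC 0) by ring.
      rewrite Cmod_0. lra.
    - rewrite sum_Sn, sum_O. change plus with Cplus. simpl.
      match goal with |- (Cmod ?x <= _)%R => replace x with (RtoC 0) by ring end.
      rewrite Cmod_0. repeat apply Rmult_le_pos; try lra.
      left; apply Rinv_0_lt_compat; nra.
    - rewrite sum_Sn. change plus with Cplus. simpl Nat.eqb in *. cbv beta iota in *.
      set (Sn := sum_n _ (S n)) in *.
      replace (Sn + ((z - z0) ^ S (S n) * c (S (S n)) - (w - z0) ^ S (S n) * c (S (S n))) - c 1%nat * (z - w))
        with ((Sn - c 1%nat * (z - w)) + ((z - z0) ^ S (S n) - (w - z0) ^ S (S n)) * c (S (S n))) by ring.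
      eapply Rle_trans; [ apply Cmod_triangle | ].
      eapply Rle_trans; [ apply Rplus_le_compat; [ apply IH | ] | ].
      { rewrite Cmod_mult. apply Rmult_le_compat; [ apply Cmod_ge_0 | apply Cmod_ge_0 | | apply HM ].
        apply (Cpow_diff_le d); lra. }
      replace (z - z0 - (w - z0)) with (z - w) by ring. fold D.
      assert (E : (INR (S (S n)) * d ^ S n * D * (M * (/ rho) ^ S (S n))
                   <= 16 * M / rho ^ 2 * d * D * (/ 2) ^ S (S n))%R).
      { assert (I2 := INR_le_pow2 (S (S n))).
        assert (Q : (d ^ n <= (rho / 4) ^ n)%R) by (apply pow_incr; lra).
        assert (K : (INR (S (S n)) * d ^ n <= 2 ^ S (S n) * (rho / 4) ^ n)%R).
        { apply Rmult_le_compat; try lra; [ apply pos_INR | apply pow_le; lra ]. }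
        replace (INR (S (S n)) * d ^ S n * D * (M * (/ rho) ^ S (S n)))%R
          with ((INR (S (S n)) * d ^ n) * (d * D * M * (/ rho) ^ S (S n)))%R by (simpl; ring).
        eapply Rle_trans.
        { apply Rmult_le_compat_r; [ | apply K ].
          assert (0 <= (/ rho) ^ S (S n))%R by (apply pow_le; left; now apply Rinv_0_lt_compat).
          apply Rmult_le_pos; [ | easy ]. repeat apply Rmult_le_pos; lra. }
        right. rewrite !pow_inv. unfold Rdiv. rewrite Rpow_mult_distr, pow_inv.
        replace (4 ^ n)%R with (2 ^ n * 2 ^ n)%R
          by (rewrite <- Rpow_mult_distr; f_equal; lra).
        assert (2 ^ n <> 0)%R by (apply pow_nonzero; lra).
        assert (rho ^ n <> 0)%R by (apply pow_nonzero; lra).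
        simpl. field. lra. }
      eapply Rle_trans; [ apply Rplus_le_compat_l, E | ].
      right. simpl. field. lra. }
  (* The linear term [c 1 (z - w)] enters as a series whose only nonzero term has index 1. *)
  assert (L : @is_series C_AbsRing C_NormedModule
     (fun n => (z - z0) ^ n * c n - (w - z0) ^ n * c n
                - (if Nat.eqb n 1 then c 1%nat * (z - w) else RtoC 0)) (f z - f w - c 1%nat * (z - w))).
  { apply (is_series_minus (V := C_NormedModule)).
    - apply (is_series_minus (V := C_NormedModule)); easy.
    - eapply filterlim_ext_loc; [ | apply filterlim_const ].
      exists 1%nat. intros n Hn. destruct n as [|n]; [ lia | ].
      clear Hn. induction n as [|n IH].
      + rewrite sum_Sn, sum_O. simpl. change plus with Cplus. ring.
      + rewrite sum_Sn, <- IH. simpl. change plus with Cplus. ring. }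
  apply (is_series_Cmod_le _ _ _ L). intros n.
  assert (E : sum_n (fun n => (z - z0) ^ n * c n - (w - z0) ^ n * c n
                - (if Nat.eqb n 1 then c 1%nat * (z - w) else RtoC 0)) n
     = sum_n (fun n => (z - z0) ^ n * c n - (w - z0) ^ n * c n) n
              - (if Nat.eqb n 0 then RtoC 0 else c 1%nat * (z - w))).
  { induction n as [|[|n] IH].
    - rewrite !sum_O. simpl. ring.
    - rewrite !sum_Sn, !sum_O. simpl. change plus with Cplus. ring.
    - rewrite sum_Sn, IH, (sum_Sn _ (S n)). simpl. change plus with Cplus. ring. }
  rewrite E. eapply Rle_trans; [ apply B | ].
  assert (0 < (/ 2) ^ n)%R by (apply pow_lt; lra).
  assert (16 * M / rho ^ 2 * d <= eps)%R.
  { replace eps with (16 * M / rho ^ 2 * (eps * rho ^ 2 / (16 * M)))%R by (field; lra).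
    apply Rmult_le_compat_l; [ | easy ]. apply Rdiv_le_0_compat; lra. }
  assert (0 <= 16 * M / rho ^ 2 * d)%R.
  { apply Rmult_le_pos; [ apply Rdiv_le_0_compat; lra | lra ]. }
  set (K := (16 * M / rho ^ 2 * d)%R) in *.
  assert (0 <= K * D)%R by (apply Rmult_le_pos; lra).
  assert (0 <= K * D * (/ 2) ^ n)%R by (apply Rmult_le_pos; lra).
  assert (K * D <= eps * D)%R by (apply Rmult_le_compat_r; lra). lra.
Qed.

(** * Complex functions of a real variable *)

(** Componentwise, so that [Cderiv], built from two real [Derive], can be read off; [cder_eps]
    recovers the estimate in the modulus. *)
Definition cder (f : R -> C) (t : R) (l : C) : Prop :=
  is_derive (fun s => Re (f s)) t (Re l) /\ is_derive (fun s => Im (f s)) t (Im l).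

Lemma is_derive_eps (f : R -> R) (t l : R) :
  is_derive f t l <->
  forall eps : R, (0 < eps)%R -> exists d : R, (0 < d)%R /\
    forall h : R, (Rabs h < d)%R -> (Rabs (f (t + h) - f t - h * l) <= eps * Rabs h)%R.
Proof.
  rewrite is_derive_Reals. split.
  - intros H eps He. destruct (H eps He) as [d Hd]. exists d. split; [ apply cond_pos | ].
    intros h Hh. destruct (Req_dec h 0) as [-> | Nh].
    { rewrite Rplus_0_r, Rabs_R0. replace (f t - f t - 0 * l)%R with 0%R by ring.
      rewrite Rabs_R0. lra. }
    specialize (Hd h Nh Hh).
    replace (f (t + h) - f t - h * l)%R with (((f (t + h) - f t) / h - l) * h)%R by (field; easy).
    rewrite Rabs_mult. apply Rmult_le_compat_r; [ apply Rabs_pos | lra ].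
  - intros H eps He. destruct (H (eps / 2)%R) as [d [Hd Hf]]; [ lra | ].
    exists (mkposreal d Hd). intros h Nh Hh. specialize (Hf h Hh).
    assert (Ph := Rabs_pos_lt h Nh).
    replace ((f (t + h) - f t) / h - l)%R with ((f (t + h) - f t - h * l) / h)%R by (field; easy).
    rewrite Rabs_div by easy. apply Rlt_div_l; [ easy | ]. nra.
Qed.

Lemma cder_eps (f : R -> C) (t : R) (l : C) :
  cder f t l <->
  forall eps : R, (0 < eps)%R -> exists d : R, (0 < d)%R /\
    forall h : R, (Rabs h < d)%R -> (Cmod (f (t + h)%R - f t - RtoC h * l) <= eps * Rabs h)%R.
Proof.
  unfold cder. rewrite !is_derive_eps. split.
  - intros [H1 H2] eps He.
    destruct (H1 (eps / 2)%R) as [d1 [P1 B1]]; [ lra | ].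
    destruct (H2 (eps / 2)%R) as [d2 [P2 B2]]; [ lra | ].
    exists (Rmin d1 d2). split; [ now apply Rmin_pos | ]. intros h Hh.
    specialize (B1 h (Rlt_le_trans _ _ _ Hh (Rmin_l _ _))).
    specialize (B2 h (Rlt_le_trans _ _ _ Hh (Rmin_r _ _))).
    eapply Rle_trans; [ apply Cmod_le_re_im | ]. simpl.
    match goal with |- (Rabs ?a + Rabs ?b <= _)%R =>
      replace a with (Re (f (t + h)%R) - Re (f t) - h * Re l)%R by (unfold Re; ring);
      replace b with (Im (f (t + h)%R) - Im (f t) - h * Im l)%R by (unfold Im; ring) end.
    lra.
  - intros H. split; intros eps He; destruct (H eps He) as [d [Pd Bd]]; exists d;
      (split; [ easy | ]); intros h Hh; specialize (Bd h Hh);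
      (eapply Rle_trans; [ | apply Bd ]);
      [ eapply Rle_trans; [ | apply re_le_Cmod ] | eapply Rle_trans; [ | apply Im_le_Cmod ] ];
      right; f_equal; simpl; unfold Re, Im; ring.
Qed.

Lemma cder_lip (f : R -> C) (t : R) (l : C) : cder f t l ->
  exists d : R, (0 < d)%R /\
    forall h : R, (Rabs h < d)%R -> (Cmod (f (t + h)%R - f t) <= (Cmod l + 1) * Rabs h)%R.
Proof.
  intros H. destruct (proj1 (cder_eps _ _ _) H 1%R Rlt_0_1) as [d [Pd Bd]].
  exists d. split; [ easy | ]. intros h Hh. specialize (Bd h Hh).
  pose proof (Cmod_triangle_minus (f (t + h)%R - f t) (RtoC h * l)) as T.
  rewrite Cmod_mult, Cmod_R in T. lra.
Qed.

Lemma cder_comp (F : C -> C) (g : R -> C) (t : R) (l m : C) :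
  sderiv F (g t) l -> cder g t m -> cder (fun s => F (g s)) t (l * m).
Proof.
  intros HF Hg. apply cder_eps. intros eps He.
  destruct (cder_lip _ _ _ Hg) as [d1 [P1 B1]].
  pose proof (Cmod_ge_0 l) as Pl. pose proof (Cmod_ge_0 m) as Pm.
  destruct (HF (eps / (2 * (Cmod m + 1)))%R) as [d2 [P2 B2]]; [ apply Rdiv_lt_0_compat; lra | ].
  destruct (proj1 (cder_eps _ _ _) Hg (eps / (2 * (Cmod l + 1)))%R) as [d3 [P3 B3]];
    [ apply Rdiv_lt_0_compat; lra | ].
  exists (Rmin d1 (Rmin (d2 / (Cmod m + 1)) d3)). split.
  { repeat apply Rmin_pos; try easy. apply Rdiv_lt_0_compat; lra. }
  intros h Hh.
  assert (H1 := Rlt_le_trans _ _ _ Hh (Rmin_l _ _)).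
  assert (H23 := Rlt_le_trans _ _ _ Hh (Rmin_r _ _)).
  assert (H2 := Rlt_le_trans _ _ _ H23 (Rmin_l _ _)).
  assert (H3 := Rlt_le_trans _ _ _ H23 (Rmin_r _ _)).
  specialize (B1 h H1). specialize (B3 h H3). apply Rlt_div_r in H2; [ | lra ].
  assert (Z : (Cmod (g t - g t) < d2)%R).
  { replace (g t - g t) with (RtoC 0) by ring. now rewrite Cmod_0. }
  specialize (B2 (g (t + h)%R) (g t) ltac:(lra) Z).
  replace (F (g (t + h)%R) - F (g t) - RtoC h * (l * m))
    with ((F (g (t + h)%R) - F (g t) - l * (g (t + h)%R - g t))
          + l * (g (t + h)%R - g t - RtoC h * m)) by ring.
  eapply Rle_trans; [ apply Cmod_triangle | ]. rewrite Cmod_mult.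
  assert (A1 : (eps / (2 * (Cmod m + 1)) * Cmod (g (t + h)%R - g t) <= eps / 2 * Rabs h)%R).
  { replace (eps / 2 * Rabs h)%R
      with (eps / (2 * (Cmod m + 1)) * ((Cmod m + 1) * Rabs h))%R by (field; lra).
    apply Rmult_le_compat_l; [ apply Rdiv_le_0_compat; lra | easy ]. }
  assert (A2 : (Cmod l * Cmod (g (t + h)%R - g t - RtoC h * m) <= eps / 2 * Rabs h)%R).
  { replace (eps / 2 * Rabs h)%R
      with ((Cmod l + 1) * (eps / (2 * (Cmod l + 1)) * Rabs h))%R by (field; lra).
    apply Rmult_le_compat; try apply Cmod_ge_0; try lra; easy. }
  lra.
Qed.

(** * Integrals over circles do not depend on the radius *)

Definition circ (r phi : R) : C := (r * cos phi, r * sin phi)%R.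

Lemma Cmod_circ (r phi : R) : (0 <= r)%R -> Cmod (circ r phi) = r.
Proof.
  intros H. unfold Cmod, circ; simpl.
  replace (_ + _)%R with (r * r * (Rsqr (sin phi) + Rsqr (cos phi)))%R by (unfold Rsqr; ring).
  rewrite sin2_cos2, Rmult_1_r. now apply sqrt_square.
Qed.

Lemma circ_period (r : R) : circ r (2 * PI) = circ r 0.
Proof. unfold circ. now rewrite cos_2PI, sin_2PI, cos_0, sin_0. Qed.

Lemma cder_circ_rad (r phi : R) : cder (fun u => circ u phi) r (circ 1 phi).
Proof. split; unfold circ; simpl; auto_derive; trivial; ring. Qed.

Lemma cder_circ_arg (r phi : R) : cder (fun v => circ r v) phi (Ci * circ r phi).
Proof. split; unfold circ; simpl; auto_derive; trivial; ring. Qed.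

Lemma circ_scal (r phi : R) : circ r phi = RtoC r * circ 1 phi.
Proof. apply injective_projections; simpl; ring. Qed.

(** Integral over the circle of radius [r] against [d phi], not [dz]. *)
Definition cint (F : C -> C) (r : R) : C :=
  (RInt (fun phi => Re (F (circ r phi))) 0 (2 * PI),
   RInt (fun phi => Im (F (circ r phi))) 0 (2 * PI)).

Lemma continuity_2d_circ (F : C -> C) (r phi : R) : ccont F (circ r phi) ->
  continuity_2d_pt (fun v u => Re (F (circ u v))) phi r /\
  continuity_2d_pt (fun v u => Im (F (circ u v))) phi r.
Proof.
  intros H.
  assert (CC : continuity_2d_pt (fun v u => u * cos v)%R phi r).
  { apply (continuity_2d_pt_mult (fun _ u => u) (fun v _ => cos v)).
    - apply continuity_2d_pt_id2.
    - apply (continuity_1d_2d_pt_comp cos (fun v _ => v)); [ apply continuity_cos | apply continuity_2d_pt_id1 ]. }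
  assert (CS : continuity_2d_pt (fun v u => u * sin v)%R phi r).
  { apply (continuity_2d_pt_mult (fun _ u => u) (fun v _ => sin v)).
    - apply continuity_2d_pt_id2.
    - apply (continuity_1d_2d_pt_comp sin (fun v _ => v)); [ apply continuity_sin | apply continuity_2d_pt_id1 ]. }
  assert (K : forall eps : posreal, locally_2d (fun v u => Cmod (F (circ u v) - F (circ r phi)) < eps)%R phi r).
  { intros eps. destruct (H eps (cond_pos eps)) as [d [Pd Bd]].
    assert (Pd2 : (0 < d / 2)%R) by lra.
    generalize (locally_2d_and _ _ _ _ (CC (mkposreal _ Pd2)) (CS (mkposreal _ Pd2))).
    apply locally_2d_impl, locally_2d_forall. simpl. intros v u [H1 H2]. apply Bd.
    eapply Rle_lt_trans; [ apply Cmod_le_re_im | ]. simpl. unfold Rminus in *. lra. }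
  split; intros eps; generalize (K eps); apply locally_2d_impl, locally_2d_forall; intros v u B;
    (eapply Rle_lt_trans; [ | apply B ]);
    [ eapply Rle_trans; [ | apply re_le_Cmod ] | eapply Rle_trans; [ | apply Im_le_Cmod ] ];
    right; reflexivity.
Qed.

Lemma continuity_2d_pt_1d_l (f : R -> R -> R) (x y : R) :
  continuity_2d_pt f x y -> continuous (fun u => f u y) x.
Proof.
  intros H. apply continuity_pt_filterlim. intros eps He.
  destruct (H (mkposreal eps He)) as [d Hd].
  exists d. split; [ apply cond_pos | ]. intros u [_ Hu].
  apply (Hd u y); [ exact Hu | ]. rewrite Rminus_eq_0, Rabs_R0. apply cond_pos.
Qed.

(** Uniform continuity near the segment from [(a, c)] to [(b, c)] bounds the difference of the
    integrands. It matters at the exceptional radius, where the integrand is continuous but need not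
    have a derivative in the radius. *)
Lemma RInt_param_continuity (f : R -> R -> R) (a b c : R) : (a <= b)%R ->
  (forall x, (a <= x <= b)%R -> continuity_2d_pt f x c) ->
  locally c (fun y => ex_RInt (fun x => f x y) a b) ->
  continuity_pt (fun y => RInt (fun x => f x y) a b) c.
Proof.
  intros Hab Hc Hex. apply continuity_pt_locally. intros eps.
  assert (Pe : (0 < eps / (2 * (b - a + 1)))%R) by (apply Rdiv_lt_0_compat; [ apply cond_pos | lra ]).
  destruct (uniform_continuity_2d_1d f a b c Hc (mkposreal _ Pe)) as [d Hd].
  assert (Hex0 := locally_singleton _ _ Hex).
  assert (L : locally c (fun y => Rabs (y - c) < d)%R) by now exists d.
  generalize (filter_and _ _ Hex L). apply filter_imp. intros y [Ey By].
  assert (E := RInt_minus (V := R_CompleteNormedModule) (fun x => f x y) (fun x => f x c) a b Ey Hex0).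
  change (Rabs (minus (RInt (fun x => f x y) a b) (RInt (fun x => f x c) a b)) < eps)%R.
  rewrite <- E.
  eapply Rle_lt_trans.
  { apply (abs_RInt_le_const _ a b (eps / (2 * (b - a + 1)))%R Hab).
    - now apply (ex_RInt_minus (V := R_NormedModule)).
    - intros t Ht. change (Rabs (f t y - f t c) <= eps / (2 * (b - a + 1)))%R. left. apply (Hd t c t y); try easy.
      + generalize (cond_pos d). lra.
      + apply Rabs_lt_between in By. lra.
      + rewrite Rminus_eq_0, Rabs_R0. apply cond_pos. }
  assert (Pe' := cond_pos eps).
  replace ((b - a) * (eps / (2 * (b - a + 1))))%R with (eps * ((b - a) / (2 * (b - a + 1))))%R by (field; lra).
  assert ((b - a) / (2 * (b - a + 1)) < 1)%R by (apply Rlt_div_l; lra).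
  nra.
Qed.

Lemma ex_RInt_circ (F : C -> C) (r : R) : (0 < r)%R ->
  (forall z, Cmod z = r -> ccont F z) ->
  ex_RInt (fun phi => Re (F (circ r phi))) 0 (2 * PI) /\
  ex_RInt (fun phi => Im (F (circ r phi))) 0 (2 * PI).
Proof.
  intros Hr H.
  split; apply (ex_RInt_continuous (V := R_CompleteNormedModule)); intros phi _.
  - apply (continuity_2d_pt_1d_l (fun v u => Re (F (circ u v)))), continuity_2d_circ, H.
    apply Cmod_circ. lra.
  - apply (continuity_2d_pt_1d_l (fun v u => Im (F (circ u v)))), continuity_2d_circ, H.
    apply Cmod_circ. lra.
Qed.

Lemma two_PI_pos : (0 < 2 * PI)%R.
Proof. generalize PI_RGT_0. lra. Qed.

(** The same increment [F (z + e) - F z] is close to [dF z0 * e], by strictness at [z0], and to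
    [dF z * e], by differentiability at [z]; dividing by [e] compares the two derivatives. *)
Lemma sderiv_ccont (F dF : C -> C) (z0 : C) (d0 : R) : (0 < d0)%R ->
  (forall z, (Cmod (z - z0) < d0)%R -> sderiv F z (dF z)) -> ccont dF z0.
Proof.
  intros Pd0 H eps He.
  assert (Z : (Cmod (z0 - z0) < d0)%R).
  { replace (z0 - z0) with (RtoC 0) by ring. now rewrite Cmod_0. }
  destruct (H z0 Z (eps / 3)%R) as [d1 [P1 B1]]; [ lra | ].
  exists (Rmin d0 d1). split; [ now apply Rmin_pos | ]. intros z Hz.
  assert (Hz0 := Rlt_le_trans _ _ _ Hz (Rmin_l _ _)).
  assert (Hz1 := Rlt_le_trans _ _ _ Hz (Rmin_r _ _)).
  destruct (H z Hz0 (eps / 3)%R) as [d2 [P2 B2]]; [ lra | ].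
  (* Small enough that [z + e] is within [d2] of [z] and within [d1] of [z0]. *)
  set (e := (Rmin d2 (d1 - Cmod (z - z0)) / 2)%R).
  assert (M1 := Rmin_l d2 (d1 - Cmod (z - z0))). assert (M2 := Rmin_r d2 (d1 - Cmod (z - z0))).
  assert (M3 : (0 < Rmin d2 (d1 - Cmod (z - z0)))%R) by (apply Rmin_pos; lra).
  assert (Pe : (0 < e)%R) by (unfold e; lra).
  assert (Ce : Cmod (z + RtoC e - z) = e).
  { replace (z + RtoC e - z) with (RtoC e) by ring. rewrite Cmod_R. apply Rabs_pos_eq; lra. }
  assert (C0 : Cmod (z - z) = 0%R).
  { replace (z - z) with (RtoC 0) by ring. apply Cmod_0. }
  assert (Cz : (Cmod (z + RtoC e - z0) <= e + Cmod (z - z0))%R).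
  { rewrite <- Ce at 2. replace (z + RtoC e - z0) with ((z + RtoC e - z) + (z - z0)) by ring.
    apply Cmod_triangle. }
  specialize (B1 (z + RtoC e) z ltac:(unfold e in *; lra) Hz1).
  specialize (B2 (z + RtoC e) z ltac:(unfold e in *; lra) ltac:(lra)).
  rewrite Ce in B1, B2.
  assert (T : (Cmod ((dF z - dF z0) * RtoC e) <= eps / 3 * e + eps / 3 * e)%R).
  { eapply Rle_trans; [ | apply Rplus_le_compat; [ apply B1 | apply B2 ] ].
    rewrite <- (Cmod_opp (F (z + RtoC e) - F z - dF z * (z + RtoC e - z))).
    eapply Rle_trans; [ | apply Cmod_triangle ]. right. f_equal. ring. }
  rewrite Cmod_mult, Cmod_R, (Rabs_pos_eq e) in T by lra.
  nra.
Qed.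

(** The radial derivative of the circle integral is the integral of an angular
    derivative, which vanishes by periodicity. *)
Lemma cint_derive_0 (F dF : C -> C) (r d0 : R) : (0 < d0 <= r)%R ->
  (forall z, (Rabs (Cmod z - r) < d0)%R -> sderiv F z (dF z)) ->
  cder (cint F) r 0.
Proof.
  intros Hr H.
  assert (CF : forall z, (Rabs (Cmod z - r) < d0)%R -> ccont F z)
    by (intros z Hz; apply hol_ccont; exists (dF z); auto).
  assert (CD : forall z, Cmod z = r -> ccont dF z).
  { intros z Hz. apply (sderiv_ccont F dF z d0); [ easy | ]. intros w Hw. apply H.
    rewrite <- Hz. eapply Rle_lt_trans; [ | apply Hw ].
    pose proof (Cmod_triangle_minus w z). pose proof (Cmod_triangle_minus z w) as T.
    rewrite Cmod_minus_sym in T. apply Rabs_le. lra. }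
  assert (Lr : forall phi u, (Rabs (u - r) < d0)%R -> cder (fun u => F (circ u phi)) u (dF (circ u phi) * circ 1 phi)).
  { intros phi u Hu. apply (cder_comp F (fun u => circ u phi)); [ | apply cder_circ_rad ].
    apply H. apply Rabs_lt_between in Hu. rewrite Cmod_circ by lra. apply Rabs_lt_between. lra. }
  assert (La : forall phi, cder (fun v => F (circ r v)) phi (dF (circ r phi) * (Ci * circ r phi))).
  { intros phi. apply (cder_comp F (fun v => circ r v)); [ | apply cder_circ_arg ].
    apply H. rewrite Cmod_circ, Rminus_eq_0, Rabs_R0 by lra. lra. }
  assert (Nr : locally r (fun u => Rabs (u - r) < d0)%R) by now exists (mkposreal d0 (proj1 Hr)).
  (* On the circle [G] is the radial derivative of [F], and [i r G] is the angular one. Written as a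
     function of [z], it falls under the continuity lemmas for circles. *)
  set (G := fun z => dF z * (z * / RtoC r)).
  assert (CG : forall z, Cmod z = r -> ccont G z).
  { intros z Hz. apply ccont_mult; [ now apply CD | ].
    apply ccont_mult; [ apply hol_ccont, hol_id | apply ccont_const ]. }
  assert (EG : forall phi, G (circ r phi) = dF (circ r phi) * circ 1 phi).
  { intros phi. unfold G. rewrite (circ_scal r phi) at 2. field. intros E. apply RtoC_inj in E. lra. }
  assert (EI : forall phi, dF (circ r phi) * (Ci * circ r phi) = RtoC r * (Ci * G (circ r phi))).
  { intros phi. rewrite EG, (circ_scal r phi). ring. }
  assert (CGd : forall phi, 
     continuity_2d_pt (fun v u => Re (dF (circ u v) * circ 1 v)) phi r /\
     continuity_2d_pt (fun v u => Im (dF (circ u v) * circ 1 v)) phi r).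
  { intros phi.
    assert (D := continuity_2d_circ dF r phi (CD _ ltac:(apply Cmod_circ; lra))).
    assert (Cc : continuity_2d_pt (fun v u : R => 1 * cos v)%R phi r).
    { apply continuity_2d_pt_mult; [ apply continuity_2d_pt_const | ].
      apply (continuity_1d_2d_pt_comp cos (fun v _ => v)); [ apply continuity_cos | apply continuity_2d_pt_id1 ]. }
    assert (Cs : continuity_2d_pt (fun v u : R => 1 * sin v)%R phi r).
    { apply continuity_2d_pt_mult; [ apply continuity_2d_pt_const | ].
      apply (continuity_1d_2d_pt_comp sin (fun v _ => v)); [ apply continuity_sin | apply continuity_2d_pt_id1 ]. }
    destruct D as [D1 D2]. split.
    - apply continuity_2d_pt_minus; apply continuity_2d_pt_mult; assumption.
    - apply continuity_2d_pt_plus; apply continuity_2d_pt_mult; assumption. }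
  (* The real part of the angular derivative is [- r Im G], and its integral over a period is an
     increment of [Re F], which vanishes. The real part of [G] is reached in the same way through
     [Im F]. *)
  assert (RIm : RInt (fun phi => Im (G (circ r phi))) 0 (2 * PI) = 0%R).
  { assert (J : is_RInt (fun phi => (- r) * Im (G (circ r phi)))%R 0 (2 * PI)
                 (minus (Re (F (circ r (2 * PI)))) (Re (F (circ r 0))))).
    { apply (is_RInt_derive (V := R_CompleteNormedModule) (fun phi => Re (F (circ r phi)))).
      - intros phi _. replace (- r * Im (G (circ r phi)))%R with (Re (dF (circ r phi) * (Ci * circ r phi))).
        { apply La. }
        rewrite EI. simpl. ring.
      - intros phi _. apply (continuous_scal_r (V := R_NormedModule) (- r)%R (fun phi => Im (G (circ r phi)))).
        apply (continuity_2d_pt_1d_l (fun v u => Im (G (circ u v)))), continuity_2d_circ, CG.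
        apply Cmod_circ. lra. }
    rewrite circ_period, minus_eq_zero in J.
    assert (J' := is_RInt_unique _ _ _ _ J).
    assert (J2 := RInt_scal (V := R_CompleteNormedModule) (fun phi => Im (G (circ r phi))) 0 (2 * PI) (- r)%R
                    (proj2 (ex_RInt_circ G r ltac:(lra) CG))).
    assert (J3 := eq_trans (eq_sym J2) J').
    clear J'; rename J3 into J'.
    change (- r * RInt (fun phi => Im (G (circ r phi))) 0 (2 * PI) = 0)%R in J'.
    apply Rmult_integral in J'. destruct J'; lra. }
  assert (RRe : RInt (fun phi => Re (G (circ r phi))) 0 (2 * PI) = 0%R).
  { assert (J : is_RInt (fun phi => r * Re (G (circ r phi)))%R 0 (2 * PI)
                 (minus (Im (F (circ r (2 * PI)))) (Im (F (circ r 0))))).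
    { apply (is_RInt_derive (V := R_CompleteNormedModule) (fun phi => Im (F (circ r phi)))).
      - intros phi _. replace (r * Re (G (circ r phi)))%R with (Im (dF (circ r phi) * (Ci * circ r phi))).
        { apply La. }
        rewrite EI. simpl. ring.
      - intros phi _. apply (continuous_scal_r (V := R_NormedModule) r (fun phi => Re (G (circ r phi)))).
        apply (continuity_2d_pt_1d_l (fun v u => Re (G (circ u v)))), continuity_2d_circ, CG.
        apply Cmod_circ. lra. }
    rewrite circ_period, minus_eq_zero in J.
    assert (J' := is_RInt_unique _ _ _ _ J).
    assert (J2 := RInt_scal (V := R_CompleteNormedModule) (fun phi => Re (G (circ r phi))) 0 (2 * PI) (r)%R
                    (proj1 (ex_RInt_circ G r ltac:(lra) CG))).
    assert (J3 := eq_trans (eq_sym J2) J').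
    clear J'; rename J3 into J'.
    change (r * RInt (fun phi => Re (G (circ r phi))) 0 (2 * PI) = 0)%R in J'.
    apply Rmult_integral in J'. destruct J'; lra. }
  assert (EX : locally r (fun y => 
     ex_RInt (fun phi => Re (F (circ y phi))) 0 (2 * PI) /\
     ex_RInt (fun phi => Im (F (circ y phi))) 0 (2 * PI))).
  { generalize Nr. apply filter_imp. intros y Hy. assert (Hy' := proj1 (Rabs_lt_between _ _) Hy). apply ex_RInt_circ; [ lra | ].
    intros z Hz. apply CF. now rewrite Hz. }
  assert (swap2d : forall (f : R -> R -> R) x y, continuity_2d_pt f x y -> continuity_2d_pt (fun u v => f v u) y x).
  { intros f x y Hf eps. destruct (Hf eps) as [d Hd]. exists d. intros u v Hu Hv. now apply Hd. }
  split.
  - assert (Z : RInt (fun t => Derive (fun u => Re (F (circ u t))) r) 0 (2 * PI) = 0%R).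
    { refine (eq_trans _ RRe). apply RInt_ext. intros phi _. rewrite EG. apply is_derive_unique, Lr.
        rewrite Rminus_eq_0, Rabs_R0. lra. }
    enough (J : is_derive (fun u => RInt (fun t => Re (F (circ u t))) 0 (2 * PI)) r
                  (RInt (fun t => Derive (fun u => Re (F (circ u t))) r) 0 (2 * PI)))
      by (rewrite Z in J; exact J).
    apply (is_derive_RInt_param (fun u t => Re (F (circ u t)))).
    + generalize Nr. apply filter_imp. intros y Hy phi _. eexists. exact (proj1 (Lr phi y Hy)).
    + intros phi _. apply (continuity_2d_pt_ext_loc (fun u v => Re (dF (circ u v) * circ 1 v))).
      * exists (mkposreal d0 (proj1 Hr)). simpl. intros u v Hu _. symmetry.
        apply is_derive_unique, (Lr v u Hu).
      * apply (swap2d (fun v u => Re (dF (circ u v) * circ 1 v))), CGd.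
    + generalize EX. apply filter_imp. tauto.
  - assert (Z : RInt (fun t => Derive (fun u => Im (F (circ u t))) r) 0 (2 * PI) = 0%R).
    { refine (eq_trans _ RIm). apply RInt_ext. intros phi _. rewrite EG. apply is_derive_unique, Lr.
        rewrite Rminus_eq_0, Rabs_R0. lra. }
    enough (J : is_derive (fun u => RInt (fun t => Im (F (circ u t))) 0 (2 * PI)) r
                  (RInt (fun t => Derive (fun u => Im (F (circ u t))) r) 0 (2 * PI)))
      by (rewrite Z in J; exact J).
    apply (is_derive_RInt_param (fun u t => Im (F (circ u t)))).
    + generalize Nr. apply filter_imp. intros y Hy phi _. eexists. exact (proj2 (Lr phi y Hy)).
    + intros phi _. apply (continuity_2d_pt_ext_loc (fun u v => Im (dF (circ u v) * circ 1 v))).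
      * exists (mkposreal d0 (proj1 Hr)). simpl. intros u v Hu _. symmetry.
        apply is_derive_unique, (Lr v u Hu).
      * apply (swap2d (fun v u => Im (dF (circ u v) * circ 1 v))), CGd.
    + generalize EX. apply filter_imp. tauto.
Qed.

Lemma MVT_const (f : R -> R) (a b : R) : (a <= b)%R ->
  (forall x, (a < x < b)%R -> is_derive f x 0%R) ->
  (forall x, (a <= x <= b)%R -> continuity_pt f x) -> f a = f b.
Proof.
  intros Hab H1 H2. destruct (MVT_gen f a b (fun _ => 0%R)) as [c [_ E]].
  - rewrite Rmin_left, Rmax_right by easy. exact H1.
  - rewrite Rmin_left, Rmax_right by easy. exact H2.
  - lra.
Qed.

(** The exceptional point stands for the radius of a circle across which the integrand is merely
    continuous. *)
Lemma MVT_const_but_one (f : R -> R) (a b c : R) : (a <= b)%R ->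
  (forall x, (a < x < b)%R -> x <> c -> is_derive f x 0%R) ->
  (forall x, (a <= x <= b)%R -> continuity_pt f x) -> f a = f b.
Proof.
  intros Hab H1 H2. destruct (Rle_lt_dec c a) as [Hc | Hc].
  { apply MVT_const; try easy. intros x Hx. apply H1; lra. }
  destruct (Rle_lt_dec b c) as [Hc' | Hc'].
  { apply MVT_const; try easy. intros x Hx. apply H1; lra. }
  transitivity (f c); apply MVT_const; try lra; intros x Hx; try (apply H1; lra); apply H2; lra.
Qed.

(** The radial derivative vanishes at every radius but [rho], and continuity in the radius bridges
    [rho]. This exceptional radius is 1 for the glued exterior products and [|w|] in Cauchy's
    formula at [w]. *)
Lemma cint_const_le (F : C -> C) (A B rho r1 r2 : R) : (0 <= A)%R ->
  (forall z, (A < Cmod z < B)%R -> ccont F z) ->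
  (forall z, (A < Cmod z < B)%R -> Cmod z <> rho -> hol F z) ->
  (A < r1)%R -> (r1 <= r2)%R -> (r2 < B)%R -> cint F r1 = cint F r2.
Proof.
  intros PA HC HH H1 H12 H2.
  assert (D : forall r, (r1 < r < r2)%R -> r <> rho -> cder (cint F) r 0).
  { intros r Hr Nr.
    set (d := Rmin (Rmin (r - A) (B - r)) (Rmin r (Rabs (r - rho)))).
    assert (Q : (0 < d /\ d <= r - A /\ d <= B - r /\ d <= r /\ d <= Rabs (r - rho))%R).
    { assert (Pr : (0 < Rabs (r - rho))%R) by (apply Rabs_pos_lt; lra).
      pose proof (Rmin_l (Rmin (r - A) (B - r)) (Rmin r (Rabs (r - rho)))).
      pose proof (Rmin_r (Rmin (r - A) (B - r)) (Rmin r (Rabs (r - rho)))).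
      pose proof (Rmin_l (r - A) (B - r)). pose proof (Rmin_r (r - A) (B - r)).
      pose proof (Rmin_l r (Rabs (r - rho))). pose proof (Rmin_r r (Rabs (r - rho))).
      unfold d. split; [ repeat apply Rmin_pos; lra | lra ]. }
    destruct Q as [Q0 [QA [QB [Qr Qd]]]].
    (* [epsilon] selects a derivative at each point; [d] keeps the ring around radius [r] inside the
       annulus and off the circle of radius [rho]. *)
    apply (cint_derive_0 F (fun z => epsilon (inhabits (RtoC 0)) (sderiv F z)) r d); [ lra | ].
    intros z Hz. apply epsilon_spec. assert (Hz' := proj1 (Rabs_lt_between _ _) Hz).
    apply HH; [ lra | ]. intros E. rewrite E, Rabs_minus_sym in Hz. lra. }
  assert (Cn : forall r, (r1 <= r <= r2)%R ->
    continuity_pt (fun y => Re (cint F y)) r /\ continuity_pt (fun y => Im (cint F y)) r).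
  { intros r Hr.
    assert (EX : locally r (fun y => 
     ex_RInt (fun phi => Re (F (circ y phi))) 0 (2 * PI) /\
     ex_RInt (fun phi => Im (F (circ y phi))) 0 (2 * PI))).
    { assert (P : (0 < Rmin (r - A) (B - r))%R) by (apply Rmin_pos; lra).
      exists (mkposreal _ P). intros y Hy. change (Rabs (y - r) < Rmin (r - A) (B - r))%R in Hy.
      assert (Y1 := Rlt_le_trans _ _ _ Hy (Rmin_l _ _)). assert (Y2 := Rlt_le_trans _ _ _ Hy (Rmin_r _ _)).
      apply Rabs_lt_between in Y1. apply Rabs_lt_between in Y2.
      apply ex_RInt_circ; [ lra | ]. intros z Hz. apply HC. lra. }
    assert (K : forall phi, ccont F (circ r phi)).
    { intros phi. apply HC. rewrite Cmod_circ; lra. }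
    generalize two_PI_pos; intros P2.
    split; simpl.
    - apply (RInt_param_continuity (fun v u => Re (F (circ u v)))); [ lra | | ].
      + intros phi _. now apply continuity_2d_circ.
      + generalize EX. apply filter_imp. tauto.
    - apply (RInt_param_continuity (fun v u => Im (F (circ u v)))); [ lra | | ].
      + intros phi _. now apply continuity_2d_circ.
      + generalize EX. apply filter_imp. tauto. }
  apply injective_projections.
  - apply (MVT_const_but_one (fun y => Re (cint F y)) r1 r2 rho H12); intros x Hx; [ intros Nx; now apply D | now apply Cn ].
  - apply (MVT_const_but_one (fun y => Im (cint F y)) r1 r2 rho H12); intros x Hx; [ intros Nx; now apply D | now apply Cn ].
Qed.

Lemma cint_const (F : C -> C) (A B rho r1 r2 : R) : (0 <= A)%R ->
  (forall z, (A < Cmod z < B)%R -> ccont F z) ->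
  (forall z, (A < Cmod z < B)%R -> Cmod z <> rho -> hol F z) ->
  (A < r1 < B)%R -> (A < r2 < B)%R -> cint F r1 = cint F r2.
Proof.
  intros PA HC HH H1 H2. destruct (Rle_lt_dec r1 r2).
  - apply (cint_const_le F A B rho); lra || assumption.
  - symmetry. apply (cint_const_le F A B rho); lra || assumption.
Qed.

(** * Mean values, and Cauchy's formula outside a disc *)

Definition ccont_circle (F : C -> C) (r : R) : Prop := forall z, Cmod z = r -> ccont F z.

Lemma cint_ext (F G : C -> C) (r : R) : (0 <= r)%R ->
  (forall z, Cmod z = r -> F z = G z) -> cint F r = cint G r.
Proof.
  intros Hr H. apply injective_projections; apply RInt_ext; intros phi _;
    now rewrite H by (now apply Cmod_circ).
Qed.

Lemma cint_plus (F G : C -> C) (r : R) : (0 < r)%R -> ccont_circle F r -> ccont_circle G r ->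
  cint (fun z => F z + G z) r = cint F r + cint G r.
Proof.
  intros Hr HF HG.
  destruct (ex_RInt_circ F r Hr HF) as [F1 F2]. destruct (ex_RInt_circ G r Hr HG) as [G1 G2].
  apply injective_projections.
  - exact (RInt_plus (V := R_CompleteNormedModule) _ _ _ _ F1 G1).
  - exact (RInt_plus (V := R_CompleteNormedModule) _ _ _ _ F2 G2).
Qed.

Lemma cint_scal (c : C) (F : C -> C) (r : R) : (0 < r)%R -> ccont_circle F r ->
  cint (fun z => c * F z) r = c * cint F r.
Proof.
  intros Hr HF. destruct (ex_RInt_circ F r Hr HF) as [F1 F2].
  assert (S1 := fun k => RInt_scal (V := R_CompleteNormedModule) _ _ _ k F1).
  assert (S2 := fun k => RInt_scal (V := R_CompleteNormedModule) _ _ _ k F2).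
  assert (X1 := fun k => ex_RInt_scal (V := R_CompleteNormedModule) _ _ _ k F1).
  assert (X2 := fun k => ex_RInt_scal (V := R_CompleteNormedModule) _ _ _ k F2).
  destruct c as [a b]. apply injective_projections.
  - transitivity (a * Re (cint F r) - b * Im (cint F r))%R; [ | reflexivity ].
    assert (E := RInt_minus (V := R_CompleteNormedModule) _ _ _ _ (X1 a) (X2 b)).
    rewrite S1, S2 in E. exact E.
  - transitivity (a * Im (cint F r) + b * Re (cint F r))%R; [ | reflexivity ].
    assert (E := RInt_plus (V := R_CompleteNormedModule) _ _ _ _ (X2 a) (X1 b)).
    rewrite S1, S2 in E. exact E.
Qed.

Lemma cint_cst (c : C) (r : R) : cint (fun _ => c) r = RtoC (2 * PI) * c.
Proof.
  unfold cint. rewrite !RInt_const.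
  apply injective_projections; simpl; unfold scal; simpl; unfold mult; simpl; unfold Re, Im; ring.
Qed.

Lemma ccont_scal (c : C) (F : C -> C) (z0 : C) : ccont F z0 -> ccont (fun z => c * F z) z0.
Proof. intros H. apply ccont_mult; [ apply ccont_const | easy ]. Qed.

Lemma cint_minus (F G : C -> C) (r : R) : (0 < r)%R -> ccont_circle F r -> ccont_circle G r ->
  cint (fun z => F z - G z) r = cint F r - cint G r.
Proof.
  intros Hr HF HG.
  rewrite (cint_ext _ (fun z => F z + (- (1)) * G z)) by (lra || (intros; ring)).
  rewrite cint_plus, cint_scal; try easy; [ ring | ].
  intros z Hz. now apply ccont_scal, HG.
Qed.

(** The constant is [4 PI] instead of [2 PI] because the real and the imaginary part are bounded
    separately. *)
Lemma cint_bound (F : C -> C) (r M : R) : (0 < r)%R -> ccont_circle F r ->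
  (forall phi, (0 <= phi <= 2 * PI)%R -> (Cmod (F (circ r phi)) <= M)%R) ->
  (Cmod (cint F r) <= 4 * PI * M)%R.
Proof.
  intros Hr HF HM. generalize two_PI_pos; intros P2.
  destruct (ex_RInt_circ F r Hr HF) as [F1 F2].
  assert (B1 := fun H => abs_RInt_le_const _ _ _ M (Rlt_le _ _ P2) F1 H).
  assert (B2 := fun H => abs_RInt_le_const _ _ _ M (Rlt_le _ _ P2) F2 H).
  eapply Rle_trans; [ apply Cmod_le_re_im | ]. unfold cint. simpl Re; simpl Im.
  rewrite Rminus_0_r in B1, B2.
  assert (B1' := B1 (fun t Ht => Rle_trans _ _ _ (re_le_Cmod _) (HM t Ht))).
  assert (B2' := B2 (fun t Ht => Rle_trans _ _ _ (Im_le_Cmod _) (HM t Ht))).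
  simpl in *. lra.
Qed.

Lemma cint_diff_bound (F G : C -> C) (r M : R) : (0 < r)%R -> ccont_circle F r -> ccont_circle G r ->
  (forall phi, (0 <= phi <= 2 * PI)%R -> (Cmod (F (circ r phi) - G (circ r phi)) <= M)%R) ->
  (Cmod (cint F r - cint G r) <= 4 * PI * M)%R.
Proof.
  intros Hr HF HG HM. rewrite <- cint_minus by easy. apply cint_bound; try easy.
  intros z Hz. apply ccont_minus; [ now apply HF | now apply HG ].
Qed.

Lemma circle_bounded (F : C -> C) (r : R) : (0 < r)%R -> ccont_circle F r ->
  exists M : R, (0 < M)%R /\ forall phi, (0 <= phi <= 2 * PI)%R -> (Cmod (F (circ r phi)) <= M)%R.
Proof.
  intros Hr HF.
  assert (K : forall phi, continuous (fun p => Re (F (circ r p))) phi /\ continuous (fun p => Im (F (circ r p))) phi).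
  { intros phi. assert (H := continuity_2d_circ F r phi (HF _ ltac:(apply Cmod_circ; lra))). split.
    - apply (continuity_2d_pt_1d_l (fun v u => Re (F (circ u v)))), H.
    - apply (continuity_2d_pt_1d_l (fun v u => Im (F (circ u v)))), H. }
  destruct (bounded_continuity (K := R_AbsRing) (V := R_NormedModule) _ 0 (2 * PI) (fun x _ => proj1 (K x))) as [M1 H1].
  destruct (bounded_continuity (K := R_AbsRing) (V := R_NormedModule) _ 0 (2 * PI) (fun x _ => proj2 (K x))) as [M2 H2].
  exists (Rabs M1 + Rabs M2 + 1)%R. split.
  { pose proof (Rabs_pos M1). pose proof (Rabs_pos M2). lra. }
  intros phi Hphi. eapply Rle_trans; [ apply Cmod_le_re_im | ].
  specialize (H1 phi Hphi). specialize (H2 phi Hphi).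
  change (Rabs (Re (F (circ r phi))) < M1)%R in H1. change (Rabs (Im (F (circ r phi))) < M2)%R in H2.
  pose proof (Rle_abs M1). pose proof (Rle_abs M2). lra.
Qed.

Lemma Cmod_small_eq (x y : C) (K : R) : (0 < K)%R ->
  (forall eps, (0 < eps)%R -> (Cmod (x - y) <= K * eps)%R) -> x = y.
Proof.
  intros PK H.
  assert (E : Cmod (x - y) = 0%R).
  { apply Rle_antisym; [ | apply Cmod_ge_0 ]. apply Rnot_lt_le. intros P.
    specialize (H (Cmod (x - y) / (2 * K))%R ltac:(apply Rdiv_lt_0_compat; lra)).
    replace (K * (Cmod (x - y) / (2 * K)))%R with (Cmod (x - y) / 2)%R in H by (field; lra). lra. }
  apply Cmod_eq_0 in E. replace x with ((x - y) + y) by ring. rewrite E. ring.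
Qed.

Definition lim_infty (f : C -> C) (l : C) : Prop :=
  forall eps : R, (0 < eps)%R -> exists M : R, forall z, (M < Cmod z)%R -> (Cmod (f z - l) < eps)%R.

Lemma cint_exterior (F : C -> C) (A rho r : R) (l : C) : (0 <= A)%R -> (A < r)%R ->
  (forall z, (A < Cmod z)%R -> ccont F z) ->
  (forall z, (A < Cmod z)%R -> Cmod z <> rho -> hol F z) ->
  lim_infty F l -> cint F r = RtoC (2 * PI) * l.
Proof.
  intros PA Hr HC HF Hl. apply (Cmod_small_eq _ _ (4 * PI)); [ generalize PI_RGT_0; lra | ].
  intros eps He. destruct (Hl eps He) as [M HM].
  set (R0 := (Rmax M r + 1)%R).
  assert (R0M : (M < R0)%R) by (pose proof (Rmax_l M r); unfold R0; lra).
  assert (R0r : (r < R0)%R) by (pose proof (Rmax_r M r); unfold R0; lra).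
  rewrite (cint_const F A (R0 + 1) rho r R0); try lra.
  - rewrite <- (cint_cst l R0). apply cint_diff_bound; [ lra | | | ].
    + intros z Hz. apply HC. lra.
    + intros z Hz. apply ccont_const.
    + intros phi _. left. apply HM. rewrite Cmod_circ; lra.
  - intros z Hz. now apply HC.
  - intros z Hz. now apply HF.
Qed.

Lemma cint_interior (F : C -> C) (B r : R) : (0 < r < B)%R ->
  (forall z, (Cmod z < B)%R -> hol F z) -> cint F r = RtoC (2 * PI) * F 0.
Proof.
  intros Hr HF. apply (Cmod_small_eq _ _ (4 * PI)); [ generalize PI_RGT_0; lra | ].
  intros eps He.
  destruct (hol_ccont F 0 (HF 0 ltac:(rewrite Cmod_0; lra)) eps He) as [d [Pd Hd]].
  set (e := Rmin (d / 2) r).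
  assert (Q : (0 < e /\ e < d /\ e <= r)%R).
  { pose proof (Rmin_l (d / 2) r). pose proof (Rmin_r (d / 2) r).
    assert (0 < e)%R by (apply Rmin_pos; lra). unfold e in *. lra. }
  (* With [rho = 0] no circle of the annulus is exceptional. *)
  rewrite (cint_const F 0 B 0 r e); try lra.
  - rewrite <- (cint_cst (F 0) e). apply cint_diff_bound; [ lra | | | ].
    + intros z Hz. apply hol_ccont, HF. lra.
    + intros z Hz. apply ccont_const.
    + intros phi _. left. apply Hd. replace (circ e phi - 0) with (circ e phi) by ring. rewrite Cmod_circ; lra.
  - intros z Hz. apply hol_ccont, HF. lra.
  - intros z Hz _. apply HF. lra.
Qed.

(** Cauchy's formula, applied to the divided difference [z (q z - q w) / (z - w)],
    which is continuous at [z = w] and holomorphic off the circle through [w]. *)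
Lemma cauchy_exterior (q : C -> C) (A r : R) (w : C) : (0 <= A < r)%R -> (r < Cmod w)%R ->
  (forall z, (A < Cmod z)%R -> hol q z) -> lim_infty q 0 ->
  cint (fun z => q z * (z / (w - z))) r = RtoC (2 * PI) * q w.
Proof.
  intros HA Hw Hq Hl.
  assert (Nzw : forall z, Cmod z <> Cmod w -> w - z <> 0).
  { intros z N E. apply N. f_equal. replace w with (w - z + z) by ring. rewrite E. ring. }
  destruct (Hq w ltac:(lra)) as [l Dl].
  (* The value [w * l], with [l] the derivative of [q] at [w], makes [k] continuous at [w]. *)
  set (k := fun z => if excluded_middle_informative (z = w) then w * l
                     else z * (q z - q w) / (z - w)).
  assert (Kz : forall z, z <> w -> k z = z * (q z - q w) / (z - w)).
  { intros z N. unfold k. now destruct (excluded_middle_informative (z = w)). }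
  assert (Kw : k w = w * l).
  { unfold k. now destruct (excluded_middle_informative (w = w)). }
  assert (hz : forall z, Cmod z <> Cmod w -> hol (fun z => z / (w - z)) z).
  { intros z N. apply hol_mult; [ apply hol_id | ].
    apply (hol_inv_comp (fun z => w - z)); [ now apply Nzw | ].
    apply hol_minus; [ apply hol_const | apply hol_id ]. }
  assert (Hk : forall z, (A < Cmod z)%R -> z <> w -> hol k z).
  { intros z Hz N.
    assert (P : (0 < Cmod (z - w))%R).
    { apply Cmod_gt_0. intros E. apply N. replace z with (z - w + w) by ring. rewrite E. ring. }
    apply (hol_ext_loc (fun z => z * (q z - q w) / (z - w)) _ z (Cmod (z - w)) P).
    - intros v Hv. symmetry. apply Kz. intros ->. rewrite Cmod_minus_sym in Hv. lra.
    - apply hol_mult; [ apply hol_mult; [ apply hol_id | apply hol_minus; [ now apply Hq | apply hol_const ] ] | ].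
      apply (hol_inv_comp (fun z => z - w)); [ now apply Cmod_gt_0 | ].
      apply hol_minus; [ apply hol_id | apply hol_const ]. }
  assert (Ck : ccont k w).
  { set (g := fun z => if excluded_middle_informative (z = w) then l else (q z - q w) / (z - w)).
    assert (Eg : forall z, k z = z * g z).
    { intros z. unfold k, g. destruct (excluded_middle_informative (z = w)) as [-> | _]; [ easy | ].
      unfold Cdiv. ring. }
    assert (Cg : ccont g w).
    { intros eps He. destruct (Dl (eps / 2)%R) as [d [Pd Bd]]; [ lra | ]. exists d. split; [ easy | ].
      intros z Hz. unfold g at 2. destruct (excluded_middle_informative (w = w)) as [_ | N]; [ | easy ].
      unfold g. destruct (excluded_middle_informative (z = w)) as [_ | N].
      { replace (l - l) with (RtoC 0) by ring. now rewrite Cmod_0. }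
      assert (N' : z - w <> 0).
      { intros E. apply N. replace z with (z - w + w) by ring. rewrite E. ring. }
      assert (P := proj1 (Cmod_gt_0 _) N').
      replace ((q z - q w) / (z - w) - l) with ((q z - q w - l * (z - w)) / (z - w)) by (field; easy).
      rewrite Cmod_div by easy. apply Rlt_div_l; [ easy | ].
      eapply Rle_lt_trans; [ apply Bd; [ easy | ] | nra ].
      replace (w - w) with (RtoC 0) by ring. now rewrite Cmod_0. }
    intros eps He. destruct (ccont_mult (fun z => z) g w (hol_ccont _ _ (hol_id w)) Cg eps He) as [d Hd].
    exists d. split; [ apply Hd | ]. intros z Hz. rewrite !Eg. now apply Hd. }
  (* At infinity [q z] tends to 0 and [z / (z - w)] to 1. *)
  assert (L : lim_infty k (- q w)).
  { intros eps He. destruct (Hl (Rmin 1 (eps / 4))%R) as [M HM]; [ apply Rmin_pos; lra | ].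
    pose proof (Cmod_ge_0 (q w)) as Pq.
    exists (Rmax M (Rmax (2 * Cmod w) (4 * Cmod w * (Cmod (q w) + 1) / eps)))%R. intros z Hz.
    assert (Z1 := Rle_lt_trans _ _ _ (Rmax_l _ _) Hz). assert (Z23 := Rle_lt_trans _ _ _ (Rmax_r _ _) Hz).
    assert (Z2 := Rle_lt_trans _ _ _ (Rmax_l _ _) Z23). assert (Z3 := Rle_lt_trans _ _ _ (Rmax_r _ _) Z23).
    assert (B := HM z Z1). replace (q z - 0) with (q z) in B by ring.
    assert (B1 := Rlt_le_trans _ _ _ B (Rmin_l _ _)). assert (B2 := Rlt_le_trans _ _ _ B (Rmin_r _ _)).
    apply Rlt_div_l in Z3; [ | easy ].
    assert (Nz : z <> w) by (intros ->; lra). rewrite Kz by easy.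
    assert (T : (Cmod z / 2 <= Cmod (z - w))%R) by (pose proof (Cmod_triangle_minus z w); lra).
    assert (N' : z - w <> 0) by (apply Cmod_gt_0; lra).
    replace (z * (q z - q w) / (z - w) - - q w) with ((z * q z - w * q w) / (z - w)) by (field; easy).
    rewrite Cmod_div by easy. apply Rlt_div_l; [ lra | ].
    replace (z * q z - w * q w) with (z * q z + - (w * q w)) by ring.
    eapply Rle_lt_trans; [ apply Cmod_triangle | ]. rewrite Cmod_opp, !Cmod_mult.
    assert (Cmod z * Cmod (q z) < Cmod z * (eps / 4))%R by (apply Rmult_lt_compat_l; lra).
    assert (eps * (Cmod z / 2) <= eps * Cmod (z - w))%R by (apply Rmult_le_compat_l; lra).
    pose proof (Cmod_ge_0 w). lra. }
  assert (I1 := cint_exterior k A (Cmod w) r (- q w)).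
  assert (I2 : cint k r = RtoC (2 * PI) * - q w).
  { apply I1; try easy; try lra.
    - intros z Hz. destruct (excluded_middle_informative (z = w)) as [-> | N]; [ easy | ].
      now apply hol_ccont, Hk.
    - intros z Hz N. apply Hk; [ easy | congruence ]. }
  (* The circle of radius [r] does not reach [w], so the integrand is holomorphic inside it, and it
     vanishes at the centre. *)
  assert (I3 : cint (fun z => z / (w - z)) r = 0).
  { rewrite (cint_interior _ (Cmod w)) by (lra || (intros z Hz; apply hz; lra)).
    unfold Cdiv. ring. }
  assert (C1 : ccont_circle (fun z => z / (w - z)) r).
  { intros z Hz. apply hol_ccont, hz. lra. }
  assert (C2 : ccont_circle (fun z => q z * (z / (w - z))) r).
  { intros z Hz. apply ccont_mult; [ apply hol_ccont, Hq; lra | now apply C1 ]. }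
  assert (E : cint k r = q w * cint (fun z => z / (w - z)) r - cint (fun z => q z * (z / (w - z))) r).
  { rewrite <- cint_scal, <- cint_minus; try easy; try lra.
    - apply cint_ext; [ lra | ]. intros z Hz. rewrite Kz by (intros ->; lra).
      field. split; [ apply Nzw; lra | ]. intros E0. apply (Nzw z ltac:(lra)).
      replace (w - z) with (- (z - w)) by ring. rewrite E0. ring.
    - intros z Hz. now apply ccont_scal, C1. }
  rewrite I2, I3 in E.
  replace (cint (fun z => q z * (z / (w - z))) r)
    with (q w * 0 - (q w * 0 - cint (fun z => q z * (z / (w - z))) r)) by ring.
  rewrite <- E. ring.
Qed.

(** By Cauchy's formula [w q(w)] is the mean of [z q(z) w / (w - z)] over the circle, and
    [w / (w - z)] tends to 1 uniformly for [|z| = r]. This is how the limit in the definition of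
    [Psi_of] is known to exist. *)
Lemma lim_infty_residue (q : C -> C) (A r : R) : (0 <= A < r)%R ->
  (forall z, (A < Cmod z)%R -> hol q z) -> lim_infty q 0 ->
  lim_infty (fun z => z * q z) (cint (fun z => z * q z) r / RtoC (2 * PI)).
Proof.
  intros HA Hq Hl.
  assert (Cq : ccont_circle q r) by (intros z Hz; apply hol_ccont, Hq; lra).
  destruct (circle_bounded q r ltac:(lra) Cq) as [M [PM HM]].
  assert (P2 := two_PI_pos). assert (N2 : RtoC (2 * PI) <> 0) by (intros E; apply RtoC_inj in E; lra).
  intros eps He. exists (r + 4 * M * r ^ 2 / eps)%R. intros w Hw.
  assert (PMr : (0 < M * r ^ 2)%R) by (apply Rmult_lt_0_compat; [ easy | apply pow_lt; lra ]).
  assert (Q : (0 < 4 * M * r ^ 2 / eps)%R) by (apply Rdiv_lt_0_compat; lra).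
  assert (Nzw : forall z, Cmod z <> Cmod w -> w - z <> 0).
  { intros z N E. apply N. f_equal. replace w with (w - z + z) by ring. rewrite E. ring. }
  assert (C1 : ccont_circle (fun z => q z * (z / (w - z))) r).
  { intros z Hz. apply ccont_mult; [ now apply Cq | apply hol_ccont ].
    apply hol_mult; [ apply hol_id | ]. apply (hol_inv_comp (fun z => w - z)); [ apply Nzw; lra | ].
    apply hol_minus; [ apply hol_const | apply hol_id ]. }
  assert (C2 : ccont_circle (fun z => z * q z) r).
  { intros z Hz. apply ccont_mult; [ apply hol_ccont, hol_id | now apply Cq ]. }
  assert (E := cauchy_exterior q A r w HA ltac:(lra) Hq Hl).
  replace (w * q w - cint (fun z => z * q z) r / RtoC (2 * PI))
    with ((w * cint (fun z => q z * (z / (w - z))) r - cint (fun z => z * q z) r) / RtoC (2 * PI))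
    by (rewrite E; field; exact N2).
  rewrite <- cint_scal by (lra || easy).
  rewrite Cmod_div, Cmod_R, (Rabs_pos_eq (2 * PI)) by (lra || easy).
  apply Rlt_div_l; [ easy | ].
  assert (Pw : (0 < Cmod w - r)%R) by lra.
  eapply Rle_lt_trans.
  { apply cint_diff_bound with (M := (M * r ^ 2 / (Cmod w - r))%R); [ lra | | easy | ].
    - intros z Hz. now apply ccont_scal, C1.
    - intros phi Hphi. set (z := circ r phi).
      assert (Cz : Cmod z = r) by (apply Cmod_circ; lra).
      assert (N : w - z <> 0) by (apply Nzw; lra).
      replace (w * (q z * (z / (w - z))) - z * q z) with (q z * (z * z / (w - z))) by (field; easy).
      rewrite Cmod_mult, Cmod_div, Cmod_mult, Cz by easy.
      assert (T : (Cmod w - r <= Cmod (w - z))%R) by (pose proof (Cmod_triangle_minus w z); lra).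
      replace (M * r ^ 2 / (Cmod w - r))%R with (M * (r * r / (Cmod w - r)))%R by (field; lra).
      apply Rmult_le_compat; [ apply Cmod_ge_0 | | now apply HM | ].
      + apply Rmult_le_pos; [ nra | left; apply Rinv_0_lt_compat; lra ].
      + apply Rmult_le_compat_l; [ nra | ]. apply Rinv_le_contravar; lra. }
  assert (H : (4 * (M * r ^ 2 / (Cmod w - r)) < eps)%R).
  { replace (4 * (M * r ^ 2 / (Cmod w - r)))%R with (4 * M * r ^ 2 / (Cmod w - r))%R by (field; lra).
    apply Rlt_div_l; [ easy | ].
    assert (Hw' : (4 * M * r ^ 2 / eps < Cmod w - r)%R) by lra. apply Rlt_div_l in Hw'; lra. }
  generalize PI_RGT_0. nra.
Qed.

(** * Limits as an increment tends to zero *)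

Definition lim_at_0 (f : R -> C) (l : C) : Prop :=
  forall eps : R, (0 < eps)%R -> exists d : R, (0 < d)%R /\
    forall h : R, (0 < Rabs h < d)%R -> (Cmod (f h - l) <= eps)%R.

Lemma lim_at_0_unique (f : R -> C) (l m : C) : lim_at_0 f l -> lim_at_0 f m -> l = m.
Proof.
  intros Hl Hm. apply (Cmod_small_eq l m 2); [ lra | ]. intros eps He.
  destruct (Hl eps He) as [d1 [P1 B1]]. destruct (Hm eps He) as [d2 [P2 B2]].
  set (h := (Rmin d1 d2 / 2)%R). assert (P := Rmin_pos _ _ P1 P2).
  assert (M1 := Rmin_l d1 d2). assert (M2 := Rmin_r d1 d2).
  assert (Ah : Rabs h = h) by (apply Rabs_pos_eq; unfold h; lra).
  specialize (B1 h ltac:(rewrite Ah; unfold h; lra)). specialize (B2 h ltac:(rewrite Ah; unfold h; lra)).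
  replace (l - m) with (- (f h - l) + (f h - m)) by ring.
  eapply Rle_trans; [ apply Cmod_triangle | ]. rewrite Cmod_opp. lra.
Qed.

Lemma lim_at_0_ext (f g : R -> C) (l : C) : (forall h, h <> 0%R -> f h = g h) -> lim_at_0 f l -> lim_at_0 g l.
Proof.
  intros E H eps He. destruct (H eps He) as [d [P B]]. exists d. split; [ easy | ].
  intros h Hh. rewrite <- E; [ now apply B | ]. intros ->. rewrite Rabs_R0 in Hh. lra.
Qed.

Lemma lim_at_0_plus (f g : R -> C) (l m : C) : lim_at_0 f l -> lim_at_0 g m -> lim_at_0 (fun h => f h + g h) (l + m).
Proof.
  intros Hf Hg eps He.
  destruct (Hf (eps / 2)%R) as [d1 [P1 B1]]; [ lra | ].
  destruct (Hg (eps / 2)%R) as [d2 [P2 B2]]; [ lra | ].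
  exists (Rmin d1 d2). split; [ now apply Rmin_pos | ]. intros h Hh.
  assert (M1 := Rmin_l d1 d2). assert (M2 := Rmin_r d1 d2).
  specialize (B1 h ltac:(lra)). specialize (B2 h ltac:(lra)).
  replace (f h + g h - (l + m)) with ((f h - l) + (g h - m)) by ring.
  eapply Rle_trans; [ apply Cmod_triangle | lra ].
Qed.

Lemma lim_at_0_scal (c : C) (f : R -> C) (l : C) : lim_at_0 f l -> lim_at_0 (fun h => c * f h) (c * l).
Proof.
  intros Hf eps He. pose proof (Cmod_ge_0 c).
  destruct (Hf (eps / (Cmod c + 1))%R) as [d [P B]]; [ apply Rdiv_lt_0_compat; lra | ].
  exists d. split; [ easy | ]. intros h Hh. specialize (B h Hh). apply Rle_div_r in B; [ | lra ].
  replace (c * f h - c * l) with (c * (f h - l)) by ring. rewrite Cmod_mult.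
  pose proof (Cmod_ge_0 (f h - l)). nra.
Qed.

Lemma lim_at_0_opp (f : R -> C) (l : C) : lim_at_0 f l -> lim_at_0 (fun h => - f h) (- l).
Proof.
  intros H. apply (lim_at_0_scal (- (1))) in H. replace (- l) with (- (1) * l) by ring.
  revert H. apply lim_at_0_ext. intros; ring.
Qed.

Lemma lim_at_0_minus (f g : R -> C) (l m : C) : lim_at_0 f l -> lim_at_0 g m -> lim_at_0 (fun h => f h - g h) (l - m).
Proof. intros Hf Hg. apply lim_at_0_plus; [ easy | now apply lim_at_0_opp ]. Qed.

Lemma lim_at_0_cder (f : R -> C) (t : R) (l : C) :
  lim_at_0 (fun h => (f (t + h)%R - f t) / RtoC h) l <-> cder f t l.
Proof.
  rewrite cder_eps. split.
  - intros H eps He. destruct (H eps He) as [d [P B]]. exists d. split; [ easy | ].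
    intros h Hh. destruct (Req_dec h 0) as [-> | N].
    { rewrite Rplus_0_r, Rabs_R0. replace (f t - f t - 0 * l) with (RtoC 0) by ring.
      rewrite Cmod_0. lra. }
    assert (Ph := Rabs_pos_lt h N). specialize (B h ltac:(lra)).
    assert (Nh : RtoC h <> 0) by (intros E; apply N, RtoC_inj, E).
    replace (f (t + h)%R - f t - RtoC h * l) with (((f (t + h)%R - f t) / RtoC h - l) * RtoC h)
      by (field; easy).
    rewrite Cmod_mult, Cmod_R. apply Rmult_le_compat_r; lra.
  - intros H eps He. destruct (H eps He) as [d [P B]]. exists d. split; [ easy | ].
    intros h Hh. specialize (B h ltac:(lra)).
    assert (N : h <> 0%R) by (intros ->; rewrite Rabs_R0 in Hh; lra).
    assert (Nh : RtoC h <> 0) by (intros E; apply N, RtoC_inj, E).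
    replace ((f (t + h)%R - f t) / RtoC h - l) with ((f (t + h)%R - f t - RtoC h * l) / RtoC h)
      by (field; easy).
    rewrite Cmod_div, Cmod_R by easy. apply Rle_div_l; lra.
Qed.

Definition unif_lim (r : R) (F : R -> C -> C) (G : C -> C) : Prop :=
  forall eps : R, (0 < eps)%R -> exists d : R, (0 < d)%R /\
    forall h : R, (0 < Rabs h < d)%R -> forall phi, (0 <= phi <= 2 * PI)%R ->
      (Cmod (F h (circ r phi) - G (circ r phi)) <= eps)%R.

Lemma lim_at_0_cint (r : R) (F : R -> C -> C) (G : C -> C) : (0 < r)%R ->
  (forall h, h <> 0%R -> ccont_circle (F h) r) -> ccont_circle G r -> unif_lim r F G ->
  lim_at_0 (fun h => cint (F h) r) (cint G r).
Proof.
  intros Hr HF HG H eps He. assert (PP := PI_RGT_0).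
  destruct (H (eps / (4 * PI))%R) as [d [P B]]; [ apply Rdiv_lt_0_compat; lra | ].
  exists d. split; [ easy | ]. intros h Hh.
  replace eps with (4 * PI * (eps / (4 * PI)))%R by (field; lra).
  apply cint_diff_bound; try easy.
  - apply HF. intros ->. rewrite Rabs_R0 in Hh. lra.
  - intros phi Hphi. now apply B.
Qed.

Lemma unif_lim_const (r : R) (G : C -> C) : unif_lim r (fun _ => G) G.
Proof.
  intros eps He. exists 1%R. split; [ lra | ]. intros h _ phi _.
  replace (G (circ r phi) - G (circ r phi)) with (RtoC 0) by ring. rewrite Cmod_0. lra.
Qed.

Lemma unif_lim_param (r : R) (f : R -> C) (l : C) : lim_at_0 f l -> unif_lim r (fun h _ => f h) (fun _ => l).
Proof. intros H eps He. destruct (H eps He) as [d [P B]]. exists d. split; auto. Qed.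

Lemma unif_lim_ext (r : R) (F F' : R -> C -> C) (G : C -> C) : (0 <= r)%R ->
  (forall h z, h <> 0%R -> Cmod z = r -> F h z = F' h z) -> unif_lim r F G -> unif_lim r F' G.
Proof.
  intros Hr E H eps He. destruct (H eps He) as [d [P B]]. exists d. split; [ easy | ].
  intros h Hh phi Hphi. rewrite <- E; [ now apply B | | now apply Cmod_circ ].
  intros ->. rewrite Rabs_R0 in Hh. lra.
Qed.

Lemma unif_lim_plus (r : R) (F F' : R -> C -> C) (G G' : C -> C) : unif_lim r F G -> unif_lim r F' G' ->
  unif_lim r (fun h z => F h z + F' h z) (fun z => G z + G' z).
Proof.
  intros Hf Hg eps He.
  destruct (Hf (eps / 2)%R) as [d1 [P1 B1]]; [ lra | ].
  destruct (Hg (eps / 2)%R) as [d2 [P2 B2]]; [ lra | ].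
  exists (Rmin d1 d2). split; [ now apply Rmin_pos | ]. intros h Hh phi Hphi.
  assert (M1 := Rmin_l d1 d2). assert (M2 := Rmin_r d1 d2).
  specialize (B1 h ltac:(lra) phi Hphi). specialize (B2 h ltac:(lra) phi Hphi).
  set (z := circ r phi) in *.
  replace (F h z + F' h z - (G z + G' z)) with ((F h z - G z) + (F' h z - G' z)) by ring.
  eapply Rle_trans; [ apply Cmod_triangle | lra ].
Qed.

Lemma unif_lim_mult (r : R) (F F' : R -> C -> C) (G G' : C -> C) : (0 < r)%R ->
  ccont_circle G r -> ccont_circle G' r -> unif_lim r F G -> unif_lim r F' G' ->
  unif_lim r (fun h z => F h z * F' h z) (fun z => G z * G' z).
Proof.
  intros Hr CG CG' Hf Hg eps He.
  destruct (circle_bounded G r Hr CG) as [M [PM BM]].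
  destruct (circle_bounded G' r Hr CG') as [M' [PM' BM']].
  destruct (Hf (eps / (2 * (M' + 1)))%R) as [d1 [P1 B1]]; [ apply Rdiv_lt_0_compat; lra | ].
  destruct (Hg (Rmin 1 (eps / (2 * M)))%R) as [d2 [P2 B2]];
    [ apply Rmin_pos; [ lra | apply Rdiv_lt_0_compat; lra ] | ].
  exists (Rmin d1 d2). split; [ now apply Rmin_pos | ]. intros h Hh phi Hphi.
  assert (M1 := Rmin_l d1 d2). assert (M2 := Rmin_r d1 d2).
  specialize (B1 h ltac:(lra) phi Hphi). specialize (B2 h ltac:(lra) phi Hphi).
  specialize (BM phi Hphi). specialize (BM' phi Hphi).
  set (z := circ r phi) in *.
  assert (B3 := Rle_trans _ _ _ B2 (Rmin_l _ _)). assert (B4 := Rle_trans _ _ _ B2 (Rmin_r _ _)).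
  apply Rle_div_r in B1; [ | lra ]. apply Rle_div_r in B4; [ | lra ].
  assert (T := Cmod_triangle_minus (F' h z) (G' z)).
  replace (F h z * F' h z - G z * G' z) with ((F h z - G z) * F' h z + G z * (F' h z - G' z)) by ring.
  eapply Rle_trans; [ apply Cmod_triangle | ]. rewrite !Cmod_mult.
  pose proof (Cmod_ge_0 (F h z - G z)). pose proof (Cmod_ge_0 (F' h z - G' z)).
  pose proof (Cmod_ge_0 (G z)).
  assert (Cmod (F h z - G z) * Cmod (F' h z) <= Cmod (F h z - G z) * (M' + 1))%R
    by (apply Rmult_le_compat_l; lra).
  assert (Cmod (G z) * Cmod (F' h z - G' z) <= M * Cmod (F' h z - G' z))%R
    by (apply Rmult_le_compat_r; lra).
  lra.
Qed.

(** [e^eta - 1] differs from [eta] by at most [12 |eta|^2], and [|eta| <= (M + 1) |h|] on the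
    circle. The constant [K] is chosen so that this remainder, divided by [|h|], is at most
    [eps / 2]. *)
Lemma unif_lim_Cexp (r : R) (eta : R -> C -> C) (G : C -> C) : (0 < r)%R -> ccont_circle G r ->
  unif_lim r (fun h z => eta h z / RtoC h) G ->
  unif_lim r (fun h z => (Cexp (eta h z) - 1) / RtoC h) G.
Proof.
  intros Hr CG H eps He. destruct (circle_bounded G r Hr CG) as [M [PM BM]].
  destruct (H (Rmin 1 (eps / 2))%R) as [d [P B]]; [ apply Rmin_pos; lra | ].
  set (K := (24 * (M + 1) ^ 2)%R).
  assert (PK : (0 < K)%R) by (apply Rmult_lt_0_compat; [ lra | apply pow_lt; lra ]).
  exists (Rmin d (Rmin (/ (M + 1)) (eps / K))). split.
  { repeat apply Rmin_pos; try easy; [ apply Rinv_0_lt_compat; lra | now apply Rdiv_lt_0_compat ]. }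
  intros h [Ph Hh] phi Hphi.
  assert (H1 := Rlt_le_trans _ _ _ Hh (Rmin_l _ _)). assert (H23 := Rlt_le_trans _ _ _ Hh (Rmin_r _ _)).
  assert (H2 := Rlt_le_trans _ _ _ H23 (Rmin_l _ _)). assert (H3 := Rlt_le_trans _ _ _ H23 (Rmin_r _ _)).
  specialize (B h (conj Ph H1) phi Hphi). specialize (BM phi Hphi). set (z := circ r phi) in *.
  assert (B1 := Rle_trans _ _ _ B (Rmin_l _ _)). assert (B2 := Rle_trans _ _ _ B (Rmin_r _ _)).
  assert (Nh : RtoC h <> 0) by (intros E; apply RtoC_inj in E; rewrite E, Rabs_R0 in Ph; lra).
  assert (T := Cmod_triangle_minus (eta h z / RtoC h) (G z)).
  set (e := eta h z) in *.
  assert (Ee : (Cmod e = Cmod (e / RtoC h) * Rabs h)%R).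
  { rewrite <- Cmod_R, <- Cmod_mult. f_equal. field. easy. }
  assert (Be : (Cmod e <= (M + 1) * Rabs h)%R) by (rewrite Ee; apply Rmult_le_compat_r; lra).
  assert (Be1 : (Cmod e <= 1)%R).
  { assert (U : ((M + 1) * / (M + 1) = 1)%R) by (field; lra).
    assert ((M + 1) * Rabs h <= (M + 1) * / (M + 1))%R by (apply Rmult_le_compat_l; lra). lra. }
  assert (X := Cexp_taylor1 e Be1).
  replace ((Cexp e - 1) / RtoC h - G z) with ((Cexp e - 1 - e) / RtoC h + (e / RtoC h - G z)) by (field; easy).
  eapply Rle_trans; [ apply Cmod_triangle | ]. rewrite Cmod_div, Cmod_R by easy.
  assert (Q : (Cmod (Cexp e - 1 - e) / Rabs h <= eps / 2)%R).
  { apply Rle_div_l; [ easy | ]. eapply Rle_trans; [ apply X | ].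
    assert (Cmod e ^ 2 <= ((M + 1) * Rabs h) ^ 2)%R by (apply pow_incr; split; [ apply Cmod_ge_0 | easy ]).
    apply Rlt_div_r in H3; [ | easy ]. unfold K in H3.
    replace (((M + 1) * Rabs h) ^ 2)%R with ((M + 1) ^ 2 * Rabs h * Rabs h)%R in * by ring.
    nra. }
  lra.
Qed.

Lemma circ_mult (r a phi : R) : circ 1 a * circ r phi = circ r (phi + a).
Proof.
  unfold circ. rewrite cos_plus, sin_plus. apply injective_projections; simpl; ring.
Qed.

(** Uniform continuity in angle and increment together, over a full period of the angle and near
    increment 0. *)
Lemma unif_lim_rotation (r : R) (F : C -> C) : (0 < r)%R -> ccont_circle F r ->
  unif_lim r (fun h z => F (circ 1 h * z)) F.
Proof.
  intros Hr CF eps He. assert (Pe : (0 < eps / 2)%R) by lra.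
  assert (K : forall phi, continuity_2d_pt (fun v h => Re (F (circ r (v + h)))) phi 0 /\
                          continuity_2d_pt (fun v h => Im (F (circ r (v + h)))) phi 0).
  { intros phi.
    assert (D : ccont F (circ r (phi + 0))) by (apply CF, Cmod_circ; lra).
    destruct (continuity_2d_circ F r (phi + 0) D) as [D1 D2].
    assert (S : continuity_2d_pt (fun v h : R => v + h)%R phi 0)
      by (apply continuity_2d_pt_plus; [ apply continuity_2d_pt_id1 | apply continuity_2d_pt_id2 ]).
    split.
    - apply (continuity_1d_2d_pt_comp (fun v => Re (F (circ r v))) (fun v h => (v + h)%R)); [ | easy ].
      apply continuity_pt_filterlim, (continuity_2d_pt_1d_l (fun v u => Re (F (circ u v)))), D1.
    - apply (continuity_1d_2d_pt_comp (fun v => Im (F (circ r v))) (fun v h => (v + h)%R)); [ | easy ].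
      apply continuity_pt_filterlim, (continuity_2d_pt_1d_l (fun v u => Im (F (circ u v)))), D2. }
  destruct (uniform_continuity_2d_1d _ 0 (2 * PI) 0 (fun x _ => proj1 (K x)) (mkposreal _ Pe)) as [d1 B1].
  destruct (uniform_continuity_2d_1d _ 0 (2 * PI) 0 (fun x _ => proj2 (K x)) (mkposreal _ Pe)) as [d2 B2].
  exists (Rmin d1 d2). split; [ apply Rmin_pos; apply cond_pos | ].
  intros h [_ Hh] phi Hphi.
  assert (H1 := Rlt_le_trans _ _ _ Hh (Rmin_l _ _)). assert (H2 := Rlt_le_trans _ _ _ Hh (Rmin_r _ _)).
  apply Rabs_def2 in H1. apply Rabs_def2 in H2.
  assert (Z : forall d : posreal, (Rabs (phi - phi) < d)%R)
    by (intros d; rewrite Rminus_eq_0, Rabs_R0; apply cond_pos).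
  assert (P1 := cond_pos d1). assert (P2 := cond_pos d2).
  specialize (B1 phi 0%R phi h Hphi ltac:(lra) Hphi ltac:(lra) (Z d1)).
  specialize (B2 phi 0%R phi h Hphi ltac:(lra) Hphi ltac:(lra) (Z d2)).
  rewrite circ_mult. rewrite Rplus_0_r in B1, B2. simpl in B1, B2.
  eapply Rle_trans; [ apply Cmod_le_re_im | ]. simpl. unfold Rminus in *. unfold Re, Im in *. lra.
Qed.

(** * Rows with a constant jump and their exterior products *)

(** A row vector [(e1, e2)] outside the unit circle and [(i1, i2)] inside it, with
    the constant jump [(e1, e2) = (i1, i2) G], [G = [[g, g*], [-g, g*]]].  The
    rows of [P e^{-i theta sigma_3}] are of this kind, for all values of [T]. *)
Record jump_row (g : C) (e1 e2 i1 i2 : C -> C) : Prop := JumpRow {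
  row_e1 : forall z, (1 < Cmod z)%R -> hol e1 z;
  row_e2 : forall z, (1 < Cmod z)%R -> hol e2 z;
  row_i1 : forall z, (0 < Cmod z < 1)%R -> hol i1 z;
  row_i2 : forall z, (0 < Cmod z < 1)%R -> hol i2 z;
  row_e1_cont : forall z, Cmod z = 1%R -> ccont_in (fun w => (1 <= Cmod w)%R) e1 z;
  row_e2_cont : forall z, Cmod z = 1%R -> ccont_in (fun w => (1 <= Cmod w)%R) e2 z;
  row_i1_cont : forall z, Cmod z = 1%R -> ccont_in (fun w => (Cmod w <= 1)%R) i1 z;
  row_i2_cont : forall z, Cmod z = 1%R -> ccont_in (fun w => (Cmod w <= 1)%R) i2 z;
  row_jump1 : forall z, Cmod z = 1%R -> e1 z = g * (i1 z - i2 z);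
  row_jump2 : forall z, Cmod z = 1%R -> e2 z = Cconj g * (i1 z + i2 z)
}.

Lemma ccont_in_mul_arg (D : C -> Prop) (f : C -> C) (c z0 : C) : Cmod c = 1%R ->
  (forall z, D z -> D (c * z)) -> ccont_in D f (c * z0) -> ccont_in D (fun z => f (c * z)) z0.
Proof.
  intros Hc HD H eps He. destruct (H eps He) as [d [P B]]. exists d. split; [ easy | ].
  intros z Dz Hz. apply B; [ now apply HD | ].
  replace (c * z - c * z0) with (c * (z - z0)) by ring. now rewrite Cmod_mult, Hc, Rmult_1_l.
Qed.

Lemma ccont_in_bar (D : C -> Prop) (f : C -> C) (z0 : C) :
  (forall z, D z -> D (Cconj z)) -> ccont_in D f (Cconj z0) ->
  ccont_in D (fun z => Cconj (f (Cconj z))) z0.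
Proof.
  intros HD H eps He. destruct (H eps He) as [d [P B]]. exists d. split; [ easy | ].
  intros z Dz Hz. rewrite <- Cminus_conj, Cmod_conj. apply B; [ now apply HD | ].
  now rewrite <- Cminus_conj, Cmod_conj.
Qed.

Lemma hol_mul_arg (f : C -> C) (c z0 : C) : hol f (c * z0) -> hol (fun z => f (c * z)) z0.
Proof.
  intros H. apply (hol_comp f (fun z => c * z)); [ | easy ].
  apply hol_mult; [ apply hol_const | apply hol_id ].
Qed.

(** The jump matrix no longer depends on [z] once the phase is absorbed into the row, and a rotation
    preserves the circle and both its sides. *)
Lemma jump_row_rotation (g : C) (e1 e2 i1 i2 : C -> C) (c : C) : Cmod c = 1%R ->
  jump_row g e1 e2 i1 i2 ->
  jump_row g (fun z => e1 (c * z)) (fun z => e2 (c * z)) (fun z => i1 (c * z)) (fun z => i2 (c * z)).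
Proof.
  intros Hc H.
  assert (M : forall z, Cmod (c * z) = Cmod z) by (intros z; rewrite Cmod_mult, Hc; ring).
  split; intros z Hz; rewrite <- M in Hz.
  - apply hol_mul_arg, (row_e1 _ _ _ _ _ H), Hz.
  - apply hol_mul_arg, (row_e2 _ _ _ _ _ H), Hz.
  - apply hol_mul_arg, (row_i1 _ _ _ _ _ H), Hz.
  - apply hol_mul_arg, (row_i2 _ _ _ _ _ H), Hz.
  - apply ccont_in_mul_arg; [ easy | intros w; now rewrite M | apply (row_e1_cont _ _ _ _ _ H), Hz ].
  - apply ccont_in_mul_arg; [ easy | intros w; now rewrite M | apply (row_e2_cont _ _ _ _ _ H), Hz ].
  - apply ccont_in_mul_arg; [ easy | intros w; now rewrite M | apply (row_i1_cont _ _ _ _ _ H), Hz ].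
  - apply ccont_in_mul_arg; [ easy | intros w; now rewrite M | apply (row_i2_cont _ _ _ _ _ H), Hz ].
  - apply (row_jump1 _ _ _ _ _ H), Hz.
  - apply (row_jump2 _ _ _ _ _ H), Hz.
Qed.

(** [G] conjugates [sigma_3] to [-sigma_1]; this is where the two parameters of
    [G(a,a)] being equal matters. *)
Lemma jump_row_sigma (g : C) (e1 e2 i1 i2 : C -> C) :
  jump_row g e1 e2 i1 i2 ->
  jump_row g e1 (fun z => - e2 z) (fun z => - i2 z) (fun z => - i1 z).
Proof.
  intros H. split; intros z Hz.
  - apply (row_e1 _ _ _ _ _ H), Hz.
  - apply hol_opp, (row_e2 _ _ _ _ _ H), Hz.
  - apply hol_opp, (row_i2 _ _ _ _ _ H), Hz.
  - apply hol_opp, (row_i1 _ _ _ _ _ H), Hz.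
  - apply (row_e1_cont _ _ _ _ _ H), Hz.
  - apply ccont_in_opp, (row_e2_cont _ _ _ _ _ H), Hz.
  - apply ccont_in_opp, (row_i2_cont _ _ _ _ _ H), Hz.
  - apply ccont_in_opp, (row_i1_cont _ _ _ _ _ H), Hz.
  - rewrite (row_jump1 _ _ _ _ _ H) by easy. ring.
  - rewrite (row_jump2 _ _ _ _ _ H) by easy. ring.
Qed.

(** The antilinear map [(v1, v2) -> (- conj v2, conj v1)] commutes with right multiplication by a
    matrix [[[alpha, beta], [- conj beta, conj alpha]]], and [G] has this form; [z -> conj z]
    preserves the circle and its sides. *)
Lemma jump_row_bar (g : C) (e1 e2 i1 i2 : C -> C) :
  jump_row g e1 e2 i1 i2 ->
  jump_row g (fun z => - Cconj (e2 (Cconj z))) (fun z => Cconj (e1 (Cconj z)))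
             (fun z => - Cconj (i2 (Cconj z))) (fun z => Cconj (i1 (Cconj z))).
Proof.
  intros H. split; intros z Hz; rewrite <- (Cmod_conj z) in Hz.
  - apply hol_opp, hol_bar, (row_e2 _ _ _ _ _ H), Hz.
  - apply hol_bar, (row_e1 _ _ _ _ _ H), Hz.
  - apply hol_opp, hol_bar, (row_i2 _ _ _ _ _ H), Hz.
  - apply hol_bar, (row_i1 _ _ _ _ _ H), Hz.
  - apply ccont_in_opp, ccont_in_bar; [ intros w; now rewrite Cmod_conj | apply (row_e2_cont _ _ _ _ _ H), Hz ].
  - apply ccont_in_bar; [ intros w; now rewrite Cmod_conj | apply (row_e1_cont _ _ _ _ _ H), Hz ].
  - apply ccont_in_opp, ccont_in_bar; [ intros w; now rewrite Cmod_conj | apply (row_i2_cont _ _ _ _ _ H), Hz ].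
  - apply ccont_in_bar; [ intros w; now rewrite Cmod_conj | apply (row_i1_cont _ _ _ _ _ H), Hz ].
  - rewrite (row_jump2 _ _ _ _ _ H) by easy. rewrite Cmult_conj, Cplus_conj, Cconj_conj. ring.
  - rewrite (row_jump1 _ _ _ _ _ H) by easy. rewrite Cmult_conj, Cminus_conj. ring.
Qed.

(** Across the circle an exterior product is multiplied by [det G = 2 g conj g = 1]. Glued into one
    function it is continuous away from 0 and holomorphic off the circle. The origin stays excluded,
    since the phase is singular there. The weight [z^k] has no jump and selects the coefficient that
    is wanted. *)
Lemma jump_row_wedge (g : C) (e1 e2 i1 i2 e1' e2' i1' i2' : C -> C) (k : nat) :
  g * Cconj g = / 2 ->
  jump_row g e1 e2 i1 i2 -> jump_row g e1' e2' i1' i2' ->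
  cint (fun z => z ^ k * (e1 z * e2' z - e2 z * e1' z)) 2
  = cint (fun z => z ^ k * (i1 z * i2' z - i2 z * i1' z)) (/ 2).
Proof.
  intros Hg H H'.
  set (fe := fun z => z ^ k * (e1 z * e2' z - e2 z * e1' z)).
  set (fi := fun z => z ^ k * (i1 z * i2' z - i2 z * i1' z)).
  set (f := fun z => if Rlt_dec (Cmod z) 1 then fi z else fe z).
  assert (Fi : forall z, (Cmod z < 1)%R -> f z = fi z).
  { intros z Hz. unfold f. destruct (Rlt_dec (Cmod z) 1); [ easy | lra ]. }
  assert (Fe : forall z, (1 <= Cmod z)%R -> f z = fe z).
  { intros z Hz. unfold f. destruct (Rlt_dec (Cmod z) 1); [ lra | easy ]. }
  assert (He : forall z, (1 < Cmod z)%R -> hol fe z).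
  { intros z Hz. apply hol_mult; [ apply (hol_pow (fun z => z)), hol_id | ].
    apply hol_minus; apply hol_mult.
    - now apply (row_e1 _ _ _ _ _ H). - now apply (row_e2 _ _ _ _ _ H').
    - now apply (row_e2 _ _ _ _ _ H). - now apply (row_e1 _ _ _ _ _ H'). }
  assert (Hi : forall z, (0 < Cmod z < 1)%R -> hol fi z).
  { intros z Hz. apply hol_mult; [ apply (hol_pow (fun z => z)), hol_id | ].
    apply hol_minus; apply hol_mult.
    - now apply (row_i1 _ _ _ _ _ H). - now apply (row_i2 _ _ _ _ _ H').
    - now apply (row_i2 _ _ _ _ _ H). - now apply (row_i1 _ _ _ _ _ H'). }
  assert (Ce : forall z, Cmod z = 1%R -> ccont_in (fun w => (1 <= Cmod w)%R) fe z).
  { intros z Hz. apply ccont_in_mult; [ apply ccont_in_ccont, hol_ccont, (hol_pow (fun z => z)), hol_id | ].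
    apply ccont_in_plus; [ | apply ccont_in_opp ]; apply ccont_in_mult.
    - now apply (row_e1_cont _ _ _ _ _ H). - now apply (row_e2_cont _ _ _ _ _ H').
    - now apply (row_e2_cont _ _ _ _ _ H). - now apply (row_e1_cont _ _ _ _ _ H'). }
  assert (Ci : forall z, Cmod z = 1%R -> ccont_in (fun w => (Cmod w <= 1)%R) fi z).
  { intros z Hz. apply ccont_in_mult; [ apply ccont_in_ccont, hol_ccont, (hol_pow (fun z => z)), hol_id | ].
    apply ccont_in_plus; [ | apply ccont_in_opp ]; apply ccont_in_mult.
    - now apply (row_i1_cont _ _ _ _ _ H). - now apply (row_i2_cont _ _ _ _ _ H').
    - now apply (row_i2_cont _ _ _ _ _ H). - now apply (row_i1_cont _ _ _ _ _ H'). }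
  assert (Eq : forall z, Cmod z = 1%R -> fe z = fi z).
  { intros z Hz. unfold fe, fi.
    rewrite (row_jump1 _ _ _ _ _ H), (row_jump2 _ _ _ _ _ H),
            (row_jump1 _ _ _ _ _ H'), (row_jump2 _ _ _ _ _ H') by easy.
    replace (i1 z * i2' z - i2 z * i1' z)
      with (/ 2 * (RtoC 2 * (i1 z * i2' z - i2 z * i1' z)))
      by (field; intros E; apply RtoC_inj in E; lra).
    rewrite <- Hg. ring. }
  assert (Hf : forall z, (0 < Cmod z)%R -> Cmod z <> 1%R -> hol f z).
  { intros z Hz N. destruct (Rlt_le_dec (Cmod z) 1) as [L | L].
    - apply (hol_ext_loc fi f z (1 - Cmod z)); [ lra | | apply Hi; lra ].
      intros w Hw. symmetry. apply Fi. pose proof (Cmod_triangle_minus w z). lra.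
    - apply (hol_ext_loc fe f z (Cmod z - 1)); [ lra | | apply He; lra ].
      intros w Hw. symmetry. apply Fe. pose proof (Cmod_triangle_minus z w) as T.
      rewrite Cmod_minus_sym in T. lra. }
  assert (Cf : forall z, (0 < Cmod z)%R -> ccont f z).
  { intros z Hz. destruct (Req_dec (Cmod z) 1) as [E | N]; [ | now apply hol_ccont, Hf ].
    intros eps Heps.
    destruct (Ce z E eps Heps) as [d1 [P1 B1]]. destruct (Ci z E eps Heps) as [d2 [P2 B2]].
    exists (Rmin d1 d2). split; [ now apply Rmin_pos | ]. intros w Hw.
    rewrite (Fe z) by lra. destruct (Rlt_le_dec (Cmod w) 1) as [L | L].
    - rewrite Fi, Eq by easy. apply B2; [ lra | eapply Rlt_le_trans; [ apply Hw | apply Rmin_r ] ].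
    - rewrite Fe by easy. apply B1; [ lra | eapply Rlt_le_trans; [ apply Hw | apply Rmin_l ] ]. }
  rewrite (cint_ext fe f 2) by (lra || (intros z Hz; symmetry; apply Fe; lra)).
  rewrite (cint_ext fi f (/ 2)) by (lra || (intros z Hz; symmetry; apply Fi; lra)).
  apply (cint_const f 0 3 1); try lra.
  - intros z Hz. apply Cf. lra.
  - intros z Hz N. apply Hf; [ lra | easy ].
Qed.

(** * From the Riemann-Hilbert problem to rows with a constant jump *)

Lemma entry_mul2 (M N : M2) (i j : nat) : (i < 2)%nat -> (j < 2)%nat ->
  entry (mul2 M N) i j = entry M i 0 * entry N 0 j + entry M i 1 * entry N 1 j.
Proof.
  intros Hi Hj. unfold entry at 1, mul2, Mmult. rewrite coeff_mat_bij by easy.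
  simpl pred. rewrite sum_Sn, sum_O. reflexivity.
Qed.

Definition theta (T : R) (z : C) : C := z ^ 2 * RtoC T + 2 * / z.

Lemma phase_theta (T : R) (z : C) : phase 0 T z = theta T z.
Proof. unfold phase, theta. ring. Qed.

Lemma entry_jump (a : C) (T : R) (z : C) :
  let k := RtoC (/ sqrt (Cmod a ^ 2 + Cmod a ^ 2)) in
  let E := Cexp (Ci * theta T z) in let E' := Cexp (- (Ci * theta T z)) in
  entry (jump (Gmat a a) 0 T z) 0 0 = k * a /\
  entry (jump (Gmat a a) 0 T z) 0 1 = k * Cconj a * (E' * E') /\
  entry (jump (Gmat a a) 0 T z) 1 0 = - (k * a) * (E * E) /\
  entry (jump (Gmat a a) 0 T z) 1 1 = k * Cconj a.
Proof.
  intros k E E'. unfold jump. rewrite !entry_mul2 by lia.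
  rewrite phase_theta. unfold exp_sigma3, Gmat, entry, coeff_mat; simpl.
  assert (X : E * E' = 1) by apply Cexp_opp_r.
  replace (- Ci * theta T z) with (- (Ci * theta T z)) by ring.
  replace (- - (Ci * theta T z)) with (Ci * theta T z) by ring.
  fold E E'.
  match goal with |- context [RtoC (/ ?s)] => replace (RtoC (/ s)) with k by (unfold k; do 3 f_equal; simpl; ring) end.
  repeat split.
  - transitivity (k * a * (E * E')); [ ring | rewrite X; ring ].
  - ring.
  - ring.
  - transitivity (k * Cconj a * (E * E')); [ ring | rewrite X; ring ].
Qed.

(** Balls of the uniform structure on [C] are squares in the two coordinates; the one of size
    [eps / 2] lies in the disc of radius [eps]. *)
Lemma Cmod_lt_ball (x : C) (eps : R) : (0 < eps)%R ->
  locally (T := C_UniformSpace) x (fun y => Cmod (y - x) < eps)%R.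
Proof. intros H. exists (mkposreal (eps / 2) ltac:(lra)). intros [y1 y2] [H1 H2]. destruct x as [x1 x2].
  change (Rabs (y1 - x1) < eps / 2)%R in H1. change (Rabs (y2 - x2) < eps / 2)%R in H2.
  eapply Rle_lt_trans; [ apply Cmod_le_re_im | ]. simpl. unfold Rminus in *. lra. Qed.

Lemma locally_Cmod (x : C) (S : C -> Prop) : locally (T := C_UniformSpace) x S ->
  exists d : R, (0 < d)%R /\ forall y, (Cmod (y - x) < d)%R -> S y.
Proof.
  intros [d Hd]. exists d. split; [ apply cond_pos | ]. intros y Hy. apply Hd.
  destruct y as [y1 y2], x as [x1 x2]. split.
  - change (Rabs (y1 - x1) < d)%R. eapply Rle_lt_trans; [ apply (re_le_Cmod ((y1, y2) - (x1, x2))) | exact Hy ].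
  - change (Rabs (y2 - x2) < d)%R. eapply Rle_lt_trans; [ apply (Im_le_Cmod ((y1, y2) - (x1, x2))) | exact Hy ].
Qed.

Lemma within_filterlim_eps (D : C -> Prop) (f : C -> C) (z0 l : C) :
  filterlim f (within D (locally (T := C_UniformSpace) z0)) (locally (T := C_UniformSpace) l) ->
  forall eps : R, (0 < eps)%R -> exists d : R, (0 < d)%R /\
    forall z, D z -> (Cmod (z - z0) < d)%R -> (Cmod (f z - l) < eps)%R.
Proof.
  intros H eps He. specialize (H _ (Cmod_lt_ball l eps He)).
  destruct (locally_Cmod z0 _ H) as [d [P B]]. exists d. split; [ easy | ].
  intros z Dz Hz. now apply B.
Qed.

Lemma lim_infty_filterlim (f : C -> C) (l : C) :
  filterlim f C_infty (locally (T := C_UniformSpace) l) <-> lim_infty f l.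
Proof.
  split.
  - intros H eps He. destruct (H _ (Cmod_lt_ball l eps He)) as [M HM]. now exists M.
  - intros H S HS. destruct (locally_Cmod l S HS) as [d [P B]].
    destruct (H d P) as [M HM]. exists M. intros z Hz. now apply B, HM.
Qed.

(** Near [z0] a point of [D] is handled by the limit of [p] and a point of the circle by the
    continuity of [b]; both limits are [b z0]. Values of [p] on the circle are overridden by [b]. *)
Lemma glue_boundary (D : C -> Prop) (p b : C -> C) (z0 : C) :
  Cmod z0 = 1%R ->
  (forall z, D z -> Cmod z <> 1%R) ->
  filterlim p (within D (locally (T := C_UniformSpace) z0)) (locally (T := C_UniformSpace) (b z0)) ->
  filterlim b (within (fun z => Cmod z = 1%R) (locally (T := C_UniformSpace) z0)) (locally (T := C_UniformSpace) (b z0)) ->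
  ccont_in (fun z => D z \/ Cmod z = 1%R)
    (fun z => if excluded_middle_informative (Cmod z = 1%R) then b z else p z) z0.
Proof.
  intros H0 HD H1 H2 eps He.
  destruct (within_filterlim_eps _ _ _ _ H1 eps He) as [d1 [P1 B1]].
  destruct (within_filterlim_eps _ _ _ _ H2 eps He) as [d2 [P2 B2]].
  exists (Rmin d1 d2). split; [ now apply Rmin_pos | ]. intros z Dz Hz.
  assert (Z1 := Rlt_le_trans _ _ _ Hz (Rmin_l _ _)). assert (Z2 := Rlt_le_trans _ _ _ Hz (Rmin_r _ _)).
  destruct (excluded_middle_informative (Cmod z0 = 1%R)) as [_ | N]; [ | easy ].
  destruct (excluded_middle_informative (Cmod z = 1%R)) as [E | N].
  - now apply B2.
  - apply B1; tauto.
Qed.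

Lemma hol_theta (T : R) (z : C) : z <> 0 -> hol (theta T) z.
Proof.
  intros N. apply hol_plus; apply hol_mult.
  - apply (hol_pow (fun z => z)), hol_id.
  - apply hol_const.
  - apply hol_const.
  - now apply hol_inv.
Qed.

(** Right multiplication by [e^{-i theta sigma_3}] turns the jump [e^{-i theta sigma_3} G e^{i theta
    sigma_3}] into the constant [G]. On the circle the outer row takes the values of [P_+] and the
    inner row those of [P_-], which is why there are two rows instead of one. *)
Lemma solves_RHP_jump_row (a : C) (T : R) (P : C -> M2) :
  solves_RHP (Gmat a a) 0 T P ->
  exists e1 e2 i1 i2 : C -> C,
    jump_row (RtoC (/ sqrt (Cmod a ^ 2 + Cmod a ^ 2)) * a) e1 e2 i1 i2 /\
    (forall z, (1 < Cmod z)%R ->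
       e1 z = entry (P z) 0 0 * Cexp (- (Ci * theta T z)) /\
       e2 z = entry (P z) 0 1 * Cexp (Ci * theta T z)) /\
    (forall z, (Cmod z < 1)%R ->
       i1 z = entry (P z) 0 0 * Cexp (- (Ci * theta T z)) /\
       i2 z = entry (P z) 0 1 * Cexp (Ci * theta T z)).
Proof.
  intros [HA [[Pp [Pm [Cp [Cm HB]]]] _]].
  set (g := RtoC (/ sqrt (Cmod a ^ 2 + Cmod a ^ 2)) * a).
  set (glue := fun (b p : C -> C) z => if excluded_middle_informative (Cmod z = 1%R) then b z else p z).
  set (E1 := fun z => Cexp (- (Ci * theta T z))). set (E2 := fun z => Cexp (Ci * theta T z)).
  assert (N0 : forall z, (0 < Cmod z)%R -> z <> 0) by (intros z; apply Cmod_gt_0).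
  assert (Hexp : forall z, (0 < Cmod z)%R -> hol E1 z /\ hol E2 z).
  { intros z Hz. assert (Hi : hol (fun z => Ci * theta T z) z)
      by (apply hol_mult; [ apply hol_const | now apply hol_theta, N0 ]).
    split; apply hol_Cexp_comp; [ now apply hol_opp | easy ]. }
  assert (Ge : forall b p z, Cmod z <> 1%R -> glue b p z = p z).
  { intros b p z N. unfold glue. now destruct (excluded_middle_informative (Cmod z = 1%R)). }
  assert (Gb : forall b p z, Cmod z = 1%R -> glue b p z = b z).
  { intros b p z N. unfold glue. now destruct (excluded_middle_informative (Cmod z = 1%R)). }
  assert (Hgl : forall b E j z, (j < 2)%nat -> (0 < Cmod z)%R -> Cmod z <> 1%R -> hol E z ->
             hol (fun z => glue b (fun z => entry (P z) 0 j) z * E z) z).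
  { intros b E j z Hj Hz N HE. apply hol_mult; [ | easy ].
    apply (hol_ext_loc (fun z => entry (P z) 0 j) _ z (Rabs (Cmod z - 1))).
    - apply Rabs_pos_lt. lra.
    - intros w Hw. symmetry. apply Ge. intros E1w.
      pose proof (Cmod_triangle_minus w z). pose proof (Cmod_triangle_minus z w) as T2.
      rewrite Cmod_minus_sym in T2. rewrite E1w in *.
      unfold Rabs in Hw. destruct (Rcase_abs (Cmod z - 1)); lra.
    - apply analytic_at_hol, HA; lia || easy. }
  assert (Hce : forall E j z, (j < 2)%nat -> Cmod z = 1%R -> hol E z ->
     ccont_in (fun w => (1 <= Cmod w)%R)
       (fun z => glue (fun z => entry (Pp z) 0 j) (fun z => entry (P z) 0 j) z * E z) z).
  { intros E j z Hj Hz HE. apply ccont_in_mult; [ | now apply ccont_in_ccont, hol_ccont ].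
    intros eps He.
    destruct (glue_boundary (fun z => (1 < Cmod z)%R) (fun z => entry (P z) 0 j)
                (fun z => entry (Pp z) 0 j) z Hz) with (eps := eps) as [d [Pd Bd]]; try easy.
    - intros w Hw. lra.
    - apply (proj1 (HB z Hz)); lia || easy.
    - apply Cp; lia || easy.
    - exists d. split; [ easy | ]. intros w Hw. apply Bd. lra. }
  assert (Hci : forall E j z, (j < 2)%nat -> Cmod z = 1%R -> hol E z ->
     ccont_in (fun w => (Cmod w <= 1)%R)
       (fun z => glue (fun z => entry (Pm z) 0 j) (fun z => entry (P z) 0 j) z * E z) z).
  { intros E j z Hj Hz HE. apply ccont_in_mult; [ | now apply ccont_in_ccont, hol_ccont ].
    intros eps He.
    destruct (glue_boundary (fun z => (Cmod z < 1)%R) (fun z => entry (P z) 0 j)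
                (fun z => entry (Pm z) 0 j) z Hz) with (eps := eps) as [d [Pd Bd]]; try easy.
    - intros w Hw. lra.
    - apply (proj1 (proj2 (HB z Hz))); lia || easy.
    - apply Cm; lia || easy.
    - exists d. split; [ easy | ]. intros w Hw. apply Bd. lra. }
  exists (fun z => glue (fun z => entry (Pp z) 0 0) (fun z => entry (P z) 0 0) z * E1 z),
         (fun z => glue (fun z => entry (Pp z) 0 1) (fun z => entry (P z) 0 1) z * E2 z),
         (fun z => glue (fun z => entry (Pm z) 0 0) (fun z => entry (P z) 0 0) z * E1 z),
         (fun z => glue (fun z => entry (Pm z) 0 1) (fun z => entry (P z) 0 1) z * E2 z).
  split; [ | split ].
  2, 3: intros z Hz; rewrite !Ge by lra; easy.
  split; intros z Hz.
  - apply Hgl; try lia; try lra. apply Hexp; lra.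
  - apply Hgl; try lia; try lra. apply Hexp; lra.
  - apply Hgl; try lia; try lra. apply Hexp; lra.
  - apply Hgl; try lia; try lra. apply Hexp; lra.
  - apply Hce; try lia; try easy. apply Hexp; lra.
  - apply Hce; try lia; try easy. apply Hexp; lra.
  - apply Hci; try lia; try easy. apply Hexp; lra.
  - apply Hci; try lia; try easy. apply Hexp; lra.
  - rewrite !Gb by easy. destruct (entry_jump a T z) as [J00 [J01 [J10 J11]]].
    rewrite (proj2 (proj2 (HB z Hz))), entry_mul2, J00, J10 by lia.
    change (Cexp (Ci * theta T z)) with (E2 z).
    assert (X : E2 z * E1 z = 1) by apply Cexp_opp_r.
    fold g. transitivity (g * (entry (Pm z) 0 0 * E1 z - entry (Pm z) 0 1 * E2 z * (E2 z * E1 z)));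
      [ ring | rewrite X; ring ].
  - rewrite !Gb by easy. destruct (entry_jump a T z) as [J00 [J01 [J10 J11]]].
    rewrite (proj2 (proj2 (HB z Hz))), entry_mul2, J01, J11 by lia.
    change (Cexp (- (Ci * theta T z))) with (E1 z).
    assert (X : E2 z * E1 z = 1) by apply Cexp_opp_r.
    replace (Cconj g) with (RtoC (/ sqrt (Cmod a ^ 2 + Cmod a ^ 2)) * Cconj a).
    2:{ unfold g. rewrite Cmult_conj. f_equal. apply injective_projections; simpl; ring. }
    set (g' := RtoC _ * Cconj a).
    transitivity (g' * (entry (Pm z) 0 0 * E1 z * (E2 z * E1 z) + entry (Pm z) 0 1 * E2 z));
      [ ring | rewrite X; ring ].
Qed.

(** This is [det G = 1] in the form that [jump_row_wedge] uses; [a <> 0] keeps the normalising root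
    away from 0. *)
Lemma jump_const_norm (a : C) : a <> 0 ->
  let g := RtoC (/ sqrt (Cmod a ^ 2 + Cmod a ^ 2)) * a in g * Cconj g = / 2.
Proof.
  intros Ha g. assert (Pa := proj1 (Cmod_gt_0 a) Ha).
  rewrite <- Cmod2_conj. unfold g. rewrite Cmod_mult, Cmod_R.
  assert (P2 : (0 < Cmod a ^ 2 + Cmod a ^ 2)%R) by nra.
  assert (Ps := sqrt_lt_R0 _ P2).
  rewrite Rabs_pos_eq by (left; now apply Rinv_0_lt_compat).
  rewrite <- RtoC_inv by lra. f_equal.
  rewrite Rpow_mult_distr, pow_inv, pow2_sqrt by lra. field. lra.
Qed.

(** * Limits at infinity, and functions holomorphic off the circle *)

Lemma lim_infty_const (c : C) : lim_infty (fun _ => c) c.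
Proof.
  intros eps He. exists 0%R. intros z _. replace (c - c) with (RtoC 0) by ring. now rewrite Cmod_0.
Qed.

Lemma lim_infty_ext (f g : C -> C) (l : C) (A : R) :
  (forall z, (A < Cmod z)%R -> f z = g z) -> lim_infty f l -> lim_infty g l.
Proof.
  intros E H eps He. destruct (H eps He) as [M HM]. exists (Rmax A M). intros z Hz.
  rewrite <- E by (eapply Rle_lt_trans; [ apply Rmax_l | apply Hz ]).
  apply HM. eapply Rle_lt_trans; [ apply Rmax_r | apply Hz ].
Qed.

Lemma lim_infty_plus (f g : C -> C) (l m : C) :
  lim_infty f l -> lim_infty g m -> lim_infty (fun z => f z + g z) (l + m).
Proof.
  intros Hf Hg eps He.
  destruct (Hf (eps / 2)%R) as [M1 B1]; [ lra | ]. destruct (Hg (eps / 2)%R) as [M2 B2]; [ lra | ].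
  exists (Rmax M1 M2). intros z Hz.
  specialize (B1 z (Rle_lt_trans _ _ _ (Rmax_l _ _) Hz)). specialize (B2 z (Rle_lt_trans _ _ _ (Rmax_r _ _) Hz)).
  replace (f z + g z - (l + m)) with ((f z - l) + (g z - m)) by ring.
  eapply Rle_lt_trans; [ apply Cmod_triangle | lra ].
Qed.

Lemma lim_infty_mult (f g : C -> C) (l m : C) :
  lim_infty f l -> lim_infty g m -> lim_infty (fun z => f z * g z) (l * m).
Proof.
  intros Hf Hg eps He. pose proof (Cmod_ge_0 l). pose proof (Cmod_ge_0 m).
  destruct (Hf (Rmin 1 (eps / (2 * (Cmod m + 1))))%R) as [M1 B1];
    [ apply Rmin_pos; [ lra | apply Rdiv_lt_0_compat; lra ] | ].
  destruct (Hg (eps / (2 * (Cmod l + 1)))%R) as [M2 B2]; [ apply Rdiv_lt_0_compat; lra | ].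
  exists (Rmax M1 M2). intros z Hz.
  specialize (B1 z (Rle_lt_trans _ _ _ (Rmax_l _ _) Hz)). specialize (B2 z (Rle_lt_trans _ _ _ (Rmax_r _ _) Hz)).
  assert (B3 := Rlt_le_trans _ _ _ B1 (Rmin_l _ _)).
  assert (B4 := Rlt_le_trans _ _ _ B1 (Rmin_r _ _)).
  apply Rlt_div_r in B4; [ | lra ]. apply Rlt_div_r in B2; [ | lra ].
  pose proof (Cmod_triangle_minus (f z) l) as T.
  replace (f z * g z - l * m) with (f z * (g z - m) + (f z - l) * m) by ring.
  eapply Rle_lt_trans; [ apply Cmod_triangle | ]. rewrite !Cmod_mult.
  pose proof (Cmod_ge_0 (f z - l)). pose proof (Cmod_ge_0 (g z - m)).
  assert (Cmod (f z) * Cmod (g z - m) <= (Cmod l + 1) * Cmod (g z - m))%R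
    by (apply Rmult_le_compat_r; lra).
  nra.
Qed.

Lemma lim_infty_mul_arg (f : C -> C) (c l : C) : Cmod c = 1%R ->
  lim_infty f l -> lim_infty (fun z => f (c * z)) l.
Proof.
  intros Hc H eps He. destruct (H eps He) as [M HM]. exists M. intros z Hz. apply HM.
  now rewrite Cmod_mult, Hc, Rmult_1_l.
Qed.

Definition bar (f : C -> C) (z : C) : C := Cconj (f (Cconj z)).

Lemma lim_infty_bar (f : C -> C) (l : C) : lim_infty f l -> lim_infty (bar f) (Cconj l).
Proof.
  intros H eps He. destruct (H eps He) as [M HM]. exists M. intros z Hz. unfold bar.
  rewrite <- Cminus_conj, Cmod_conj. apply HM. now rewrite Cmod_conj.
Qed.

Lemma lim_infty_Cexp_inv (c : C) : lim_infty (fun z => Cexp (c / z)) 1.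
Proof.
  intros eps He. destruct (hol_ccont _ _ (hol_Cexp 0) eps He) as [d [Pd Bd]].
  pose proof (Cmod_ge_0 c).
  exists (Cmod c / d)%R. intros z Hz.
  assert (Q : (0 <= Cmod c / d)%R) by (apply Rdiv_le_0_compat; lra).
  rewrite <- Cexp_0. apply Bd. replace (c / z - 0) with (c / z) by ring.
  rewrite Cmod_div by (apply Cmod_gt_0; lra).
  apply Rlt_div_l; [ lra | ]. apply Rlt_div_l in Hz; lra.
Qed.

Definition hol_off_circle (f : C -> C) : Prop := forall z, Cmod z <> 1%R -> hol f z.

Lemma hol_off_circle_bar (f : C -> C) : hol_off_circle f -> hol_off_circle (bar f).
Proof. intros H z Hz. apply hol_bar, H. now rewrite Cmod_conj. Qed.

Lemma hol_off_circle_mul_arg (f : C -> C) (c : C) : Cmod c = 1%R ->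
  hol_off_circle f -> hol_off_circle (fun z => f (c * z)).
Proof. intros Hc H z Hz. apply hol_mul_arg, H. now rewrite Cmod_mult, Hc, Rmult_1_l. Qed.

(** Follows the syntax of the function. At the leaves [lra] derives [0 < |z|] or [|z| <> 1] from the
    context. The last clause undoes an eta-expansion, so that a hypothesis [hol_off_circle f] can
    match. *)
Ltac hol_auto := lazymatch goal with
  | |- hol (fun _ => ?c) _ => apply hol_const
  | |- hol (fun z => z) _ => apply hol_id
  | |- hol (fun z => @?f z + @?g z) _ => apply (hol_plus f g); hol_auto
  | |- hol (fun z => @?f z - @?g z) _ => apply (hol_minus f g); hol_auto
  | |- hol (fun z => - @?f z) _ => apply (hol_opp f); hol_auto
  | |- hol (fun z => @?f z * @?g z) _ => apply (hol_mult f g); hol_auto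
  | |- hol (fun z => @?f z / z) _ => apply (hol_mult f Cinv); hol_auto
  | |- hol (fun z => @?f z / ?c) _ => apply (hol_mult f (fun _ => / c)); hol_auto
  | |- hol Cinv _ => apply hol_inv, Cmod_gt_0; lra
  | |- hol (fun z => / z) _ => apply hol_inv, Cmod_gt_0; lra
  | |- hol (fun z => (@?f z) ^ ?n) _ => apply (hol_pow f n); hol_auto
  | |- hol (fun z => Cexp (@?f z)) _ => apply (hol_Cexp_comp f); hol_auto
  | H : hol_off_circle ?f |- hol ?f _ => apply H; lra
  | |- hol (fun z => ?f z) _ => change (fun z => f z) with f; hol_auto
  end.

(** [p] and [q] are the entries of the first row of a solution at [(0, T)], inside and
    outside the circle; their values on the circle do not matter. *)
Record rhp_row (g : C) (T : R) (p q : C -> C) : Prop := RhpRow {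
  rhp_hol1 : hol_off_circle p;
  rhp_hol2 : hol_off_circle q;
  rhp_lim1 : lim_infty p 1;
  rhp_lim2 : lim_infty q 0;
  rhp_jump : exists e1 e2 i1 i2 : C -> C,
    jump_row g e1 e2 i1 i2 /\
    (forall z, (1 < Cmod z)%R ->
       e1 z = p z * Cexp (- (Ci * theta T z)) /\ e2 z = q z * Cexp (Ci * theta T z)) /\
    (forall z, (Cmod z < 1)%R ->
       i1 z = p z * Cexp (- (Ci * theta T z)) /\ i2 z = q z * Cexp (Ci * theta T z))
}.

Lemma solves_RHP_rhp_row (a : C) (T : R) (P : C -> M2) : solves_RHP (Gmat a a) 0 T P ->
  rhp_row (RtoC (/ sqrt (Cmod a ^ 2 + Cmod a ^ 2)) * a) T
    (fun z => entry (P z) 0 0) (fun z => entry (P z) 0 1).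
Proof.
  intros H. assert (HJ := solves_RHP_jump_row a T P H). destruct H as [HA [_ HL]]. split; try easy.
  - intros z Hz. apply analytic_at_hol, HA; lia || easy.
  - intros z Hz. apply analytic_at_hol, HA; lia || easy.
  - apply (lim_infty_filterlim _ 1), (HL 0%nat 0%nat); lia.
  - apply (lim_infty_filterlim _ 0), (HL 0%nat 1%nat); lia.
Qed.

(** * Bilinear identities between first rows *)

Lemma theta_shift (T T' : R) (z : C) : theta T' z - theta T z = RtoC (T' - T) * z ^ 2.
Proof. unfold theta. rewrite RtoC_minus. ring. Qed.

Lemma theta_conj (T : R) (z : C) : z <> 0 -> Cconj (theta T (Cconj z)) = theta T z.
Proof.
  intros N. assert (N' : Cconj z <> 0) by (apply Cmod_gt_0; rewrite Cmod_conj; now apply Cmod_gt_0).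
  unfold theta. rewrite Cplus_conj, !Cmult_conj, Cpow_conj, Cinv_conj, Cconj_conj by easy.
  f_equal; f_equal; apply injective_projections; simpl; ring.
Qed.

Lemma Cexp_iconj (u : C) : Cconj (Cexp (Ci * u)) = Cexp (- (Ci * Cconj u)).
Proof. rewrite Cexp_conj. f_equal. rewrite Cmult_conj. apply injective_projections; simpl; ring. Qed.

Lemma Cexp_miconj (u : C) : Cconj (Cexp (- (Ci * u))) = Cexp (Ci * Cconj u).
Proof. rewrite Cexp_conj. f_equal. rewrite Copp_conj, Cmult_conj. apply injective_projections; simpl; ring. Qed.

(** The term [2/z] is common to the phases at [T] and [T'] and cancels. What remains is entire, so
    [F] is holomorphic at the origin and its inner mean can be read off at [z = 0]. *)
Lemma wedge_shift (g : C) (T T' : R) (p q p' q' : C -> C) (k : nat) : g * Cconj g = / 2 ->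
  rhp_row g T p q -> rhp_row g T' p' q' ->
  let F := fun z => z ^ k * (p z * q' z) * Cexp (Ci * (RtoC (T' - T) * z ^ 2))
                    - z ^ k * (q z * p' z) * Cexp (- (Ci * (RtoC (T' - T) * z ^ 2))) in
  cint F 2 = cint F (/ 2).
Proof.
  intros Hg H H' F.
  destruct (rhp_jump _ _ _ _ H) as [e1 [e2 [i1 [i2 [J [Je Ji]]]]]].
  destruct (rhp_jump _ _ _ _ H') as [e1' [e2' [i1' [i2' [J' [Je' Ji']]]]]].
  assert (W := jump_row_wedge g _ _ _ _ _ _ _ _ k Hg J J').
  rewrite (cint_ext F (fun z => z ^ k * (e1 z * e2' z - e2 z * e1' z)) 2).
  2: lra.
  2:{ intros z Hz. destruct (Je z ltac:(lra)) as [-> ->]. destruct (Je' z ltac:(lra)) as [-> ->].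
      unfold F. rewrite <- theta_shift.
      replace (Ci * (theta T' z - theta T z)) with (- (Ci * theta T z) + Ci * theta T' z) by ring.
      replace (- (- (Ci * theta T z) + Ci * theta T' z)) with (Ci * theta T z + - (Ci * theta T' z)) by ring.
      rewrite !Cexp_plus. ring. }
  rewrite (cint_ext F (fun z => z ^ k * (i1 z * i2' z - i2 z * i1' z)) (/ 2)).
  2: lra.
  2:{ intros z Hz. destruct (Ji z ltac:(lra)) as [-> ->]. destruct (Ji' z ltac:(lra)) as [-> ->].
      unfold F. rewrite <- theta_shift.
      replace (Ci * (theta T' z - theta T z)) with (- (Ci * theta T z) + Ci * theta T' z) by ring.
      replace (- (- (Ci * theta T z) + Ci * theta T' z)) with (Ci * theta T z + - (Ci * theta T' z)) by ring.
      rewrite !Cexp_plus. ring. }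
  exact W.
Qed.

(** As [theta] is real on the real axis, reflecting the second row inverts its phase factor, and
    [2/z] cancels again. The double minus gives [F] the shape [A e^eta - B e^(-eta)] that
    [lim_at_0_cint_exp] treats. *)
Lemma wedge_bar (g : C) (T T' : R) (p q p' q' : C -> C) (k : nat) : g * Cconj g = / 2 ->
  rhp_row g T p q -> rhp_row g T' p' q' ->
  let F := fun z => z ^ k * (p z * bar p' z) * Cexp (Ci * (RtoC (T' - T) * z ^ 2))
                    - - (z ^ k * (q z * bar q' z)) * Cexp (- (Ci * (RtoC (T' - T) * z ^ 2))) in
  cint F 2 = cint F (/ 2).
Proof.
  intros Hg H H' F.
  destruct (rhp_jump _ _ _ _ H) as [e1 [e2 [i1 [i2 [J [Je Ji]]]]]].
  destruct (rhp_jump _ _ _ _ H') as [e1' [e2' [i1' [i2' [J' [Je' Ji']]]]]].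
  assert (W := jump_row_wedge g _ _ _ _ _ _ _ _ k Hg J (jump_row_bar _ _ _ _ _ J')).
  simpl in W.
  rewrite (cint_ext F (fun z => z ^ k * (e1 z * Cconj (e1' (Cconj z)) - e2 z * - Cconj (e2' (Cconj z)))) 2).
  2: lra.
  2:{ intros z Hz. assert (N : z <> 0) by (apply Cmod_gt_0; lra).
      destruct (Je z ltac:(lra)) as [-> ->]. destruct (Je' (Cconj z) ltac:(rewrite Cmod_conj; lra)) as [-> ->].
      unfold F, bar. rewrite <- theta_shift, !Cmult_conj, Cexp_iconj, Cexp_miconj, theta_conj by easy.
      replace (Ci * (theta T' z - theta T z)) with (- (Ci * theta T z) + Ci * theta T' z) by ring.
      replace (- (- (Ci * theta T z) + Ci * theta T' z)) with (Ci * theta T z + - (Ci * theta T' z)) by ring.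
      rewrite !Cexp_plus. ring. }
  rewrite (cint_ext F (fun z => z ^ k * (i1 z * Cconj (i1' (Cconj z)) - i2 z * - Cconj (i2' (Cconj z)))) (/ 2)).
  2: lra.
  2:{ intros z Hz. assert (N : z <> 0) by (apply Cmod_gt_0; lra).
      destruct (Ji z ltac:(lra)) as [-> ->]. destruct (Ji' (Cconj z) ltac:(rewrite Cmod_conj; lra)) as [-> ->].
      unfold F, bar. rewrite <- theta_shift, !Cmult_conj, Cexp_iconj, Cexp_miconj, theta_conj by easy.
      replace (Ci * (theta T' z - theta T z)) with (- (Ci * theta T z) + Ci * theta T' z) by ring.
      replace (- (- (Ci * theta T z) + Ci * theta T' z)) with (Ci * theta T z + - (Ci * theta T' z)) by ring.
      rewrite !Cexp_plus. ring. }
  exact W.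
Qed.

(** A multiple of [1/z] survives in the exponent, so this identity is exploited only to first order
    in the angle, on both circles. *)
Lemma wedge_rotation (g : C) (T : R) (p q : C -> C) (k : nat) (c : C) : g * Cconj g = / 2 ->
  Cmod c = 1%R -> rhp_row g T p q ->
  let F := fun z => z ^ k * (p z * q (c * z)) * Cexp (Ci * (theta T (c * z) - theta T z))
                    - z ^ k * (q z * p (c * z)) * Cexp (- (Ci * (theta T (c * z) - theta T z))) in
  cint F 2 = cint F (/ 2).
Proof.
  intros Hg Hc H F.
  destruct (rhp_jump _ _ _ _ H) as [e1 [e2 [i1 [i2 [J [Je Ji]]]]]].
  assert (W := jump_row_wedge g _ _ _ _ _ _ _ _ k Hg J (jump_row_rotation _ _ _ _ _ c Hc J)).
  simpl in W.
  assert (M : forall z, Cmod (c * z) = Cmod z) by (intros z; rewrite Cmod_mult, Hc; ring).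
  rewrite (cint_ext F (fun z => z ^ k * (e1 z * e2 (c * z) - e2 z * e1 (c * z))) 2).
  2: lra.
  2:{ intros z Hz. destruct (Je z ltac:(lra)) as [-> ->]. destruct (Je (c * z) ltac:(rewrite M; lra)) as [-> ->].
      unfold F.
      replace (Ci * (theta T (c * z) - theta T z)) with (- (Ci * theta T z) + Ci * theta T (c * z)) by ring.
      replace (- (- (Ci * theta T z) + Ci * theta T (c * z))) with (Ci * theta T z + - (Ci * theta T (c * z))) by ring.
      rewrite !Cexp_plus. ring. }
  rewrite (cint_ext F (fun z => z ^ k * (i1 z * i2 (c * z) - i2 z * i1 (c * z))) (/ 2)).
  2: lra.
  2:{ intros z Hz. destruct (Ji z ltac:(lra)) as [-> ->]. destruct (Ji (c * z) ltac:(rewrite M; lra)) as [-> ->].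
      unfold F.
      replace (Ci * (theta T (c * z) - theta T z)) with (- (Ci * theta T z) + Ci * theta T (c * z)) by ring.
      replace (- (- (Ci * theta T z) + Ci * theta T (c * z))) with (Ci * theta T z + - (Ci * theta T (c * z))) by ring.
      rewrite !Cexp_plus. ring. }
  exact W.
Qed.

(** Under [z -> -z] the term [T z^2] of the phase is even and [2/z] is odd. Outside, [T z^2] cancels
    and [4/z] is left, harmless at infinity. Inside, [jump_row_sigma] has exchanged the two entries,
    so [2/z] cancels and [2 T z^2] is left, harmless at 0. Both means are therefore explicit without
    any limit of an increment. *)
Lemma wedge_reflection (g : C) (T : R) (p q : C -> C) : g * Cconj g = / 2 ->
  rhp_row g T p q ->
  cint (fun z => p z * bar p (- (1) * z) * Cexp (- (4 * Ci) / z)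
                 - q z * bar q (- (1) * z) * Cexp (4 * Ci / z)) 2
  = cint (fun z => - (p z * bar q (- (1) * z) * Cexp (- (2 * Ci * RtoC T * z ^ 2)))
                   - q z * bar p (- (1) * z) * Cexp (2 * Ci * RtoC T * z ^ 2)) (/ 2).
Proof.
  intros Hg H.
  destruct (rhp_jump _ _ _ _ H) as [e1 [e2 [i1 [i2 [J [Je Ji]]]]]].
  assert (Hc : Cmod (- (1)) = 1%R) by apply Cmod_m1.
  assert (W := jump_row_wedge g _ _ _ _ _ _ _ _ 0 Hg J
    (jump_row_bar _ _ _ _ _ (jump_row_sigma _ _ _ _ _ (jump_row_rotation _ _ _ _ _ _ Hc J)))).
  simpl in W.
  assert (M : forall z, Cmod (- (1) * z) = Cmod z) by (intros z; rewrite Cmod_mult, Hc; ring).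
  assert (K : forall z, - (1) * Cconj z = Cconj (- (1) * z)).
  { intros z. apply injective_projections; simpl; ring. }
  assert (ThM : forall z : C, z <> 0 -> theta T (- (1) * z) = z ^ 2 * RtoC T - 2 / z).
  { intros z N. unfold theta. field. easy. }
  rewrite (cint_ext (fun z => p z * bar p (- (1) * z) * Cexp (- (4 * Ci) / z)
                 - q z * bar q (- (1) * z) * Cexp (4 * Ci / z))
    (fun z => 1 * (e1 z * Cconj (e1 (- (1) * Cconj z)) - e2 z * - Cconj (- e2 (- (1) * Cconj z)))) 2).
  2: lra.
  2:{ intros z Hz. assert (N : z <> 0) by (apply Cmod_gt_0; lra).
      assert (N' : - (1) * z <> 0) by (apply Cmod_gt_0; rewrite M; lra).
      assert (Ey := ThM z N). rewrite K. assert (My := M z). set (y := - (1) * z) in *.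
      destruct (Je z ltac:(lra)) as [-> ->].
      destruct (Je (Cconj y) ltac:(rewrite Cmod_conj; lra)) as [-> ->].
      unfold bar. rewrite Copp_conj, !Cmult_conj, Cexp_iconj, Cexp_miconj, theta_conj, Ey by easy.
      replace (- (4 * Ci) / z) with (- (Ci * theta T z) + Ci * (z ^ 2 * RtoC T - 2 / z))
        by (unfold theta; field; easy).
      replace (4 * Ci / z) with (Ci * theta T z + - (Ci * (z ^ 2 * RtoC T - 2 / z)))
        by (unfold theta; field; easy).
      rewrite !Cexp_plus. ring. }
  rewrite (cint_ext (fun z => - (p z * bar q (- (1) * z) * Cexp (- (2 * Ci * RtoC T * z ^ 2)))
                   - q z * bar p (- (1) * z) * Cexp (2 * Ci * RtoC T * z ^ 2))
    (fun z => 1 * (i1 z * Cconj (- i2 (- (1) * Cconj z)) - i2 z * - Cconj (- i1 (- (1) * Cconj z)))) (/ 2)).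
  2: lra.
  2:{ intros z Hz. assert (N : z <> 0) by (apply Cmod_gt_0; lra).
      assert (N' : - (1) * z <> 0) by (apply Cmod_gt_0; rewrite M; lra).
      assert (Ey := ThM z N). rewrite K. assert (My := M z). set (y := - (1) * z) in *.
      destruct (Ji z ltac:(lra)) as [-> ->].
      destruct (Ji (Cconj y) ltac:(rewrite Cmod_conj; lra)) as [-> ->].
      unfold bar. rewrite !Copp_conj, !Cmult_conj, Cexp_iconj, Cexp_miconj, theta_conj, Ey by easy.
      replace (- (2 * Ci * RtoC T * z ^ 2)) with (- (Ci * theta T z) + - (Ci * (z ^ 2 * RtoC T - 2 / z)))
        by (unfold theta; field; easy).
      replace (2 * Ci * RtoC T * z ^ 2) with (Ci * theta T z + Ci * (z ^ 2 * RtoC T - 2 / z))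
        by (unfold theta; field; easy).
      rewrite !Cexp_plus. ring. }
  exact W.
Qed.

(** The derivative at [h = 0] of an integral of exponentials, needing only the
    continuity in [h] of the factors [A] and [B]. *)
Lemma lim_at_0_cint_exp (r : R) (A B eta : R -> C -> C) (A0 B0 G : C -> C) : (0 < r)%R ->
  (forall h, h <> 0%R -> ccont_circle (A h) r) -> (forall h, h <> 0%R -> ccont_circle (B h) r) ->
  (forall h z, h <> 0%R -> Cmod z = r -> hol (eta h) z) ->
  ccont_circle A0 r -> ccont_circle B0 r -> ccont_circle G r ->
  unif_lim r A A0 -> unif_lim r B B0 -> unif_lim r (fun h z => eta h z / RtoC h) G ->
  lim_at_0 (fun h => (cint (fun z => A h z * Cexp (eta h z) - B h z * Cexp (- eta h z)) r
                  - (cint (A h) r - cint (B h) r)) / RtoC h)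
       (cint (fun z => (A0 z + B0 z) * G z) r).
Proof.
  intros Hr CA CB He CA0 CB0 CG UA UB UG.
  assert (CmG : ccont_circle (fun z => - (1) * G z) r) by (intros z Hz; now apply ccont_scal, CG).
  (* The exponent [- eta] has the quotient limit [- G]; with the minus sign before [B] this produces
     the sum [A0 + B0]. *)
  assert (UmG : unif_lim r (fun h z => - eta h z / RtoC h) (fun z => - (1) * G z)).
  { apply (unif_lim_ext r (fun h z => - (1) * (eta h z / RtoC h))); [ lra | intros; unfold Cdiv; ring | ].
    apply (unif_lim_mult r (fun _ _ => - (1)) _ (fun _ => - (1)) G); try easy.
    - intros z _. apply ccont_const.
    - apply unif_lim_const. }
  assert (U1 := unif_lim_Cexp r _ _ Hr CG UG). assert (U2 := unif_lim_Cexp r _ _ Hr CmG UmG).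
  assert (CE1 : forall h z, h <> 0%R -> Cmod z = r -> ccont (fun z => (Cexp (eta h z) - 1) / RtoC h) z).
  { intros h z N Hz. apply hol_ccont. apply hol_mult; [ | apply hol_const ].
    apply hol_minus; [ | apply hol_const ]. apply hol_Cexp_comp. auto. }
  assert (CE2 : forall h z, h <> 0%R -> Cmod z = r -> ccont (fun z => (Cexp (- eta h z) - 1) / RtoC h) z).
  { intros h z N Hz. apply hol_ccont. apply hol_mult; [ | apply hol_const ].
    apply hol_minus; [ | apply hol_const ]. apply hol_Cexp_comp, hol_opp. auto. }
  assert (L1 := lim_at_0_cint r (fun h z => A h z * ((Cexp (eta h z) - 1) / RtoC h)) (fun z => A0 z * G z) Hr
    (fun h N z Hz => ccont_mult _ _ z (CA h N z Hz) (CE1 h z N Hz))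
    (fun z Hz => ccont_mult _ _ z (CA0 z Hz) (CG z Hz)) (unif_lim_mult r _ _ _ _ Hr CA0 CG UA U1)).
  assert (L2 := lim_at_0_cint r (fun h z => B h z * ((Cexp (- eta h z) - 1) / RtoC h)) (fun z => B0 z * (- (1) * G z)) Hr
    (fun h N z Hz => ccont_mult _ _ z (CB h N z Hz) (CE2 h z N Hz))
    (fun z Hz => ccont_mult _ _ z (CB0 z Hz) (CmG z Hz)) (unif_lim_mult r _ _ _ _ Hr CB0 CmG UB U2)).
  assert (L := lim_at_0_minus _ _ _ _ L1 L2).
  rewrite <- cint_minus in L; try easy.
  2: intros z Hz; now apply ccont_mult; [ apply CA0 | apply CG ].
  2: intros z Hz; now apply ccont_mult; [ apply CB0 | apply CmG ].
  rewrite (cint_ext _ (fun z => (A0 z + B0 z) * G z)) in L by (lra || (intros; ring)).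
  revert L. apply lim_at_0_ext. intros h N.
  assert (Nh : RtoC h <> 0) by (intros E; apply N, RtoC_inj, E).
  assert (CAE : ccont_circle (fun z => A h z * ((Cexp (eta h z) - 1) / RtoC h)) r)
    by (intros z Hz; apply ccont_mult; [ now apply CA | now apply CE1 ]).
  assert (CBE : ccont_circle (fun z => B h z * ((Cexp (- eta h z) - 1) / RtoC h)) r)
    by (intros z Hz; apply ccont_mult; [ now apply CB | now apply CE2 ]).
  (* The splitting [e^eta = 1 + h ((e^eta - 1) / h)] is exact for every [h <> 0]. *)
  assert (E : cint (fun z => A h z * Cexp (eta h z) - B h z * Cexp (- eta h z)) r =
     (cint (A h) r - cint (B h) r) +
     RtoC h * (cint (fun z => A h z * ((Cexp (eta h z) - 1) / RtoC h)) r
               - cint (fun z => B h z * ((Cexp (- eta h z) - 1) / RtoC h)) r)).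
  { rewrite <- (cint_minus (A h) (B h)), <- (cint_minus (fun z => A h z * _)), <- cint_scal, <- cint_plus; auto.
    - apply cint_ext; [ lra | ]. intros z Hz. field. easy.
    - intros z Hz. apply ccont_minus; [ now apply CA | now apply CB ].
    - intros z Hz. apply ccont_scal, ccont_minus; [ now apply CAE | now apply CBE ].
    - intros z Hz. apply ccont_minus; [ now apply CAE | now apply CBE ]. }
  rewrite E. field. easy.
Qed.

(** * Evaluation of the bilinear identities *)

Lemma two_PI_neq_0 : RtoC (2 * PI) <> 0.
Proof. intros E. apply RtoC_inj in E. generalize two_PI_pos. lra. Qed.

Lemma cint_exterior_2 (F : C -> C) (l : C) : (forall z, (1 < Cmod z)%R -> hol F z) ->
  lim_infty F l -> cint F 2 = RtoC (2 * PI) * l.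
Proof.
  intros HF Hl. apply (cint_exterior F 1 0 2 l); try lra; try easy.
  - intros z Hz. now apply hol_ccont, HF.
  - intros z Hz _. now apply HF.
Qed.

Lemma cint_interior_half (F : C -> C) : (forall z, (Cmod z < 1)%R -> hol F z) ->
  cint F (/ 2) = RtoC (2 * PI) * F 0.
Proof. intros HF. apply (cint_interior F 1); [ lra | easy ]. Qed.

Lemma Cmult_cancel_l (k x y : C) : k <> 0 -> k * x = k * y -> x = y.
Proof.
  intros N E. replace x with (/ k * (k * x)) by (field; easy). rewrite E. field. easy.
Qed.

(** The coefficient of [1/z] at infinity, when [q] is holomorphic for [|z| > 1] and
    tends to 0. *)
Definition residue (q : C -> C) : C := cint (fun z => z * q z) 2 / RtoC (2 * PI).

Lemma lim_infty_residue_2 (q : C -> C) : hol_off_circle q -> lim_infty q 0 ->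
  lim_infty (fun z => z * q z) (residue q).
Proof.
  intros Hq Hl. apply (lim_infty_residue q 1 2); try lra; [ | easy ].
  intros z Hz. apply Hq. lra.
Qed.

Lemma bar_0 (f : C -> C) : bar f 0 = Cconj (f 0).
Proof. unfold bar. do 2 f_equal. apply injective_projections; simpl; ring. Qed.

Lemma Cconj_R (x : R) : Cconj (RtoC x) = x.
Proof. apply injective_projections; simpl; ring. Qed.

(** Reflection gives [|p(0)|^2 + |q(0)|^2 = 1]; reflection with [z -> -z] gives
    [- 2 Re (p(0) conj q(0)) = 1]. Subtracting, [|p(0) + q(0)|^2 = 0]. *)
Lemma row_value_0 (g : C) (T : R) (p q : C -> C) : g * Cconj g = / 2 -> rhp_row g T p q ->
  q 0 = - p 0 /\ p 0 * Cconj (p 0) = / 2.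
Proof.
  intros Hg H. assert (Hp := rhp_hol1 _ _ _ _ H). assert (Hq := rhp_hol2 _ _ _ _ H).
  assert (Lp := rhp_lim1 _ _ _ _ H). assert (Lq := rhp_lim2 _ _ _ _ H).
  assert (Hp' := hol_off_circle_bar _ Hp). assert (Hq' := hol_off_circle_bar _ Hq).
  assert (Lp' := lim_infty_bar _ _ Lp). assert (Lq' := lim_infty_bar _ _ Lq).
  rewrite Cconj_R in Lp', Lq'.
  assert (N1 : Cmod (- (1)) = 1%R) by apply Cmod_m1.
  assert (Hpr := hol_off_circle_mul_arg _ _ N1 Hp'). assert (Hqr := hol_off_circle_mul_arg _ _ N1 Hq').
  assert (Lpr := lim_infty_mul_arg _ _ _ N1 Lp'). assert (Lqr := lim_infty_mul_arg _ _ _ N1 Lq').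
  assert (W1 := wedge_bar g T T p q p q 0 Hg H H). simpl in W1.
  assert (S1 : forall r, (0 < r)%R -> 
     cint (fun z => 1 * (p z * bar p z) * Cexp (Ci * (RtoC (T - T) * z ^ 2)) - - (1 * (q z * bar q z)) * Cexp (- (Ci * (RtoC (T - T) * z ^ 2)))) r
     = cint (fun z => p z * bar p z + q z * bar q z) r).
  { intros r Hr. apply cint_ext; [ lra | ]. intros z _.
    replace (Ci * (RtoC (T - T) * z ^ 2)) with (RtoC 0) by (rewrite Rminus_diag; ring).
    replace (- RtoC 0) with (RtoC 0) by ring. rewrite Cexp_0. ring. }
  simpl in S1. rewrite !S1 in W1 by lra.
  rewrite (cint_exterior_2 _ (1 * 1 + 0 * 0)) in W1.
  2: intros z Hz; hol_auto.
  2: now apply lim_infty_plus; apply lim_infty_mult.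
  rewrite cint_interior_half in W1 by (intros z Hz; hol_auto).
  rewrite !bar_0 in W1.
  assert (W2 := wedge_reflection g T p q Hg H).
  rewrite (cint_exterior_2 _ (1 * 1 * 1 + - (0 * 0 * 1))) in W2.
  2:{ intros z Hz. hol_auto. }
  2:{ apply lim_infty_plus.
      - repeat apply lim_infty_mult; try easy. apply lim_infty_Cexp_inv.
      - apply (lim_infty_ext (fun z => - (1) * (q z * bar q (- (1) * z) * Cexp (4 * Ci / z))) _ _ 0);
          [ intros; ring | ].
        replace (- (0 * 0 * 1)) with (- (1) * (0 * 0 * 1)) by ring.
        apply lim_infty_mult; [ apply lim_infty_const | ].
        repeat apply lim_infty_mult; try easy. apply lim_infty_Cexp_inv. }
  rewrite cint_interior_half in W2 by (intros z Hz; hol_auto).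
  replace (- (1) * RtoC 0) with (RtoC 0) in W2 by ring.
  replace (2 * Ci * RtoC T * RtoC 0 ^ 2) with (RtoC 0) in W2 by (simpl; ring).
  replace (- RtoC 0) with (RtoC 0) in W2 by ring. rewrite Cexp_0, !bar_0 in W2.
  assert (NP := two_PI_neq_0).
  apply (Cmult_cancel_l (RtoC (2 * PI))) in W1; [ | easy ].
  apply (Cmult_cancel_l (RtoC (2 * PI))) in W2; [ | easy ].
  assert (Z : (p 0 + q 0) * Cconj (p 0 + q 0) = 0).
  { rewrite Cplus_conj.
    transitivity ((p 0 * Cconj (p 0) + q 0 * Cconj (q 0))
      - (- (p 0 * Cconj (q 0) * 1) - q 0 * Cconj (p 0) * 1)); [ ring | ].
    rewrite <- W1, <- W2. ring. }
  rewrite <- Cmod2_conj in Z. apply RtoC_inj in Z.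
  assert (Z' : Cmod (p 0 + q 0) = 0%R).
  { pose proof (Cmod_ge_0 (p 0 + q 0)). nra. }
  apply Cmod_eq_0 in Z'.
  assert (Q : q 0 = - p 0) by (replace (q 0) with ((p 0 + q 0) - p 0) by ring; rewrite Z'; ring).
  split; [ easy | ].
  rewrite Q, Copp_conj in W1.
  replace (p 0 * Cconj (p 0)) with (/ 2 * (p 0 * Cconj (p 0) + - p 0 * - Cconj (p 0)))
    by (field; intros E; apply RtoC_inj in E; lra).
  rewrite <- W1. ring.
Qed.

(** The weight [z^2] makes the inner mean vanish, so the two integrals are opposite; the one with
    [q] follows from [z q z -> beta]. *)
Lemma cint_row_second_moment (g : C) (T : R) (p q : C -> C) : g * Cconj g = / 2 -> rhp_row g T p q ->
  cint (fun z => z ^ 2 * (q z * bar q z)) 2 = RtoC (2 * PI) * (residue q * Cconj (residue q)) /\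
  cint (fun z => z ^ 2 * (p z * bar p z)) 2 = - (RtoC (2 * PI) * (residue q * Cconj (residue q))).
Proof.
  intros Hg H. assert (Hp := rhp_hol1 _ _ _ _ H). assert (Hq := rhp_hol2 _ _ _ _ H).
  assert (Lq := rhp_lim2 _ _ _ _ H).
  assert (Hp' := hol_off_circle_bar _ Hp). assert (Hq' := hol_off_circle_bar _ Hq).
  assert (Lr := lim_infty_residue_2 q Hq Lq). assert (Lr' := lim_infty_bar _ _ Lr).
  assert (E1 : cint (fun z => z ^ 2 * (q z * bar q z)) 2 = RtoC (2 * PI) * (residue q * Cconj (residue q))).
  { apply cint_exterior_2; [ intros z Hz; hol_auto | ].
    apply (lim_infty_ext (fun z => (z * q z) * bar (fun z => z * q z) z) _ _ 0).
    - intros z _. unfold bar. rewrite Cmult_conj, Cconj_conj. ring.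
    - now apply lim_infty_mult. }
  split; [ easy | ].
  assert (W := wedge_bar g T T p q p q 2 Hg H H). cbv zeta in W.
  assert (S1 : forall r, (0 < r)%R -> 
     cint (fun z => z ^ 2 * (p z * bar p z) * Cexp (Ci * (RtoC (T - T) * z ^ 2)) - - (z ^ 2 * (q z * bar q z)) * Cexp (- (Ci * (RtoC (T - T) * z ^ 2)))) r
     = cint (fun z => z ^ 2 * (p z * bar p z) + z ^ 2 * (q z * bar q z)) r).
  { intros r Hr. apply cint_ext; [ lra | ]. intros z _.
    replace (Ci * (RtoC (T - T) * z ^ 2)) with (RtoC 0) by (rewrite Rminus_diag; ring).
    replace (- RtoC 0) with (RtoC 0) by ring. rewrite Cexp_0. ring. }
  rewrite !S1 in W by lra.
  rewrite cint_plus in W by (lra || (intros z Hz; apply hol_ccont; hol_auto)).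
  rewrite cint_interior_half in W by (intros z Hz; hol_auto).
  rewrite E1 in W.
  replace (cint (fun z => z ^ 2 * (p z * bar p z)) 2)
    with (cint (fun z => z ^ 2 * (p z * bar p z)) 2 + RtoC (2 * PI) * (residue q * Cconj (residue q))
          - RtoC (2 * PI) * (residue q * Cconj (residue q))) by ring.
  rewrite W. simpl. ring.
Qed.

(** The uniformity in [z] turns this into [unif_lim] on any circle other than the unit circle. *)
Definition cont_param (f : R -> C -> C) : Prop := forall T eps : R, (0 < eps)%R ->
  exists d : R, (0 < d)%R /\ forall T' : R, (Rabs (T' - T) < d)%R ->
    forall z, Cmod z <> 1%R -> (Cmod (f T' z - f T z) <= eps)%R.

Lemma cont_param_unif_lim (f : R -> C -> C) (T r : R) : (0 <= r)%R -> r <> 1%R -> cont_param f ->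
  unif_lim r (fun h => f (T + h)%R) (f T).
Proof.
  intros Hr N H eps He. destruct (H T eps He) as [d [P B]]. exists d. split; [ easy | ].
  intros h Hh phi _. apply B; [ | now rewrite Cmod_circ ].
  replace (T + h - T)%R with h by ring. easy.
Qed.

Lemma RtoC_neq_0 (h : R) : h <> 0%R -> RtoC h <> 0.
Proof. intros N E. apply N, RtoC_inj, E. Qed.

(** The row at [T + h] is paired with the reflected row at [T]. Up to the factor [2 PI] the inner
    mean is [2 p_{T+h}(0) conj x], because [q(0) = - p(0)] at both values, and the outer one is
    [1 + 2 i h |beta|^2 + o(h)] by the second moments. As [1 = 2 x conj x], the quotient gives
    [2 conj x x' = 2 i |beta|^2], and [1 / conj x = 2 x]. *)
Lemma p0_derivative (g : C) (p q : R -> C -> C) (T : R) : g * Cconj g = / 2 ->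
  (forall T, rhp_row g T (p T) (q T)) -> cont_param p -> cont_param q ->
  cder (fun T => p T 0) T (2 * Ci * (residue (q T) * Cconj (residue (q T))) * p T 0).
Proof.
  intros Hg H Cp Cq.
  assert (Hp := fun T => rhp_hol1 _ _ _ _ (H T)). assert (Hq := fun T => rhp_hol2 _ _ _ _ (H T)).
  assert (Lp := fun T => rhp_lim1 _ _ _ _ (H T)). assert (Lq := fun T => rhp_lim2 _ _ _ _ (H T)).
  assert (Hpb := hol_off_circle_bar _ (Hp T)). assert (Hqb := hol_off_circle_bar _ (Hq T)).
  assert (HpT := Hp T). assert (HqT := Hq T).
  assert (Lpb := lim_infty_bar _ _ (Lp T)). assert (Lqb := lim_infty_bar _ _ (Lq T)).
  rewrite Cconj_R in Lpb, Lqb.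
  destruct (row_value_0 _ _ _ _ Hg (H T)) as [V1 V2].
  destruct (cint_row_second_moment _ _ _ _ Hg (H T)) as [M1 M2].
  assert (NP := two_PI_neq_0).
  set (b := residue (q T)) in *. set (x := p T 0) in *.
  assert (L := lim_at_0_cint_exp 2 (fun h z => p (T + h)%R z * bar (p T) z) (fun h z => - (q (T + h)%R z * bar (q T) z))
    (fun h z => Ci * (RtoC (T - (T + h)) * z ^ 2)) (fun z => p T z * bar (p T) z) (fun z => - (q T z * bar (q T) z))
    (fun z => - Ci * z ^ 2)).
  assert (L' : lim_at_0 (fun h => (cint (fun z => p (T + h)%R z * bar (p T) z * Cexp (Ci * (RtoC (T - (T + h)) * z ^ 2))
        - - (q (T + h)%R z * bar (q T) z) * Cexp (- (Ci * (RtoC (T - (T + h)) * z ^ 2)))) 2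
      - (cint (fun z => p (T + h)%R z * bar (p T) z) 2 - cint (fun z => - (q (T + h)%R z * bar (q T) z)) 2)) / RtoC h)
     (cint (fun z => (p T z * bar (p T) z + - (q T z * bar (q T) z)) * (- Ci * z ^ 2)) 2)).
  { apply L; clear L; try lra.
    - intros h _ z Hz. assert (Hh := Hp (T + h)%R). apply hol_ccont. hol_auto.
    - intros h _ z Hz. assert (Hh := Hq (T + h)%R). apply hol_ccont. hol_auto.
    - intros h z _ Hz. hol_auto.
    - intros z Hz. apply hol_ccont. hol_auto.
    - intros z Hz. apply hol_ccont. hol_auto.
    - intros z Hz. apply hol_ccont. hol_auto.
    - apply unif_lim_mult; try lra.
      + intros z Hz. apply hol_ccont. hol_auto.
      + intros z Hz. apply hol_ccont. hol_auto.
      + apply cont_param_unif_lim; try lra; easy.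
      + apply unif_lim_const.
    - apply (unif_lim_ext 2 (fun h z => q (T + h)%R z * (- (1) * bar (q T) z))); [ lra | intros; ring | ].
      replace (fun z => - (q T z * bar (q T) z)) with (fun z => q T z * (- (1) * bar (q T) z))
        by (apply functional_extensionality; intros; ring).
      apply unif_lim_mult; try lra.
      + intros z Hz. apply hol_ccont. hol_auto.
      + intros z Hz. apply hol_ccont. hol_auto.
      + apply cont_param_unif_lim; try lra; easy.
      + apply unif_lim_const.
    - apply (unif_lim_ext 2 (fun _ z => - Ci * z ^ 2)); [ lra | | apply unif_lim_const ].
      intros h z N _. replace (T - (T + h))%R with (- h)%R by ring. rewrite RtoC_opp. field. now apply RtoC_neq_0. }
  clear L.
  rewrite (cint_ext _ (fun z => - Ci * (z ^ 2 * (p T z * bar (p T) z)) + Ci * (z ^ 2 * (q T z * bar (q T) z)))) in L'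
    by (lra || (intros; ring)).
  rewrite cint_plus, !cint_scal, M1, M2 in L' by (lra || (intros z Hz; apply hol_ccont; hol_auto)).
  apply lim_at_0_cder.
  (* Inverts the factor with which the increment of [x] enters the inner mean. *)
  apply (lim_at_0_scal (/ (RtoC (2 * PI) * 2 * Cconj x))) in L'.
  assert (N2 : RtoC 2 <> 0) by (apply RtoC_neq_0; lra).
  assert (Nx : Cconj x <> 0).
  { intros E. rewrite E, Cmult_0_r in V2. apply (RtoC_neq_0 1); [ lra | ].
    transitivity (2 * / 2); [ field; easy | rewrite <- V2; ring ]. }
  replace (2 * Ci * (b * Cconj b) * x) with
    (/ (RtoC (2 * PI) * 2 * Cconj x) * (- Ci * - (RtoC (2 * PI) * (b * Cconj b)) + Ci * (RtoC (2 * PI) * (b * Cconj b)))).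
  2:{ transitivity (2 * (/ 2) * (Ci * (b * Cconj b)) / Cconj x); [ field; auto | ].
      rewrite <- V2. field. auto. }
  revert L'. apply lim_at_0_ext. intros h N.
  assert (W := wedge_bar g (T + h) T _ _ _ _ 0 Hg (H (T + h)%R) (H T)). simpl pow in W. cbv zeta in W.
  assert (Hph := Hp (T + h)%R). assert (Hqh := Hq (T + h)%R).
  rewrite (cint_ext _ (fun z => p (T + h)%R z * bar (p T) z * Cexp (Ci * (RtoC (T - (T + h)) * z ^ 2))
        - - (q (T + h)%R z * bar (q T) z) * Cexp (- (Ci * (RtoC (T - (T + h)) * z ^ 2)))) 2) in W
    by (lra || (intros; simpl; ring)).
  rewrite W.
  rewrite cint_interior_half by (intros z Hz; hol_auto).
  rewrite (cint_exterior_2 _ (1 * 1)) by ((intros z Hz; hol_auto) || now apply lim_infty_mult).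
  rewrite (cint_exterior_2 _ (- (1) * (0 * 0))).
  2: intros z Hz; hol_auto.
  2:{ apply (lim_infty_ext (fun z => - (1) * (q (T + h)%R z * bar (q T) z)) _ _ 0); [ intros; ring | ].
      apply lim_infty_mult; [ apply lim_infty_const | now apply lim_infty_mult ]. }
  destruct (row_value_0 _ _ _ _ Hg (H (T + h)%R)) as [Vh1 _].
  rewrite !bar_0, Vh1, V1, Copp_conj. fold x. set (xh := p (T + h)%R 0).
  replace (Ci * (RtoC (T - (T + h)) * RtoC 0 ^ 2)) with (RtoC 0) by (simpl; ring).
  replace (- RtoC 0) with (RtoC 0) by ring. rewrite Cexp_0.
  assert (Nh := RtoC_neq_0 h N).
  simpl (RtoC 0 ^ 0).
  transitivity ((xh * Cconj x - / 2) / (RtoC h * Cconj x)).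
  { field. auto. }
  rewrite <- V2. field. auto.
Qed.

(** The unknown common to the [T]-derivative of [beta] and the rotation identity; [psi_system]
    eliminates it. *)
Definition third_moment (p q : C -> C) : C := cint (fun z => z ^ 3 * (p z * q z)) 2.

(** The weight [z] makes the inner mean vanish. Outside, the integrals without exponentials give
    [2 PI (beta(T + h) - beta(T))], and to first order the exponentials add [2 i h] times the third
    moment. *)
Lemma residue_derivative (g : C) (p q : R -> C -> C) (T : R) : g * Cconj g = / 2 ->
  (forall T, rhp_row g T (p T) (q T)) -> cont_param p -> cont_param q ->
  cder (fun T => residue (q T)) T (- (2 * Ci) * third_moment (p T) (q T) / RtoC (2 * PI)).
Proof.
  intros Hg H Cp Cq.
  assert (Hp := fun T => rhp_hol1 _ _ _ _ (H T)). assert (Hq := fun T => rhp_hol2 _ _ _ _ (H T)).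
  assert (Lp := fun T => rhp_lim1 _ _ _ _ (H T)). assert (Lq := fun T => rhp_lim2 _ _ _ _ (H T)).
  assert (HpT := Hp T). assert (HqT := Hq T).
  assert (NP := two_PI_neq_0).
  assert (Lr := fun T => lim_infty_residue_2 (q T) (Hq T) (Lq T)).
  assert (L : lim_at_0 (fun h => (cint (fun z => z ^ 1 * (p T z * q (T + h)%R z) * Cexp (Ci * (RtoC (T + h - T) * z ^ 2))
        - z ^ 1 * (q T z * p (T + h)%R z) * Cexp (- (Ci * (RtoC (T + h - T) * z ^ 2)))) 2
      - (cint (fun z => z ^ 1 * (p T z * q (T + h)%R z)) 2 - cint (fun z => z ^ 1 * (q T z * p (T + h)%R z)) 2)) / RtoC h)
     (cint (fun z => (z ^ 1 * (p T z * q T z) + z ^ 1 * (q T z * p T z)) * (Ci * z ^ 2)) 2)).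
  { apply (lim_at_0_cint_exp 2 (fun h z => z ^ 1 * (p T z * q (T + h)%R z)) (fun h z => z ^ 1 * (q T z * p (T + h)%R z))
      (fun h z => Ci * (RtoC (T + h - T) * z ^ 2)) (fun z => z ^ 1 * (p T z * q T z)) (fun z => z ^ 1 * (q T z * p T z))
      (fun z => Ci * z ^ 2)); try lra.
    - intros h _ z Hz. assert (Hh := Hq (T + h)%R). apply hol_ccont. hol_auto.
    - intros h _ z Hz. assert (Hh := Hp (T + h)%R). apply hol_ccont. hol_auto.
    - intros h z _ Hz. hol_auto.
    - intros z Hz. apply hol_ccont. hol_auto.
    - intros z Hz. apply hol_ccont. hol_auto.
    - intros z Hz. apply hol_ccont. hol_auto.
    - apply (unif_lim_mult 2 (fun _ z => z ^ 1) _ (fun z => z ^ 1)); try lra; [ | | apply unif_lim_const | ].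
      + intros z Hz. apply hol_ccont. hol_auto.
      + intros z Hz. apply hol_ccont. hol_auto.
      + apply (unif_lim_mult 2 (fun _ z => p T z) _ (fun z => p T z)); try lra; [ | | apply unif_lim_const | ].
        * intros z Hz. apply hol_ccont. hol_auto.
        * intros z Hz. apply hol_ccont. hol_auto.
        * apply cont_param_unif_lim; try lra; easy.
    - apply (unif_lim_mult 2 (fun _ z => z ^ 1) _ (fun z => z ^ 1)); try lra; [ | | apply unif_lim_const | ].
      + intros z Hz. apply hol_ccont. hol_auto.
      + intros z Hz. apply hol_ccont. hol_auto.
      + apply (unif_lim_mult 2 (fun _ z => q T z) _ (fun z => q T z)); try lra; [ | | apply unif_lim_const | ].
        * intros z Hz. apply hol_ccont. hol_auto.
        * intros z Hz. apply hol_ccont. hol_auto.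
        * apply cont_param_unif_lim; try lra; easy.
    - apply (unif_lim_ext 2 (fun _ z => Ci * z ^ 2)); [ lra | | apply unif_lim_const ].
      intros h z N _. replace (T + h - T)%R with h by ring. field. now apply RtoC_neq_0. }
  rewrite (cint_ext _ (fun z => (2 * Ci) * (z ^ 3 * (p T z * q T z)))) in L by (lra || (intros; simpl; ring)).
  rewrite cint_scal in L by (lra || (intros z Hz; apply hol_ccont; hol_auto)).
  fold (third_moment (p T) (q T)) in L.
  apply lim_at_0_cder. apply (lim_at_0_scal (- (1) / RtoC (2 * PI))) in L.
  replace (- (2 * Ci) * third_moment (p T) (q T) / RtoC (2 * PI))
    with (- (1) / RtoC (2 * PI) * (2 * Ci * third_moment (p T) (q T))) by (field; easy).
  revert L. apply lim_at_0_ext. intros h N. assert (Nh := RtoC_neq_0 h N).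
  assert (Hph := Hp (T + h)%R). assert (Hqh := Hq (T + h)%R).
  assert (W := wedge_shift g T (T + h) _ _ _ _ 1 Hg (H T) (H (T + h)%R)). cbv zeta in W.
  rewrite W. rewrite cint_interior_half by (intros z Hz; hol_auto).
  rewrite (cint_exterior_2 (fun z => z ^ 1 * (p T z * q (T + h)%R z)) (1 * residue (q (T + h)%R))).
  2: intros z Hz; hol_auto.
  2:{ apply (lim_infty_ext (fun z => p T z * (z * q (T + h)%R z)) _ _ 0); [ intros; simpl; ring | ].
      now apply lim_infty_mult. }
  rewrite (cint_exterior_2 (fun z => z ^ 1 * (q T z * p (T + h)%R z)) (residue (q T) * 1)).
  2: intros z Hz; hol_auto.
  2:{ apply (lim_infty_ext (fun z => (z * q T z) * p (T + h)%R z) _ _ 0); [ intros; simpl; ring | ].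
      now apply lim_infty_mult. }
  simpl (RtoC 0 ^ 1). field. auto.
Qed.

Lemma circ_1_0 : circ 1 0 = 1.
Proof. unfold circ. rewrite cos_0, sin_0. apply injective_projections; simpl; ring. Qed.

Lemma lim_at_0_circ (k : R) : lim_at_0 (fun h => (circ 1 (k * h) - 1) / RtoC h) (RtoC k * Ci).
Proof.
  assert (D : cder (fun h => circ 1 (k * h)) 0 (RtoC k * Ci)).
  { split; unfold circ; simpl; auto_derive; trivial; rewrite Rmult_0_r, ?cos_0, ?sin_0; ring. }
  apply lim_at_0_cder in D. revert D. apply lim_at_0_ext. intros h _.
  rewrite Rplus_0_l, Rmult_0_r, circ_1_0. easy.
Qed.

(** First order in the angle [h], with weight [z]. Outside, [q (e^{ih} z)] has the residue
    [e^{-ih} beta], whence the term [- i beta]. The exponentials contribute the integral of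
    [2 z p q G], which reduces to the third moment on radius 2 and to [p(0) q(0)] on radius 1/2. *)
Lemma rotation_identity (g : C) (T : R) (p q : C -> C) : g * Cconj g = / 2 -> rhp_row g T p q ->
  - Ci * (RtoC (2 * PI) * residue q) - 4 * RtoC T * third_moment p q
  = 4 * (RtoC (2 * PI) * (p 0 * q 0)).
Proof.
  intros Hg H. assert (Hp := rhp_hol1 _ _ _ _ H). assert (Hq := rhp_hol2 _ _ _ _ H).
  assert (Lp := rhp_lim1 _ _ _ _ H). assert (Lq := rhp_lim2 _ _ _ _ H).
  assert (NP := two_PI_neq_0).
  assert (Lr := lim_infty_residue_2 q Hq Lq).
  assert (Cc : forall h, Cmod (circ 1 h) = 1%R) by (intros h; apply Cmod_circ; lra).
  assert (Hpc := fun h => hol_off_circle_mul_arg p (circ 1 h) (Cc h) Hp).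
  assert (Hqc := fun h => hol_off_circle_mul_arg q (circ 1 h) (Cc h) Hq).
  set (eta := fun h z => Ci * (theta T (circ 1 h * z) - theta T z)).
  (* The derivative of [eta h z] in [h] at [h = 0]. *)
  set (G := fun z => - (2 * RtoC T) * z ^ 2 + 2 / z).
  assert (NZ : forall (r : R) (z : C), (0 < r)%R -> Cmod z = r -> z <> 0) by (intros r z Hr Hz; apply Cmod_gt_0; lra).
  assert (Inv : forall h, circ 1 (- 1 * h) * circ 1 h = 1).
  { intros h. rewrite circ_mult. replace (h + -1 * h)%R with 0%R by ring. apply circ_1_0. }
  assert (Nc : forall h, circ 1 h <> 0) by (intros h; apply Cmod_gt_0; rewrite Cc; lra).
  assert (Ic : forall h, / circ 1 h = circ 1 (- 1 * h)).
  { intros h. apply (Cmult_cancel_l (circ 1 h)); [ apply Nc | ].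
    transitivity (RtoC 1); [ field; apply Nc | rewrite <- (Inv h); ring ]. }
  (* The dependence on [h] sits in two scalar factors, whose quotients converge by [lim_at_0_circ]
     with speeds 2 and -1. *)
  assert (Eeta : forall (h : R) (z : C), z <> 0 -> eta h z =
     Ci * RtoC T * z ^ 2 * (circ 1 (2 * h) - 1) + 2 * Ci * / z * (circ 1 (- 1 * h) - 1)).
  { intros h z N. unfold eta, theta.
    replace (circ 1 (2 * h)) with (circ 1 h * circ 1 h) by (rewrite circ_mult; f_equal; ring).
    rewrite <- Ic. field. auto. }
  (* The limit is taken on both circles, because [eta] has a pole at 0 and the inner mean is no
     value at the origin before [h] tends to 0. *)
  assert (L : forall r, (0 < r)%R -> r <> 1%R ->
    lim_at_0 (fun h => (cint (fun z => z ^ 1 * (p z * q (circ 1 h * z)) * Cexp (eta h z)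
        - z ^ 1 * (q z * p (circ 1 h * z)) * Cexp (- eta h z)) r
      - (cint (fun z => z ^ 1 * (p z * q (circ 1 h * z))) r - cint (fun z => z ^ 1 * (q z * p (circ 1 h * z))) r)) / RtoC h)
     (cint (fun z => (z ^ 1 * (p z * q z) + z ^ 1 * (q z * p z)) * G z) r)).
  { intros r Hr Nr.
    assert (CG : ccont_circle G r) by (intros z Hz; apply hol_ccont; unfold G; hol_auto).
    apply (lim_at_0_cint_exp r (fun h z => z ^ 1 * (p z * q (circ 1 h * z))) (fun h z => z ^ 1 * (q z * p (circ 1 h * z)))
      eta (fun z => z ^ 1 * (p z * q z)) (fun z => z ^ 1 * (q z * p z)) G); try easy.
    - intros h _ z Hz. assert (Hh := Hqc h). apply hol_ccont. hol_auto.
    - intros h _ z Hz. assert (Hh := Hpc h). apply hol_ccont. hol_auto.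
    - intros h z _ Hz. assert (N := NZ r z Hr Hz).
      apply (hol_mult (fun _ => Ci) (fun z => theta T (circ 1 h * z) - theta T z)); [ apply hol_const | ].
      apply hol_minus; [ | now apply hol_theta ].
      apply (hol_mul_arg (theta T)), hol_theta. apply Cmod_gt_0. rewrite Cmod_mult, Cc. lra.
    - intros z Hz. apply hol_ccont. hol_auto.
    - intros z Hz. apply hol_ccont. hol_auto.
    - apply (unif_lim_mult r (fun _ z => z ^ 1) _ (fun z => z ^ 1)); try lra; [ | | apply unif_lim_const | ].
      + intros z Hz. apply hol_ccont. hol_auto.
      + intros z Hz. apply hol_ccont. hol_auto.
      + apply (unif_lim_mult r (fun _ z => p z) _ (fun z => p z)); try lra; [ | | apply unif_lim_const | ].
        * intros z Hz. apply hol_ccont. hol_auto.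
        * intros z Hz. apply hol_ccont. hol_auto.
        * apply unif_lim_rotation; [ lra | ]. intros z Hz. apply hol_ccont. hol_auto.
    - apply (unif_lim_mult r (fun _ z => z ^ 1) _ (fun z => z ^ 1)); try lra; [ | | apply unif_lim_const | ].
      + intros z Hz. apply hol_ccont. hol_auto.
      + intros z Hz. apply hol_ccont. hol_auto.
      + apply (unif_lim_mult r (fun _ z => q z) _ (fun z => q z)); try lra; [ | | apply unif_lim_const | ].
        * intros z Hz. apply hol_ccont. hol_auto.
        * intros z Hz. apply hol_ccont. hol_auto.
        * apply unif_lim_rotation; [ lra | ]. intros z Hz. apply hol_ccont. hol_auto.
    - apply (unif_lim_ext r (fun h z => Ci * RtoC T * z ^ 2 * ((circ 1 (2 * h) - 1) / RtoC h)
                                   + 2 * Ci * / z * ((circ 1 (- 1 * h) - 1) / RtoC h))); [ lra | | ].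
      { intros h z N Hz. rewrite (Eeta h z (NZ r z Hr Hz)). field. split; [ now apply (NZ r) | now apply RtoC_neq_0 ]. }
      assert (EG : G = fun z => Ci * RtoC T * z ^ 2 * (RtoC 2 * Ci) + 2 * Ci * / z * (RtoC (- 1) * Ci)).
      { apply functional_extensionality. intros z. unfold G, Cdiv.
        replace (RtoC (- 1)) with (- RtoC 1) by (now rewrite <- RtoC_opp).
        assert (CC : Ci * Ci = - (1)) by (apply injective_projections; simpl; ring).
        transitivity (2 * RtoC T * z ^ 2 * (Ci * Ci) - 2 * (Ci * Ci) * / z); [ rewrite CC; ring | ring ]. }
      rewrite EG. apply unif_lim_plus; apply unif_lim_mult; try lra.
      + intros z Hz. apply hol_ccont. hol_auto.
      + intros z Hz. apply hol_ccont. hol_auto.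
      + apply unif_lim_const.
      + apply unif_lim_param, lim_at_0_circ.
      + intros z Hz. apply hol_ccont. hol_auto.
      + intros z Hz. apply hol_ccont. hol_auto.
      + apply unif_lim_const.
      + apply unif_lim_param, lim_at_0_circ. }
  assert (L2 := L 2%R ltac:(lra) ltac:(lra)). assert (L3 := L (/ 2)%R ltac:(lra) ltac:(lra)). clear L.
  assert (EL : forall r, (0 < r)%R -> r <> 1%R ->
     cint (fun z => (z ^ 1 * (p z * q z) + z ^ 1 * (q z * p z)) * G z) r
     = - (4 * RtoC T) * cint (fun z => z ^ 3 * (p z * q z)) r + 4 * cint (fun z => p z * q z) r).
  { intros r Hr Nr.
    rewrite <- !cint_scal, <- cint_plus; try lra; try (intros z Hz; apply hol_ccont; hol_auto).
    apply cint_ext; [ lra | ]. intros z Hz. unfold G. simpl. field. now apply (NZ r). }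
  rewrite EL in L2, L3 by lra. fold (third_moment p q) in L2.
  rewrite (cint_exterior_2 (fun z => p z * q z) (1 * 0)) in L2
    by ((intros z Hz; hol_auto) || now apply lim_infty_mult).
  rewrite !cint_interior_half in L3 by (intros z Hz; hol_auto).
  assert (LA : lim_at_0 (fun h => (cint (fun z => z ^ 1 * (p z * q (circ 1 h * z))) 2 - cint (fun z => z ^ 1 * (q z * p (circ 1 h * z))) 2) / RtoC h)
     (RtoC (2 * PI) * residue q * (RtoC (- 1) * Ci))).
  { apply (lim_at_0_ext (fun h => RtoC (2 * PI) * residue q * ((circ 1 (- 1 * h) - 1) / RtoC h))).
    2: apply lim_at_0_scal, lim_at_0_circ.
    intros h N. assert (Nh := RtoC_neq_0 h N). assert (Hh := Hqc h). assert (Hh' := Hpc h).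
    rewrite (cint_exterior_2 (fun z => z ^ 1 * (p z * q (circ 1 h * z))) (1 * circ 1 (- 1 * h) * residue q)).
    2: intros z Hz; hol_auto.
    2:{ apply (lim_infty_ext (fun z => p z * circ 1 (- 1 * h) * ((fun z => z * q z) (circ 1 h * z))) _ _ 0).
        - intros z _. transitivity ((circ 1 (- 1 * h) * circ 1 h) * (z * (p z * q (circ 1 h * z)))); [ ring | ].
          rewrite Inv. simpl. ring.
        - apply lim_infty_mult; [ apply lim_infty_mult; [ easy | apply lim_infty_const ] | ].
          apply (lim_infty_mul_arg (fun z => z * q z)); [ apply Cc | easy ]. }
    rewrite (cint_exterior_2 (fun z => z ^ 1 * (q z * p (circ 1 h * z))) (residue q * 1)).
    2: intros z Hz; hol_auto.
    2:{ apply (lim_infty_ext (fun z => (z * q z) * p (circ 1 h * z)) _ _ 0); [ intros; simpl; ring | ].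
        apply lim_infty_mult; [ easy | apply lim_infty_mul_arg; [ apply Cc | easy ] ]. }
    field. easy. }
  assert (LT := lim_at_0_plus _ _ _ _ L2 LA).
  assert (E : RtoC (2 * PI) * residue q * (RtoC (- 1) * Ci) + (- (4 * RtoC T) * third_moment p q + 4 * (RtoC (2 * PI) * (1 * 0)))
     = - (4 * RtoC T) * (RtoC (2 * PI) * (RtoC 0 ^ 3 * (p 0 * q 0))) + 4 * (RtoC (2 * PI) * (p 0 * q 0))).
  { rewrite Cplus_comm. apply (lim_at_0_unique _ _ _ LT). revert L3. apply lim_at_0_ext. intros h N.
    assert (Nh := RtoC_neq_0 h N). assert (Hh := Hqc h). assert (Hh' := Hpc h).
    assert (W := wedge_rotation g T p q 1 (circ 1 h) Hg (Cc h) H). cbv zeta in W.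
    fold (eta h) in W.
    change (fun z => z ^ 1 * (p z * q (circ 1 h * z)) * Cexp (Ci * (theta T (circ 1 h * z) - theta T z))
        - z ^ 1 * (q z * p (circ 1 h * z)) * Cexp (- (Ci * (theta T (circ 1 h * z) - theta T z))))
      with (fun z => z ^ 1 * (p z * q (circ 1 h * z)) * Cexp (eta h z)
        - z ^ 1 * (q z * p (circ 1 h * z)) * Cexp (- eta h z)) in W.
    rewrite W.
    rewrite (cint_interior_half (fun z => z ^ 1 * (p z * q (circ 1 h * z)))) by (intros z Hz; hol_auto).
    rewrite (cint_interior_half (fun z => z ^ 1 * (q z * p (circ 1 h * z)))) by (intros z Hz; hol_auto).
    simpl (RtoC 0 ^ 1). field. easy. }
  replace (RtoC (- 1)) with (- RtoC 1) in E by (now rewrite <- RtoC_opp).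
  transitivity (RtoC (2 * PI) * residue q * (- (1) * Ci) + (- (4 * RtoC T) * third_moment p q + 4 * (RtoC (2 * PI) * (1 * 0)))); [ ring | ].
  rewrite E. simpl. ring.
Qed.

(** * Continuity in [T], and [Psi] as a residue *)

Lemma is_series_C_unique (c : nat -> C) (l m : C) :
  @is_series C_AbsRing C_NormedModule c l -> @is_series C_AbsRing C_NormedModule c m -> l = m.
Proof. intros H1 H2. exact (filterlim_locally_unique (K := C_AbsRing) (V := C_NormedModule) _ l m H1 H2). Qed.

Lemma is_series_C_head (c : nat -> C) : (forall n, c (S n) = 0) ->
  @is_series C_AbsRing C_NormedModule c (c 0%nat).
Proof.
  intros H. eapply filterlim_ext; [ | apply filterlim_const ].
  intros n. induction n as [|n IH]; [ now rewrite sum_O | ].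
  rewrite sum_Sn, <- IH, H. symmetry. apply (plus_zero_r (G := C_AbelianMonoid)).
Qed.

(** At [X = X0 = 0] the double series reduces to a series in [T - T0]. Its terms are at most
    [|M| y^n] with [y = |T - T0| / r <= 1/2], uniformly in [z], so it differs from its value at [T0]
    by at most [2 |M| y]. *)
Lemma real_analytic_cont_param (P : R -> R -> C -> M2) (j : nat) : (j < 2)%nat ->
  real_analytic_dependence P -> cont_param (fun T z => entry (P 0%R T z) 0 j).
Proof.
  intros Hj H T0 eps He. destruct (H 0%nat j ltac:(lia) Hj 0%R T0) as [r [M [c Hc]]].
  assert (Pr := cond_pos r).
  set (K := (2 * Rabs M / r + 1)%R).
  assert (PK0 : (0 <= 2 * Rabs M / r)%R) by (apply Rdiv_le_0_compat; [ generalize (Rabs_pos M); lra | easy ]).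
  exists (Rmin (r / 2) (eps / K)). split; [ apply Rmin_pos; [ lra | apply Rdiv_lt_0_compat; unfold K; lra ] | ].
  intros T HT z Hz.
  assert (HT1 := Rlt_le_trans _ _ _ HT (Rmin_l _ _)). assert (HT2 := Rlt_le_trans _ _ _ HT (Rmin_r _ _)).
  destruct (Hc z Hz) as [B Sm].
  assert (V : forall T, (Rabs (T - T0) < r)%R ->
    @is_series C_AbsRing C_NormedModule (fun n => c 0%nat n z * RtoC ((T - T0) ^ n)) (entry (P 0%R T z) 0 j)).
  { intros T' HT'. destruct (Sm 0%R T') as [s [S1 S2]]; [ rewrite Rminus_eq_0, Rabs_R0; lra | easy | ].
    (* Only [m = 0] survives, with [0^0 = 1]. *)
    assert (S3 : @is_series C_AbsRing C_NormedModule (fun m => s m * RtoC ((0 - 0) ^ m)) (s 0%nat * RtoC ((0 - 0) ^ 0))).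
    { apply (is_series_C_head (fun m => s m * RtoC ((0 - 0) ^ m))).
      intros n. rewrite Rminus_eq_0. simpl. rewrite Rmult_0_l. ring. }
    rewrite (is_series_C_unique _ _ _ S2 S3). simpl. rewrite Cmult_1_r. apply S1. }
  assert (V0 := V T0 ltac:(rewrite Rminus_eq_0, Rabs_R0; lra)). assert (V1 := V T ltac:(lra)).
  assert (D : @is_series C_AbsRing C_NormedModule
     (fun n => c 0%nat n z * RtoC ((T - T0) ^ n) - c 0%nat n z * RtoC ((T0 - T0) ^ n))
     (entry (P 0%R T z) 0 j - entry (P 0%R T0 z) 0 j)).
  { now apply (is_series_minus (V := C_NormedModule)). }
  set (y := (Rabs (T - T0) / r)%R).
  assert (Py : (0 <= y)%R) by (apply Rdiv_le_0_compat; [ apply Rabs_pos | easy ]).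
  assert (Y2 : (y <= 1 / 2)%R) by (apply Rle_div_l; lra).
  assert (PM := Rabs_pos M).
  (* The term [n = 0] cancels in the difference, and [1 - (1/2)^n] is the partial sum of the
     geometric majorant of the others. *)
  assert (BS : forall n, (Cmod (sum_n (fun n => c 0%nat n z * RtoC ((T - T0) ^ n) - c 0%nat n z * RtoC ((T0 - T0) ^ n))%C n)
                   <= 2 * Rabs M * y * (1 - (1 / 2) ^ n))%R).
  { induction n as [|n IH].
    - rewrite sum_O. simpl. match goal with |- (Cmod ?w <= _)%R => replace w with (RtoC 0) by ring end.
      rewrite Cmod_0. lra.
    - rewrite sum_Sn. eapply Rle_trans; [ apply (Cmod_triangle (sum_n _ n)) | ].
      eapply Rle_trans; [ apply Rplus_le_compat_r, IH | ].
      assert (E : (Cmod (c 0%nat (S n) z * RtoC ((T - T0) ^ S n) - c 0%nat (S n) z * RtoC ((T0 - T0) ^ S n))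
                <= Rabs M * y * (1 / 2) ^ n)%R).
      { replace ((T0 - T0) ^ S n)%R with 0%R by (rewrite Rminus_eq_0; simpl; ring).
        replace (c 0%nat (S n) z * RtoC ((T - T0) ^ S n) - c 0%nat (S n) z * 0)
          with (c 0%nat (S n) z * RtoC ((T - T0) ^ S n)) by ring.
        rewrite Cmod_mult, Cmod_R, <- RPow_abs.
        replace (Rabs (T - T0)) with (y * r)%R by (unfold y; field; lra).
        rewrite Rpow_mult_distr.
        specialize (B 0%nat (S n)). simpl (0 + S n)%nat in B.
        assert (B' : (Cmod (c 0%nat (S n) z) * r ^ S n <= Rabs M)%R)
          by (eapply Rle_trans; [ apply B | apply Rle_abs ]).
        assert (Q : (y ^ n <= (1 / 2) ^ n)%R) by (apply pow_incr; lra).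
        assert (0 <= y ^ n)%R by (apply pow_le; lra).
        replace (Cmod (c 0%nat (S n) z) * (y ^ S n * r ^ S n))%R
          with ((Cmod (c 0%nat (S n) z) * r ^ S n) * (y * y ^ n))%R by (simpl; ring).
        replace (Rabs M * y * (1 / 2) ^ n)%R with (Rabs M * (y * (1 / 2) ^ n))%R by ring.
        apply Rmult_le_compat; try easy.
        - apply Rmult_le_pos; [ apply Cmod_ge_0 | apply pow_le; lra ].
        - now apply Rmult_le_pos.
        - now apply Rmult_le_compat_l. }
      eapply Rle_trans; [ apply Rplus_le_compat_l, E | ]. right. simpl. field. }
  apply (Rle_trans _ (2 * Rabs M * y)%R).
  - apply (is_series_Cmod_le _ _ _ D). intros n. eapply Rle_trans; [ apply BS | ].
    assert (0 <= (1 / 2) ^ n)%R by (apply pow_le; lra).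
    assert (0 <= 2 * Rabs M * y)%R by (apply Rmult_le_pos; lra).
    assert (0 <= 2 * Rabs M * y * (1 / 2) ^ n)%R by (apply Rmult_le_pos; lra). lra.
  - apply Rlt_div_r in HT2; [ | unfold K; lra ].
    replace (2 * Rabs M * y)%R with (Rabs (T - T0) * (2 * Rabs M / r))%R by (unfold y; field; lra).
    pose proof (Rabs_pos (T - T0)). unfold K in HT2. lra.
Qed.

Lemma C_infty_filter : ProperFilter' C_infty.
Proof.
  split.
  - intros [M HM]. apply (HM (RtoC (Rabs M + 1))). rewrite Cmod_R.
    pose proof (Rle_abs M). pose proof (Rabs_pos M). rewrite Rabs_pos_eq; lra.
  - split.
    + exists 0%R. easy.
    + intros S1 S2 [M1 H1] [M2 H2]. exists (Rmax M1 M2). intros z Hz. split.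
      * apply H1. eapply Rle_lt_trans; [ apply Rmax_l | apply Hz ].
      * apply H2. eapply Rle_lt_trans; [ apply Rmax_r | apply Hz ].
    + intros S1 S2 HS [M1 H1]. exists M1. auto.
Qed.

(** [iota] returns a limit that exists and is unique: existence is [lim_infty_residue_2], uniqueness
    comes from the properness of [C_infty]. *)
Lemma Psi_of_residue (g : C) (T : R) (P : C -> M2) :
  rhp_row g T (fun z => entry (P z) 0 0) (fun z => entry (P z) 0 1) ->
  Psi_of P = 2 * Ci * residue (fun z => entry (P z) 0 1).
Proof.
  intros H. unfold Psi_of. f_equal.
  assert (FF := C_infty_filter).
  apply (iota_filterlim_locally (K := R_AbsRing) (V := C_R_CompleteNormedModule) (F := C_infty)).
  apply (lim_infty_filterlim (fun z => z * entry (P z) 0 1)).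
  apply lim_infty_residue_2; [ apply (rhp_hol2 _ _ _ _ H) | apply (rhp_lim2 _ _ _ _ H) ].
Qed.

(** * Real-variable calculus and the differential system in [t] *)

Lemma cder_value (f : R -> C) (t : R) (l m : C) : l = m -> cder f t l -> cder f t m.
Proof. now intros ->. Qed.

Lemma cder_const (c : C) (t : R) : cder (fun _ => c) t 0.
Proof.
  split; [ exact (is_derive_const (V := R_NormedModule) (Re c) t) | exact (is_derive_const (V := R_NormedModule) (Im c) t) ].
Qed.

Lemma cder_id (t : R) : cder (fun s => RtoC s) t 1.
Proof. split; [ exact (is_derive_id (K := R_AbsRing) t) | exact (is_derive_const (V := R_NormedModule) 0%R t) ]. Qed.

Lemma cder_plus (f g : R -> C) (t : R) (l m : C) : cder f t l -> cder g t m ->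
  cder (fun s => f s + g s) t (l + m).
Proof. intros [F1 F2] [G1 G2]. split; [ exact (is_derive_plus (V := R_NormedModule) _ _ _ _ _ F1 G1) | exact (is_derive_plus (V := R_NormedModule) _ _ _ _ _ F2 G2) ]. Qed.

Lemma cder_mult (f g : R -> C) (t : R) (l m : C) : cder f t l -> cder g t m ->
  cder (fun s => f s * g s) t (l * g t + f t * m).
Proof.
  intros [F1 F2] [G1 G2].
  assert (MM : forall (f g : R -> R) (l m : R), is_derive f t l -> is_derive g t m ->
            is_derive (fun s => f s * g s)%R t (l * g t + f t * m)%R).
  { intros f' g' l' m' Hf Hg. apply (is_derive_mult (K := R_AbsRing)); try easy. intros; apply Rmult_comm. }
  split.
  - assert (D := is_derive_minus (V := R_NormedModule) _ _ t _ _ (MM _ _ _ _ F1 G1) (MM _ _ _ _ F2 G2)).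
    replace (Re (l * g t + f t * m)) with (minus (Re l * Re (g t) + Re (f t) * Re m)%R (Im l * Im (g t) + Im (f t) * Im m)%R).
    + exact D.
    + unfold minus, plus, opp, Re, Im; simpl; ring.
  - assert (D := is_derive_plus (V := R_NormedModule) _ _ t _ _ (MM _ _ _ _ F1 G2) (MM _ _ _ _ F2 G1)).
    replace (Im (l * g t + f t * m)) with (plus (Re l * Im (g t) + Re (f t) * Im m)%R (Im l * Re (g t) + Im (f t) * Re m)%R).
    + exact D.
    + unfold plus, Re, Im; simpl; ring.
Qed.

Lemma cder_conj (f : R -> C) (t : R) (l : C) : cder f t l -> cder (fun s => Cconj (f s)) t (Cconj l).
Proof. intros [F1 F2]. split; [ exact F1 | exact (is_derive_opp (V := R_NormedModule) _ _ _ F2) ]. Qed.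

Lemma cder_square_arg (f : R -> C) (t : R) (l : C) : cder f (t ^ 2) l ->
  cder (fun s => f (s ^ 2)%R) t (2 * RtoC t * l).
Proof.
  intros [F1 F2].
  assert (S : is_derive (fun s : R => s ^ 2)%R t (2 * t)%R) by (auto_derive; [ easy | ring ]).
  split.
  - replace (Re (2 * RtoC t * l)) with (scal (2 * t)%R (Re l)).
    + exact (is_derive_comp (V := R_NormedModule) (fun s => Re (f s)) (fun s => s ^ 2)%R t _ _ F1 S).
    + unfold scal; simpl; unfold mult, Re, Im; simpl; ring.
  - replace (Im (2 * RtoC t * l)) with (scal (2 * t)%R (Im l)).
    + exact (is_derive_comp (V := R_NormedModule) (fun s => Im (f s)) (fun s => s ^ 2)%R t _ _ F2 S).
    + unfold scal; simpl; unfold mult, Re, Im; simpl; ring.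
Qed.

Lemma cder_Cderiv (f : R -> C) (t : R) (l : C) : cder f t l -> Cderiv f t = l.
Proof.
  intros [F1 F2]. apply injective_projections; simpl; now apply is_derive_unique.
Qed.

Lemma cder_Cdifferentiable (f : R -> C) (t : R) (l : C) : cder f t l -> Cdifferentiable f t.
Proof.
  intros H. exists l. split; [ apply (is_linear_scal_l (V := C_R_NormedModule)) | ].
  intros x Hx. apply (is_filter_lim_locally_unique (V := R_NormedModule) t x) in Hx. subst x.
  intros eps. destruct (proj1 (cder_eps _ _ _) H eps (cond_pos eps)) as [d [Pd Bd]].
  exists (mkposreal d Pd). intros y Hy. change (Rabs (y - t) < d)%R in Hy.
  specialize (Bd (y - t)%R Hy). replace (t + (y - t))%R with y in Bd by (symmetry; apply Rplus_minus).
  match goal with |- (norm ?w <= _)%R => replace w with (f y - f t - RtoC (y - t) * l) end.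
  - rewrite Cmod_norm in Bd. exact Bd.
  - apply injective_projections; simpl.
    + transitivity (fst (f y) + - fst (f t) + - ((y + - t) * fst l))%R; [ ring | reflexivity ].
    + transitivity (snd (f y) + - snd (f t) + - ((y + - t) * snd l))%R; [ ring | reflexivity ].
Qed.

(** With [T = t^2] the operator [2 T d/dT] becomes [t d/dt], so [beta + 2 T beta_T] becomes the
    derivative of [t beta]. The witness [dpsi] comes from the third moment and involves no division
    by [t], so the system holds at [t = 0] as well. *)
Lemma psi_system (a : C) (P : R -> R -> C -> M2) : a <> 0 ->
  (forall X T : R, solves_RHP (Gmat a a) X T (P X T)) -> real_analytic_dependence P ->
  exists (x dpsi : R -> C), let psi := fun t : R => Psi_of (P 0%R (t ^ 2)%R) in
  forall t : R,
    cder psi t (dpsi t) /\ psi t + RtoC t * dpsi t = 8 * x t ^ 2 /\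
    cder x t (Ci * RtoC t * (psi t * Cconj (psi t)) * x t) /\ x t * Cconj (x t) = / 2.
Proof.
  intros Ha hP hPan.
  set (g := RtoC (/ sqrt (Cmod a ^ 2 + Cmod a ^ 2)) * a).
  set (p := fun T z => entry (P 0%R T z) 0 0). set (q := fun T z => entry (P 0%R T z) 0 1).
  assert (Hg : g * Cconj g = / 2) by now apply jump_const_norm.
  assert (H : forall T, rhp_row g T (p T) (q T)) by (intros T; apply solves_RHP_rhp_row, hP).
  assert (Cp : cont_param p) by (now apply real_analytic_cont_param; [ lia | ]).
  assert (Cq : cont_param q) by (now apply real_analytic_cont_param; [ lia | ]).
  assert (NP := two_PI_neq_0).
  set (db := fun T => - (2 * Ci) * third_moment (p T) (q T) / RtoC (2 * PI)).
  assert (CC : Ci * Ci = - (1)) by (apply injective_projections; simpl; ring).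
  (* The third moment is eliminated between [rotation_identity] and the definition of [db];
     [q(0) = - p(0)] turns [p(0) q(0)] into [- p(0)^2]. *)
  assert (R0 : forall T, residue (q T) + 2 * RtoC T * db T = - (4 * Ci) * (p T 0 * p T 0)).
  { intros T. assert (E := rotation_identity g T _ _ Hg (H T)).
    destruct (row_value_0 _ _ _ _ Hg (H T)) as [V1 _]. rewrite V1 in E.
    apply (Cmult_cancel_l (- Ci * RtoC (2 * PI))).
    { apply Cmult_neq_0; [ | easy ]. intros E0. apply (RtoC_neq_0 1); [ lra | ].
      transitivity (- Ci * Ci); [ | rewrite E0; ring ].
      transitivity (- (Ci * Ci)); [ rewrite CC; ring | ring ]. }
    transitivity (- Ci * (RtoC (2 * PI) * residue (q T)) + (Ci * Ci) * (4 * RtoC T * third_moment (p T) (q T))).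
    { unfold db. field. easy. }
    rewrite CC.
    transitivity (- Ci * (RtoC (2 * PI) * residue (q T)) - 4 * RtoC T * third_moment (p T) (q T)); [ ring | ].
    rewrite E.
    transitivity ((Ci * Ci) * (4 * (RtoC (2 * PI) * (p T 0 * p T 0)))); [ rewrite CC; ring | ring ]. }
  assert (Epsi : forall t : R, Psi_of (P 0%R (t ^ 2)%R) = 2 * Ci * residue (q (t ^ 2)%R)).
  { intros t. apply (Psi_of_residue g (t ^ 2)). apply H. }
  exists (fun t => p (t ^ 2)%R 0), (fun t => 2 * Ci * (2 * RtoC t * db (t ^ 2)%R)).
  intros psi t. split; [ | split; [ | split ] ].
  - unfold psi. apply (cder_value _ _ (0 * residue (q (t ^ 2)%R) + 2 * Ci * (2 * RtoC t * db (t ^ 2)%R))); [ ring | ].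
    replace (fun t : R => Psi_of (P 0%R (t ^ 2)%R)) with (fun t : R => 2 * Ci * residue (q (t ^ 2)%R))
      by (apply functional_extensionality; intros; now rewrite Epsi).
    apply (cder_mult (fun _ => 2 * Ci)); [ apply cder_const | ].
    apply (cder_square_arg (fun T => residue (q T))), (residue_derivative g p q); easy.
  - unfold psi. rewrite Epsi.
    transitivity (2 * Ci * (residue (q (t ^ 2)%R) + 2 * RtoC (t ^ 2) * db (t ^ 2)%R)).
    { rewrite RtoC_pow. ring. }
    rewrite R0. transitivity (- (Ci * Ci) * 8 * p (t ^ 2)%R 0 ^ 2); [ ring | rewrite CC; ring ].
  - unfold psi. rewrite Epsi.
    apply (cder_value _ _ (2 * RtoC t * (2 * Ci * (residue (q (t ^ 2)%R) * Cconj (residue (q (t ^ 2)%R))) * p (t ^ 2)%R 0))).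
    { rewrite !Cmult_conj, Cconj_R. replace (Cconj Ci) with (- Ci) by (apply injective_projections; simpl; ring).
      set (b := residue _). set (y := p _ _).
      transitivity (Ci * RtoC t * (4 * - (Ci * Ci) * (b * Cconj b)) * y); [ rewrite CC; ring | ring ]. }
    apply (cder_square_arg (fun T => p T 0)), (p0_derivative g); easy.
  - apply (row_value_0 g (t ^ 2) _ _ Hg (H _)).
Qed.

(** * The Painleve equation *)

Theorem theorem1p14 (a : C) (eps : R) (P : R -> R -> C -> M2)
  (ha : a <> RtoC 0)
  (heps : eps = 1%R \/ eps = (-1)%R)
  (hP : forall X T : R, solves_RHP (Gmat a a) X T (P X T))
  (hPan : real_analytic_dependence P) :
  let psi : R -> C := fun t : R => Psi_of (P 0%R (t ^ 2)%R) in
  let u : R -> C := u_of eps psi in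
  (forall t : R, Cdifferentiable (fun s : R => Cconj (psi s)) t) /\
  (forall t : R, Cdifferentiable u t) /\
  (forall t : R, Cdifferentiable (Cderiv u) t) /\
  (exists t : R, u t <> RtoC 0) /\
  (forall t : R, t <> 0%R -> u t <> RtoC 0 ->
     PIII_D7_eq eps (Ci / RtoC 2)%C (RtoC 4 * RtoC eps)%C u t).
Proof.
  intros psi u. destruct (psi_system a P ha hP hPan) as [x [dpsi HS]]. fold psi in HS. cbv zeta in HS.
  assert (Dp := fun t => proj1 (HS t)). assert (Rp := fun t => proj1 (proj2 (HS t))).
  assert (Dx := fun t => proj1 (proj2 (proj2 (HS t)))). assert (Nx := fun t => proj2 (proj2 (proj2 (HS t)))).
  clear HS.
  assert (Dpc := fun t => cder_conj _ _ _ (Dp t)). assert (Dxc := fun t => cder_conj _ _ _ (Dx t)).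
  assert (CC : Ci * Ci = - (1)) by (apply injective_projections; simpl; ring).
  assert (Cc : Cconj Ci = - Ci) by (apply injective_projections; simpl; ring).
  assert (N2 : RtoC 2 <> 0) by (apply RtoC_neq_0; lra).
  assert (N4 : RtoC 4 <> 0) by (apply RtoC_neq_0; lra).
  assert (Ee : RtoC eps * RtoC eps = 1) by (rewrite <- RtoC_mult; f_equal; destruct heps; subst; ring).
  assert (Rpc : forall t, Cconj (psi t) + RtoC t * Cconj (dpsi t) = 8 * Cconj (x t) ^ 2).
  { intros t. rewrite <- (Cconj_R t) at 1. rewrite <- Cmult_conj, <- Cplus_conj, Rp, Cmult_conj, Cpow_conj, Cconj_R. easy. }
  assert (Eu : u = fun t => 2 * Ci * RtoC eps * (RtoC t * psi t * Cconj (x t) ^ 2)).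
  { apply functional_extensionality. intros t. unfold u, u_of.
    rewrite (cder_Cderiv _ _ _ (Dpc t)), Rpc, RtoC_inv. field. easy. }
  assert (Du : forall t, cder u t (4 * Ci * RtoC eps - 2 * Ci * RtoC t * (psi t * Cconj (psi t)) * u t)).
  (* The product [t psi] is kept as one factor, because its derivative [8 x^2] is free of [dpsi]. *)
  { intros t. rewrite Eu. set (d := fun s => RtoC s * psi s).
    assert (Dd : cder d t (8 * x t ^ 2)).
    { apply (cder_value _ _ (1 * psi t + RtoC t * dpsi t)); [ rewrite <- Rp; ring | ].
      apply cder_mult; [ apply cder_id | easy ]. }
    assert (Dxx := cder_mult _ _ _ _ _ (Dxc t) (Dxc t)).
    assert (D := cder_mult _ _ _ _ _ (cder_const (2 * Ci * RtoC eps) t) (cder_mult _ _ _ _ _ Dd Dxx)).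
    replace (fun t => 2 * Ci * RtoC eps * (RtoC t * psi t * Cconj (x t) ^ 2))
      with (fun s => 2 * Ci * RtoC eps * (d s * (Cconj (x s) * Cconj (x s))))
      by (apply functional_extensionality; intros; unfold d; ring).
    revert D. apply cder_value. rewrite !Cmult_conj, Cc, Cconj_R, Cconj_conj. unfold d.
    set (X := x t) in *. set (Y := psi t). set (e := RtoC eps).
    (* The first term is [16 i eps |x|^4], which is the constant [4 i eps]. *)
    transitivity (16 * Ci * e * ((X * Cconj X) * (X * Cconj X))
      - 2 * Ci * RtoC t * (Y * Cconj Y) * (2 * Ci * e * (RtoC t * Y * Cconj X ^ 2))); [ ring | ].
    unfold X at 1 2 3 4. rewrite (Nx t). field. }
  assert (EDu : Cderiv u = fun t => 4 * Ci * RtoC eps - 2 * Ci * RtoC t * (psi t * Cconj (psi t)) * u t).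
  { apply functional_extensionality. intros t. apply cder_Cderiv, Du. }
  assert (DDu : forall t, cder (Cderiv u) t
     (- (2 * Ci) * ((8 * x t ^ 2 * Cconj (psi t) + RtoC t * psi t * Cconj (dpsi t)) * u t
                    + RtoC t * (psi t * Cconj (psi t)) * Cderiv u t))).
  { intros t. rewrite EDu at 1.
    assert (Dd : cder (fun s => RtoC s * psi s) t (8 * x t ^ 2)).
    { apply (cder_value _ _ (1 * psi t + RtoC t * dpsi t)); [ rewrite <- Rp; ring | ].
      apply cder_mult; [ apply cder_id | easy ]. }
    assert (D1 := cder_mult _ _ _ _ _ (cder_mult _ _ _ _ _ Dd (Dpc t)) (Du t)).
    assert (D := cder_plus _ _ _ _ _ (cder_const (4 * Ci * RtoC eps) t)
                   (cder_mult _ _ _ _ _ (cder_const (- (2 * Ci)) t) D1)).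
    replace (fun s => 4 * Ci * RtoC eps - 2 * Ci * RtoC s * (psi s * Cconj (psi s)) * u s)
      with (fun s => 4 * Ci * RtoC eps + - (2 * Ci) * (RtoC s * psi s * Cconj (psi s) * u s))
      by (apply functional_extensionality; intros; ring).
    revert D. apply cder_value. rewrite (cder_Cderiv _ _ _ (Du t)). ring. }
  split; [ | split; [ | split; [ | split ] ] ].
  - intros t. apply (cder_Cdifferentiable _ _ _ (Dpc t)).
  - intros t. apply (cder_Cdifferentiable _ _ _ (Du t)).
  - intros t. apply (cder_Cdifferentiable _ _ _ (DDu t)).
  (* If [u] vanished identically so would [u'(0)], but [u'(0) = 4 i eps]. *)
  - destruct (excluded_middle_informative (exists t, u t <> 0)) as [E | N]; [ easy | exfalso ].
    assert (Z : u = fun _ => 0).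
    { apply functional_extensionality. intros t.
      destruct (excluded_middle_informative (u t = 0)) as [E | E]; [ easy | exfalso; apply N; now exists t ]. }
    assert (D := cder_Cderiv _ _ _ (Du 0%R)). rewrite Z, (cder_Cderiv _ _ _ (cder_const 0 0%R)) in D.
    apply (f_equal Im) in D. simpl in D. destruct heps; subst; lra.
  - intros t Nt Nu. unfold PIII_D7_eq. rewrite (cder_Cderiv _ _ _ (DDu t)).
    assert (Nt' := RtoC_neq_0 t Nt).
    assert (E1 := cder_Cderiv _ _ _ (Du t)). rewrite E1.
    (* The derivative of [conj psi] is eliminated at the price of a division by [t]. *)
    assert (Edp : Cconj (dpsi t) = (8 * Cconj (x t) ^ 2 - Cconj (psi t)) / RtoC t).
    { rewrite <- Rpc. field. easy. }
    rewrite Edp.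
    assert (Ut : u t = 2 * Ci * RtoC eps * (RtoC t * psi t * Cconj (x t) ^ 2)) by now rewrite Eu.
    set (U := u t) in *. set (e := RtoC eps) in *. set (Y := psi t) in *. set (s := RtoC t) in *.
    set (X := x t) in *. set (Xc := Cconj X) in *. set (Yc := Cconj Y) in *.
    assert (NX : X * Xc = / 2) by apply Nx.
    (* The two products that still contain [x] are rewritten without it: this one by [|x|^2 = 1/2],
       the next one by recognising a second factor [u], with [eps^2 = 1]. *)
    assert (K1 : 16 * Ci * (X ^ 2 * Yc) * U = - (8 * e * s * (Y * Yc))).
    { rewrite Ut. transitivity (32 * (Ci * Ci) * e * s * (Y * Yc) * ((X * Xc) * (X * Xc))); [ ring | ].
      rewrite CC, NX. field. }
    assert (K2 : 16 * Ci * (Y * Xc ^ 2) * U = 8 * e * U ^ 2 / s).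
    { transitivity (8 * e * U * (2 * Ci * e * (s * Y * Xc ^ 2)) / s).
      - transitivity (16 * Ci * (Y * Xc ^ 2) * U * (e * e)); [ rewrite Ee; ring | field; easy ].
      - rewrite <- Ut. field. easy. }
    set (S := Y * Yc) in *.
    (* A common form of both sides in [t], [|psi|^2] and [u] alone. *)
    transitivity (16 * e * s * S - 4 * s ^ 2 * S ^ 2 * U + 2 * Ci * S * U - 8 * e * U ^ 2 / s).
    + transitivity (- (16 * Ci * (X ^ 2 * Yc) * U) - 16 * Ci * (Y * Xc ^ 2) * U + 2 * Ci * S * U
        + (Ci * Ci) * (- (8) * e * s * S + 4 * s ^ 2 * S ^ 2 * U)).
      { unfold S. field. easy. }
      rewrite K1, K2, CC. ring.
    (* With [u' = 4 i eps - 2 i t |psi|^2 u], the term [(4 i eps)^2 / u] of [u'^2 / u] cancels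
       against [B^2 / u], and [- 4 i eps / t] against [2 A B / t]. These two cancellations are what
       the values of [A] and [B] provide. *)
    + transitivity ((16 * ((Ci * Ci) * (e * e) + e * e) / U - 16 * (Ci * Ci) * e * s * S + 4 * (Ci * Ci) * s ^ 2 * S ^ 2 * U)
         + 2 * Ci * S * U - 8 * e * U ^ 2 / s).
      { rewrite CC, Ee. field. easy. }
      field. auto.
Qed.
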